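(* Let $n\ge 1$ be an integer and let $q$ be a prime power with $q\equiv 1\pmod 4$. The diagonal action of the group $2\times PSp(2n,q)=\langle\zeta\rangle\times PSp(2n,q)$ on $\widehat{\mathcal V}\times\widehat{\mathcal V}$ has orbits exactly $R_0,R_1,\dots,R_{2n+1}$; so these form the relations of a $(2n+1)$-class (symmetric) Schurian association scheme $\mathcal S$ on $\widehat{\mathcal V}$. The same conclusion holds for $2\times P\Sigma Sp(2n,q)=\langle\zeta\rangle\times P\Sigma Sp(2n,q)$, which is therefore the full automorphism group of the association scheme $\mathcal S$ (the group of all permutations of $\widehat{\mathcal V}$ preserving each relation $R_i$).
   Context: Setting. $V$ is a $2n$-dimensional vector space over $\mathbb F_q$ with a nondegenerate alternating bilinear form $B$. $\mathcal V$ is the set of all $n$-dimensional totally isotropic subspaces of $V$. For $X,Y\in\mathcal V$ put $d(X,Y)=n-\dim(X\cap Y)$. $\chi:\mathbb F_q^\times\to\{\pm1\}$ is the quadratic character. For each $X\in\mathcal V$ fix a determinant function $\delta_X$, i.e. a nonzero alternating $n$-linear form $X^n\to\mathbb F_q$. For $X\ne Y$ in $\mathcal V$ with $d(X,Y)=k$, choose bases $x_1,\dots,x_n$ of $X$ and $y_1,\dots,y_n$ of $Y$ such that $x_i=y_i$ for $k<i\le n$ form a basis of $X\cap Y$, and put $$\sigma(X,Y)=\chi\bigl(\delta_X(x_1,\dots,x_n)\,\delta_Y(y_1,\dots,y_n)\det[B(x_i,y_j):1\le i,j\le k]\bigr);$$ this does not depend on the chosen bases, and since $q\equiv1\pmod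 4$ it is symmetric in $X,Y$. Put $\sigma(X,X)=1$. Relations. $\widehat{\mathcal V}=\mathcal V\times\{\pm1\}$, and for $k=0,1,\dots,n$, $$R_k=\{((X,\varepsilon),(Y,\varepsilon')):d(X,Y)=k,\ \varepsilon\varepsilon'=\sigma(X,Y)\},$$ $$R_{2n+1-k}=\{((X,\varepsilon),(Y,\varepsilon')):d(X,Y)=k,\ \varepsilon\varepsilon'=-\sigma(X,Y)\}.$$ Groups. $Sp(2n,q)$ is the group of linear isometries of $B$. $\Sigma Sp(2n,q)$ is the group of semi-isometries: invertible semilinear maps $g$ of $V$, with associated field automorphism $\tau_g\in\mathrm{Aut}\,\mathbb F_q$, such that $B(x^g,y^g)=B(x,y)^{\tau_g}$ for all $x,y\in V$. $PSp(2n,q)=Sp(2n,q)/\langle -I\rangle$ and $P\Sigma Sp(2n,q)=\Sigma Sp(2n,q)/\langle -I\rangle$. Action on $\widehat{\mathcal V}$: for $g\in\Sigma Sp(2n,q)$ and $U\in\mathcal V$ let $\lambda_{g,U}\in\mathbb F_q^\times$ be the scalar with $\delta_{U^g}(u_1^g,\dots,u_n^g)=\lambda_{g,U}\,\delta_U(u_1,\dots,u_n)^{\tau_g}$ for all $u_i\in U$, and put $(U,\varepsilon)^g=(U^g,\chi(\lambda_{g,U})\varepsilon)$; $-I$ acts trivially. $\zeta$ is the permutation $(U,\varepsilon)\mapsto(U,-\varepsilon)$. This gives a faithful action of $\langle\zeta\rangle\times P\Sigma Sp(2n,q)$ on $\widehat{\mathcal V}$. Terminology. A symmetric $d$-class association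 scheme on a finite set $\Omega$ is a partition $R_0,\dots,R_d$ of $\Omega\times\Omega$ into symmetric relations, $R_0$ being the identity, such that for each $i,j,k$ and $(x,y)\in R_k$ the number of $z$ with $(x,z)\in R_i$, $(z,y)\in R_j$ is a constant $p_{ij}^k$. It is Schurian if its relations are the orbits on $\Omega\times\Omega$ of a transitive permutation group on $\Omega$. *)

(* Defs.v *)
From HB Require Import structures.
From mathcomp Require Import all_boot all_fingroup all_solvable.
From mathcomp Require Import all_order all_algebra all_field.
Set Implicit Arguments.
Unset Strict Implicit.
Unset Printing Implicit Defensive.
Import GRing.Theory.
Local Open Scope ring_scope.

Section DiagonalAction.
Variables (aT : finGroupType) (D : {set aT}) (T : finType) (to : action D T).

Definition diag_act (p : T * T) (a : aT) : T * T := (to p.1 a, to p.2 a).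

Lemma diag_act_is_action : is_action D diag_act.
Proof.
split=> [a [x1 x2] [y1 y2] [/act_inj-> /act_inj->] // | [x1 x2] a b Da Db].
by rewrite /diag_act /= !actMin.
Qed.

Canonical diag_action := Action diag_act_is_action.

Definition orbitals (G : {set aT}) : {set {set T * T}} :=
  orbit diag_action G @: [set: T * T].

End DiagonalAction.

Section AssociationSchemes.
Variables (T : finType) (d : nat) (R : 'I_d.+1 -> {set T * T}).

Definition relations : {set {set T * T}} := R @: [set: 'I_d.+1].

Definition symmetric_scheme : Prop :=
  [/\ injective R /\ partition relations [set: T * T],
      R ord0 = [set p | p.1 == p.2],
      forall k x y, (x, y) \in R k -> (y, x) \in R k &
      forall i j k, exists pijk : nat, forall x y, (x, y) \in R k ->
        #|[set z | ((x, z) \in R i) && ((z, y) \in R j)]| = pijk].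

Definition schurian : Prop :=
  exists2 G : {group {perm T}},
    [transitive G, on [set: T] | 'P] & orbitals 'P G = relations.

Definition scheme_aut : {set {perm T}} :=
  [set s : {perm T} | [forall k, forall x, forall y,
    ((s x, s y) \in R k) == ((x, y) \in R k)]].

End AssociationSchemes.

Section FiniteVspace.
Import VectorInternalTheory.
Variables (F : finFieldType) (V : vectType F).
HB.instance Definition _ := Countable.copy {vspace V} (can_type (@vs2mxK F V)).
HB.instance Definition _ : isFinite {vspace V} := CanIsFinite (@vs2mxK F V).

Lemma card_memv (W : {vspace V}) :
  #|[pred v : finvect_type V | v \in W]| = (#|F| ^ \dim W)%N.
Proof.
case: V W => T cV W.
by rewrite -(@card_vspace F (finvect_type (Vector.Pack cV)) cV W); apply: eq_card.
Qed.
End FiniteVspace.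

Section QuadraticCharacter.
Variable F : finFieldType.

(* The sign group {1, -1} is represented by (bool, (+)), with false for 1 and  *)
(* true for -1; on nonzero elements chi is the quadratic character.            *)
Definition chi (a : F) : bool := ~~ [exists b, b ^+ 2 == a].

Definition field_aut (t : {perm F}) : bool :=
  [forall a, forall b, (t (a + b) == t a + t b) && (t (a * b) == t a * t b)].

Lemma chiM a b : a != 0 -> b != 0 -> chi (a * b) = chi a (+) chi b.
Proof.
have [g g0 gen] : exists2 g : F, g != 0 & forall c, c != 0 -> exists k, c = g ^+ k.
  have /cyclicP[x defU] := field_unit_group_cyclic [set: {unit F}]%G.
  exists (val x); first by rewrite -unitfE (valP x).
  move=> c; rewrite -unitfE => Uc.
  have : FinRing.unit F Uc \in <[x]>%g by rewrite -defU inE.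
  by case/cycleP=> k Ek; exists k; rewrite -FinRing.val_unitX -Ek.
have chiX k : chi (g ^+ k) = odd k && chi g.
  case kodd: (odd k) => /=; last first.
    apply/negbTE; rewrite negbK; apply/existsP; exists (g ^+ k./2).
    by rewrite -exprM muln2 -[in X in _ == X](odd_double_half k) kodd.
  congr (~~ _); have Dk: (k = k./2.*2.+1)%N.
    by rewrite -[LHS]odd_double_half kodd.
  apply/existsP/existsP=> -[h /eqP Dh].
    exists (h / g ^+ k./2); rewrite expr_div_n Dh [in g ^+ k]Dk exprS.
    by rewrite -exprM muln2 mulfK // expf_neq0.
  exists (h * g ^+ k./2).
  by rewrite exprMn Dh -exprM muln2 -exprS -Dk.
move=> /gen[k ->] /gen[l ->]; rewrite -exprD !chiX oddD.
by case: (odd k) (odd l) (chi g) => [] [] [].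
Qed.

Section FieldAut.
Variable t : {perm F}.
Hypothesis tP : field_aut t.

Lemma field_autD a b : t (a + b) = t a + t b.
Proof. by have /forallP/(_ a)/forallP/(_ b)/andP[/eqP-> _] := tP. Qed.
Lemma field_autM a b : t (a * b) = t a * t b.
Proof. by have /forallP/(_ a)/forallP/(_ b)/andP[_ /eqP->] := tP. Qed.
Lemma field_aut0 : t 0 = 0.
Proof. by apply: (addIr (t 0)); rewrite -field_autD !add0r. Qed.
Lemma field_aut_eq0 a : (t a == 0) = (a == 0).
Proof. by rewrite -[in LHS]field_aut0 (inj_eq (@perm_inj _ t)). Qed.
Lemma field_autV : field_aut t^-1%g.
Proof.
apply/forallP=> a; apply/forallP=> b.
by apply/andP; split; apply/eqP/(@perm_inj _ t);
   rewrite (field_autD, field_autM) !permKV.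
Qed.
Lemma chi_aut a : chi (t a) = chi a.
Proof.
congr (~~ _); apply/existsP/existsP=> -[b /eqP Db].
  exists (t^-1%g b); apply/eqP/(@perm_inj _ t).
  by rewrite expr2 field_autM !permKV -Db.
by exists (t b); rewrite -Db expr2 field_autM.
Qed.
End FieldAut.

End QuadraticCharacter.

Section DeterminantFunctions.
Variables (F : finFieldType) (V : vectType F) (n : nat) (X : {vspace V}).
Implicit Types (u : {ffun 'I_n -> V}) (d : {ffun 'I_n -> V} -> F).

Definition family_in u : Prop := forall i, u i \in X.

Definition replace u (i : 'I_n) (x : V) : {ffun 'I_n -> V} :=
  [ffun j => if j == i then x else u j].

Definition multilinear_on d : Prop := forall u i a x y,
  family_in u -> x \in X -> y \in X ->
  d (replace u i (a *: x + y)) = a * d (replace u i x) + d (replace u i y).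

Definition alternating_on d : Prop := forall u i j,
  family_in u -> i != j -> u i = u j -> d u = 0.

(* Only the restriction to families of vectors of X is constrained.            *)
Record detfun := DetFun {
  detfun_val :> {ffun 'I_n -> V} -> F;
  detfun_multilinear : multilinear_on detfun_val;
  detfun_alternating : alternating_on detfun_val;
  detfun_neq0 : exists2 u, family_in u & detfun_val u != 0
}.

Lemma replace_in u i x : family_in u -> x \in X -> family_in (replace u i x).
Proof. by move=> Xu Xx j; rewrite ffunE; case: eqP. Qed.

Lemma replace_id u i : replace u i (u i) = u.
Proof. by apply/ffunP=> j; rewrite ffunE; case: eqP => // ->. Qed.

Lemma replaceC u i j x y : i != j ->
  replace (replace u i x) j y = replace (replace u j y) i x.
Proof.
move=> ij; apply/ffunP=> k; rewrite !ffunE.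
by case: eqP => [->|//]; rewrite eq_sym (negbTE ij).
Qed.

Lemma multilinear0 d u i : multilinear_on d -> family_in u ->
  d (replace u i 0) = 0.
Proof.
move=> dM Xu; have := dM u i (-1) 0 0 Xu (mem0v _) (mem0v _).
by rewrite scaler0 addr0 mulN1r addNr.
Qed.

Lemma multilinear_sum d u i m (c : 'I_m -> F) (e : 'I_m -> V) :
  multilinear_on d -> family_in u -> (forall j, e j \in X) ->
  d (replace u i (\sum_j c j *: e j)) = \sum_j c j * d (replace u i (e j)).
Proof.
move=> dM Xu Xe.
suff [] : (\sum_j c j *: e j \in X) /\
  d (replace u i (\sum_j c j *: e j)) = \sum_j c j * d (replace u i (e j)) by [].
elim/big_rec2: _ => [|j a x _ [Xx <-]]; first by rewrite mem0v multilinear0.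
by rewrite memvD ?memvZ // dM.
Qed.

Lemma multilinear_vanish d m (e : 'I_m -> V) :
    multilinear_on d -> (forall j, e j \in X) ->
    (forall x, x \in X -> exists c : 'I_m -> F, x = \sum_j c j *: e j) ->
    (forall f : 'I_n -> 'I_m, d [ffun i => e (f i)] = 0) ->
  forall u, family_in u -> d u = 0.
Proof.
move=> dM Xe span_e d0.
suff vanish k u : (k <= n)%N -> family_in u ->
    (forall i : 'I_n, (k <= i)%N -> exists j, u i = e j) -> d u = 0.
  by move=> u Xu; apply: (vanish n) => // i; rewrite leqNgt ltn_ord.
elim: k u => [|k IHk] u ltkn Xu ue.
  have /fin_all_exists[f uf] : forall i : 'I_n, exists j, u i = e j.
    by move=> i; apply: ue.
  by rewrite -(d0 f); congr (d _); apply/ffunP=> i; rewrite ffunE.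
pose i := Ordinal ltkn; have [c uic] := span_e _ (Xu i).
rewrite -(replace_id u i) uic multilinear_sum // big1 // => j _.
rewrite IHk ?mulr0 ?(ltnW ltkn) //; first exact: replace_in.
move=> l lekl; rewrite ffunE; case: eqP => [_|/eqP neq_li]; first by exists j.
by apply: ue; rewrite ltn_neqAle lekl andbT; apply: contraNneq neq_li => El; apply/eqP/val_inj.
Qed.

Lemma alternating_tperm d u i j : multilinear_on d -> alternating_on d ->
  family_in u -> i != j -> d [ffun k => u (tperm i j k)] = - d u.
Proof.
move=> dM dA Xu ij.
pose D x y := d (replace (replace u i x) j y).
have Dxx x : x \in X -> D x x = 0.
  move=> Xx; apply: (dA _ i j) => //; first by do 2!apply: replace_in => //.
  by rewrite !ffunE eqxx (negbTE ij) eqxx.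
have Dr x y z : x \in X -> y \in X -> z \in X -> D x (y + z) = D x y + D x z.
  move=> Xx Xy Xz; rewrite /D -[y in LHS]scale1r dM ?mul1r //.
  exact: replace_in.
have Dl x y z : x \in X -> y \in X -> z \in X -> D (x + y) z = D x z + D y z.
  move=> Xx Xy Xz; rewrite /D !(replaceC _ _ _ ij) -[x in LHS]scale1r dM ?mul1r //.
  exact: replace_in.
have [Xi Xj] := (Xu i, Xu j).
have Du : D (u i) (u j) = d u by rewrite /D replace_id (replace_id u).
have -> : [ffun k => u (tperm i j k)] = replace (replace u i (u j)) j (u i).
  apply/ffunP=> k; rewrite !ffunE; case: tpermP => [->|->|/eqP ki /eqP kj].
  - by rewrite (negbTE ij) eqxx.
  - by rewrite eqxx.
  by rewrite (negbTE ki) (negbTE kj).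
apply/eqP; rewrite -addr_eq0 -Du; apply/eqP.
have := Dxx (u i + u j) (memvD Xi Xj).
rewrite Dr ?memvD // !Dl // !Dxx // add0r addr0 addrC => <-; first by rewrite addrC.
Qed.

Lemma alternating_perm d u (s : {perm 'I_n}) :
  multilinear_on d -> alternating_on d -> family_in u ->
  d [ffun k => u (s k)] = (-1) ^+ s * d u.
Proof.
move=> dM dA Xu; have [ts -> dts] := prod_tpermP s.
elim: ts dts => [|t ts IHts] /=.
  rewrite big_nil odd_perm1 mul1r => _; congr (d _).
  by apply/ffunP=> k; rewrite ffunE perm1.
case/andP=> dt /IHts {}IHts; rewrite big_cons.
set s' := (\prod_(t <- ts) _)%g in IHts *.
have -> : [ffun k => u ((tperm t.1 t.2 * s')%g k)] =
          [ffun k => [ffun l => u (s' l)] (tperm t.1 t.2 k)].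
  by apply/ffunP=> k; rewrite !ffunE permM.
rewrite alternating_tperm //; last by move=> l; rewrite ffunE.
by rewrite IHts odd_mul_tperm dt addTb signrN mulNr.
Qed.

Lemma alternating_proportional d1 d2 u v : \dim X = n ->
    multilinear_on d1 -> alternating_on d1 ->
    multilinear_on d2 -> alternating_on d2 ->
  family_in u -> family_in v -> d1 u * d2 v = d1 v * d2 u.
Proof.
move=> dimX d1M d1A d2M d2A Xu Xv.
pose e : {ffun 'I_n -> V} := [ffun i : 'I_n => (vbasis X)`_i].
have Xe : family_in e.
  by move=> i; rewrite ffunE vbasis_mem ?mem_nth // size_tuple dimX.
have span_e x : x \in X -> exists c : 'I_n -> F, x = \sum_j c j *: e j.
  move/coord_vbasis=> Dx.
  exists (fun j => coord (vbasis X) (cast_ord (esym dimX) j) x).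
  rewrite [LHS]Dx (reindex (cast_ord (esym dimX))) /=; last first.
    by exists (cast_ord dimX) => j _; rewrite (cast_ordK, cast_ordKV).
  by apply: eq_bigr => j _; rewrite ffunE.
have vanish d w : multilinear_on d -> alternating_on d -> d e = 0 ->
    family_in w -> d w = 0.
  move=> dM dA de0; apply: (multilinear_vanish (e := e)) => // f.
  have Xf : family_in [ffun i => e (f i)] by move=> i; rewrite ffunE.
  have [/injectiveP inj_f | /injectivePn[i [j ij Ef]]] := boolP (injectiveb f).
    have -> : [ffun i => e (f i)] = [ffun i => e (perm inj_f i)].
      by apply/ffunP=> i; rewrite !ffunE permE.
    by rewrite alternating_perm // de0 mulr0.
  by apply: (dA _ i j) => //; rewrite [LHS]ffunE [RHS]ffunE Ef.
have prop_e w : family_in w -> d1 w * d2 e = d1 e * d2 w.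
  move=> Xw; apply/eqP; rewrite -subr_eq0; apply/eqP.
  pose d w := d1 w * d2 e - d1 e * d2 w.
  apply: (vanish d) => // [w1 i a x y Xw1 Xx Xy | w1 i j Xw1 ij Eij |].
  - rewrite /d d1M // d2M // mulrDl !mulrDr opprD addrACA; congr (_ + _).
    by rewrite mulrN !mulrA; congr (_ - _); rewrite (mulrC a).
  - by rewrite /d (d1A w1 i j) // (d2A w1 i j) // mul0r mulr0 subrr.
  exact: subrr.
have [d20 | d2n0] := eqVneq (d2 e) 0; first by rewrite (vanish d2 v) // (vanish d2 u) // !mulr0.
apply: (mulIf d2n0).
by rewrite mulrAC (prop_e u) // [RHS]mulrAC (prop_e v) // mulrAC.
Qed.

End DeterminantFunctions.

Section DualPolarCover.
Variables (F : finFieldType) (V : vectType F) (B : {biscalar V}) (n : nat).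
Local Notation fV := (finvect_type V).
Implicit Types (U : {vspace V}) (t : {perm F}) (g h : {perm fV}).

Definition totally_isotropic U : bool :=
  [forall x : fV, forall y : fV, (x \in U) && (y \in U) ==> (B x y == 0)].

Definition lagr : predArgType :=
  {U : {vspace V} | (\dim U == n) && totally_isotropic U}.
Implicit Types X Y : lagr.

Definition dist X Y : nat := n - \dim (val X :&: val Y).

Definition adapted_bases X Y (x y : {ffun 'I_n -> fV}) : bool :=
  [&& basis_of (val X) (codom x), basis_of (val Y) (codom y),
      [forall i : 'I_n, (dist X Y <= i)%N ==> (x i == y i)] &
      basis_of (val X :&: val Y) [seq x i | i in [pred i : 'I_n | (dist X Y <= i)%N]]].

(* A permutation g acts on the right: x^g is g x, and (g * h) x = h (g x). *)
Definition semi_isometry t g : bool :=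
  [&& field_aut t,
      [forall a : F, forall x, forall y, g (a *: x + y) == t a *: g x + g y] &
      [forall x, forall y, B (g x) (g y) == t (B x y)]].

Definition SigmaSp_set : {set {perm fV}} :=
  [set g | [exists t, semi_isometry t g]].

Definition Sp_set : {set {perm fV}} := [set g | semi_isometry 1%g g].

Definition autF g : {perm F} := odflt 1%g [pick t | semi_isometry t g].

Definition im_space g U : {vspace V} :=
  <<[seq (g u : V) | u in [pred u : fV | u \in U]]>>%VS.

Section SemiIsometry.
Variables (t : {perm F}) (g : {perm fV}).
Hypothesis gP : semi_isometry t g.

Lemma semi_field_aut : field_aut t. Proof. by case/and3P: gP. Qed.

Lemma semi_linear a x y : g (a *: x + y) = t a *: g x + g y.
Proof.
by case/and3P: gP => _ /forallP/(_ a)/forallP/(_ x)/forallP/(_ y)/eqP.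
Qed.

Lemma semi_form x y : B (g x) (g y) = t (B x y).
Proof. by case/and3P: gP => _ _ /forallP/(_ x)/forallP/(_ y)/eqP. Qed.

Lemma semi0 : g 0 = 0.
Proof.
have := semi_linear (-1) 0 0; rewrite scaler0 addr0 => /eqP.
rewrite -{1}[g 0]add0r (inj_eq (addIr _)) eq_sym scaler_eq0.
by rewrite (field_aut_eq0 semi_field_aut) oppr_eq0 oner_eq0 => /eqP.
Qed.

Lemma semiD x y : g (x + y) = g x + g y.
Proof.
have t1 : t 1 = 1.
  apply: (mulfI (x := t 1)).
    by rewrite (field_aut_eq0 semi_field_aut) oner_eq0.
  by rewrite -(field_autM semi_field_aut) !mulr1.
by rewrite -[x in LHS]scale1r semi_linear t1 scale1r.
Qed.

Lemma semiZ a x : g (a *: x) = t a *: g x.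
Proof. by rewrite -[a *: x]addr0 semi_linear semi0 addr0. Qed.

Lemma mem_im_spaceP U v : reflect (exists2 u, u \in U & v = g u) (v \in im_space g U).
Proof.
apply: (iffP idP) => [/coord_span-> | [u Uu ->]]; last first.
  by apply: memv_span; apply: image_f.
elim/big_rec: _ => [|i v' _ [u Uu ->]]; first by exists 0; rewrite ?mem0v ?semi0.
pose s := [seq (g x : V) | x in [pred x : fV | x \in U]].
have /imageP[w Uw ->] : s`_i \in s by rewrite mem_nth // size_image.
set a := coord _ _ _.
exists (t^-1%g a *: w + u); first by rewrite memvD ?memvZ.
by rewrite semi_linear permKV.
Qed.

Lemma mem_im_space U u : (g u \in im_space g U) = (u \in U).
Proof.
apply/mem_im_spaceP/idP => [[w Uw /perm_inj->] //|Uu].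
by exists u.
Qed.

Lemma dim_im_space U : \dim (im_space g U) = \dim U.
Proof.
have q_gt1 : (1 < #|F|)%N := finNzRing_gt1 F.
apply/eqP; rewrite -(eqn_exp2l _ _ q_gt1) -!card_memv.
rewrite -(card_imset [pred v : fV | v \in U] (@perm_inj _ g)); apply/eqP.
apply: eq_card => v; rewrite !inE.
apply/mem_im_spaceP/imsetP => -[u Uu ->]; by exists u.
Qed.

Lemma im_space_isotropic U : totally_isotropic U -> totally_isotropic (im_space g U).
Proof.
move=> isoU; apply/forallP=> x; apply/forallP=> y; apply/implyP=> /andP[].
move=> /mem_im_spaceP[u Uu ->] /mem_im_spaceP[v Uv ->]; rewrite semi_form.
have /forallP/(_ u)/forallP/(_ v)/implyP/(_ _)/eqP-> := isoU; last by rewrite Uu.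
by rewrite (field_aut0 semi_field_aut).
Qed.

End SemiIsometry.

Lemma semi_isometry1 : semi_isometry 1 1.
Proof.
apply/and3P; split; apply/forallP=> a; apply/forallP=> b; rewrite ?perm1 ?eqxx //.
by apply/forallP=> c; rewrite !perm1.
Qed.

Lemma semi_isometryM t s g h :
  semi_isometry t g -> semi_isometry s h -> semi_isometry (t * s) (g * h).
Proof.
move=> gP hP; have [tP sP] := (semi_field_aut gP, semi_field_aut hP).
apply/and3P; split; apply/forallP=> a; apply/forallP=> b.
- by rewrite !permM !(field_autD, field_autM) // !eqxx.
- by apply/forallP=> c; rewrite !permM (semi_linear gP) (semi_linear hP).
by rewrite !permM (semi_form hP) (semi_form gP).
Qed.

Lemma group_set_Sp : group_set Sp_set.
Proof.
apply/group_setP; split=> [|g h]; rewrite !inE; first exact: semi_isometry1.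
by move=> gP hP; have := semi_isometryM gP hP; rewrite mulg1.
Qed.
Canonical Sp := Group group_set_Sp.

Lemma group_set_SigmaSp : group_set SigmaSp_set.
Proof.
apply/group_setP; split=> [|g h]; rewrite !inE.
  by apply/existsP; exists 1%g; apply: semi_isometry1.
case/existsP=> t gP /existsP[s hP]; apply/existsP; exists (t * s)%g.
exact: semi_isometryM.
Qed.
Canonical SigmaSp := Group group_set_SigmaSp.

Lemma autFP g : g \in SigmaSp -> semi_isometry (autF g) g.
Proof.
by rewrite inE /autF => /existsP[t gP]; case: pickP => //= /(_ t); rewrite gP.
Qed.

Definition negV : {perm fV} := perm (@oppr_inj fV).

Definition PSp := (Sp / <[negV]>)%g.
Definition PSigmaSp := (SigmaSp / <[negV]>)%g.
Canonical PSp_group := Eval hnf in [group of PSp].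
Canonical PSigmaSp_group := Eval hnf in [group of PSigmaSp].

(* The default value U is only used when g is not a semi-isometry, see         *)
(* val_lagr_im.                                                                *)
Definition lagr_im g (U : lagr) : lagr := insubd U (im_space g (val U)).

Lemma val_lagr_im g (U : lagr) :
  g \in SigmaSp -> val (lagr_im g U) = im_space g (val U).
Proof.
move/autFP=> gP; rewrite val_insubd ifT // (dim_im_space gP).
by have /andP[-> /(im_space_isotropic gP)] := valP U.
Qed.

Variable delta : forall X : lagr, detfun n (val X).

(* sigma and the second component of cover are signs encoded as for chi.       *)
(* The bases of the definition of sigma are chosen by pick; they always exist, *)
(* so the None branch is never reached.                                        *)
Definition sigma X Y : bool :=
  if X == Y then false else
  if [pick xy : {ffun 'I_n -> fV} * {ffun 'I_n -> fV} |
        adapted_bases X Y xy.1 xy.2] is Some (x, y) then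
    let i0 := widen_ord (leq_subr (\dim (val X :&: val Y)) n) in
    chi (delta X x * delta Y y *
         \det (\matrix_(i < dist X Y, j < dist X Y) B (x (i0 i)) (y (i0 j))))
  else false.

Definition cover : predArgType := (lagr * bool)%type.

Definition cover_rel (i : 'I_(n.*2.+2)) : {set cover * cover} :=
  if (i <= n)%N then
    [set p : cover * cover | (dist p.1.1 p.2.1 == i) &&
                             (p.1.2 (+) p.2.2 == sigma p.1.1 p.2.1)]
  else
    [set p : cover * cover | (dist p.1.1 p.2.1 == n.*2.+1 - i)%N &&
                             (p.1.2 (+) p.2.2 == ~~ sigma p.1.1 p.2.1)].

Definition lambda g (U : lagr) : F :=
  odflt 1 [pick l : F | (l != 0) &&
    [forall u : {ffun 'I_n -> fV}, [forall i, u i \in val U] ==>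
       (delta (lagr_im g U) [ffun i => g (u i)] == l * autF g (delta U u))]].

Definition cover_act (x : cover) g : cover :=
  if g \in SigmaSp then (lagr_im g x.1, chi (lambda g x.1) (+) x.2) else x.

Definition gframe g (u : {ffun 'I_n -> V}) : {ffun 'I_n -> V} :=
  [ffun i => g (u i)].

Lemma lambdaP g (U : lagr) : g \in SigmaSp ->
  lambda g U != 0 /\ forall u, family_in (val U) u ->
    delta (lagr_im g U) (gframe g u) = lambda g U * autF g (delta U u).
Proof.
move=> Gg; have gP := autFP Gg; set t := autF g in gP *.
have tP := semi_field_aut gP; have t'P := field_autV tP.
have gUin u : family_in (val U) u -> family_in (val (lagr_im g U)) (gframe g u).
  by move=> Uu i; rewrite val_lagr_im // ffunE (mem_im_space gP).
pose d u := t^-1%g (delta (lagr_im g U) (gframe g u)).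
have g_repl u i x : gframe g (replace u i x) = replace (gframe g u) i (g x).
  by apply/ffunP=> j; rewrite !ffunE; case: eqP.
have dM : multilinear_on (val U) d.
  move=> u i a x y Uu Ux Uy; rewrite /d !g_repl (semi_linear gP).
  rewrite detfun_multilinear ?val_lagr_im ?(mem_im_space gP) //; last first.
    by have := gUin u Uu; rewrite val_lagr_im.
  by rewrite (field_autD t'P) (field_autM t'P) permK.
have dA : alternating_on (val U) d.
  move=> u i j Uu ij Eij; rewrite /d (detfun_alternating _ (gUin u Uu) ij).
    exact: field_aut0.
  by rewrite !ffunE Eij.
have [w Uw dw] : exists2 w, family_in (val U) w & d w != 0.
  have [v gUv dv] := detfun_neq0 (delta (lagr_im g U)).
  have /fin_all_exists[w /all_and2[Uw vw]] i :
      exists u, u \in val U /\ v i = g u.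
    have := gUv i; rewrite val_lagr_im //.
    by case/(mem_im_spaceP gP) => u Uu ->; exists u.
  exists [ffun i => w i]; first by move=> i; rewrite ffunE.
  rewrite /d (field_aut_eq0 t'P); congr (detfun_val _ _ != 0): dv.
  by apply/ffunP=> i; rewrite !ffunE vw.
have dimU : \dim (val U) = n by have /andP[/eqP] := valP U.
have [v Uv dv] := detfun_neq0 (delta U).
have prop u : family_in (val U) u -> d u * delta U v = d v * delta U u.
  move=> Uu; apply: (alternating_proportional dimU dM dA _ _ Uu Uv).
    exact: detfun_multilinear.
  exact: detfun_alternating.
pose c := d v / delta U v.
have c0 : c != 0.
  apply: contraNneq dw => c0; rewrite -(mulIr_eq0 _ (mulIf dv)) prop //.
  by move/eqP: c0; rewrite mulf_eq0 invr_eq0 (negbTE dv) orbF => /eqP->; rewrite mul0r.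
pose good l := (l != 0) && [forall u : {ffun 'I_n -> fV},
   [forall i, u i \in val U] ==>
   (delta (lagr_im g U) [ffun i => g (u i)] == l * t (delta U u))].
have good_tc : good (t c).
  rewrite /good (field_aut_eq0 tP) c0; apply/forallP=> u; apply/implyP=> /forallP Uu.
  apply/eqP/(@perm_inj _ t^-1%g); rewrite (field_autM t'P) !permK.
  by rewrite /c mulrAC -prop // mulfK.
have: good (lambda g U) by rewrite /lambda; case: pickP => //= /(_ (t c)) /idP[].
case/andP=> l0 /forallP gl; split=> // u Uu.
by have /implyP/(_ _)/eqP := gl u; apply; apply/forallP.
Qed.

Lemma chi_lambda g (U : lagr) u : g \in SigmaSp -> family_in (val U) u ->
    delta U u != 0 ->
  [/\ family_in (val (lagr_im g U)) (gframe g u),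
      delta (lagr_im g U) (gframe g u) != 0 &
      chi (delta (lagr_im g U) (gframe g u)) = chi (lambda g U) (+) chi (delta U u)].
Proof.
move=> Gg Uu du; have gP := autFP Gg; have tP := semi_field_aut gP.
have [l0 /(_ u Uu) El] := lambdaP U Gg.
have tdu : autF g (delta U u) != 0 by rewrite (field_aut_eq0 tP).
split; last by rewrite El chiM // chi_aut.
  by move=> i; rewrite val_lagr_im // ffunE (mem_im_space gP).
by rewrite El mulf_neq0.
Qed.

Lemma lagr_imM g h (U : lagr) : g \in SigmaSp -> h \in SigmaSp ->
  lagr_im (g * h) U = lagr_im h (lagr_im g U).
Proof.
move=> Gg Gh; apply: val_inj; rewrite !val_lagr_im ?groupM //; apply/vspaceP=> v.
have [[gP hP] ghP] := (autFP Gg, autFP Gh, autFP (groupM Gg Gh)).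
apply/idP/idP=> [/(mem_im_spaceP ghP)[u Uu ->] |].
  by rewrite permM (mem_im_space hP) (mem_im_space gP).
case/(mem_im_spaceP hP)=> w /(mem_im_spaceP gP)[u Uu ->] ->.
by rewrite -permM (mem_im_space ghP).
Qed.

Lemma cover_act_is_action : is_action SigmaSp cover_act.
Proof.
split=> [g [U e] [U' e'] | [U e] g h Gg Gh].
  rewrite /cover_act; case: ifP => //= Gg [] /(congr1 val).
  rewrite !val_lagr_im // => EU; have gP := autFP Gg.
  have -> : U = U'.
    apply: val_inj; apply/vspaceP=> v.
    by rewrite -[LHS](mem_im_space gP) -[RHS](mem_im_space gP) EU.
  by move/addbI->.
rewrite /cover_act groupM // Gg Gh /= lagr_imM //; congr (_, _).
have [u Uu du] := detfun_neq0 (delta U).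
have [gUu dgu Eg] := chi_lambda Gg Uu du.
have [_ _ Eh] := chi_lambda Gh gUu dgu.
have [_ _] := chi_lambda (groupM Gg Gh) Uu du.
have -> : gframe (g * h) u = gframe h (gframe g u).
  by apply/ffunP=> i; rewrite !ffunE permM.
rewrite lagr_imM // Eh Eg addbA => /addIb <-.
by rewrite addbA.
Qed.
Canonical cover_action := Action cover_act_is_action.

Fact zeta_inj : injective (fun x : cover => (x.1, ~~ x.2)).
Proof. by move=> [U e] [U' e'] /= [-> /negb_inj->]. Qed.
Definition zeta : {perm cover} := perm zeta_inj.

Definition mod_cover_action := (cover_action %% <[negV]>)%act.

(* The groups <zeta> x PSp and <zeta> x PSigmaSp, as external direct products. *)
Definition two_PSp : {set {perm cover} * coset_of <[negV]>} :=
  setX <[zeta]>%g PSp.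
Definition two_PSigmaSp : {set {perm cover} * coset_of <[negV]>} :=
  setX <[zeta]>%g PSigmaSp.
Canonical two_PSp_group := Eval hnf in [group of two_PSp].
Canonical two_PSigmaSp_group := Eval hnf in [group of two_PSigmaSp].

Definition full_act (x : cover) (a : {perm cover} * coset_of <[negV]>) : cover :=
  mod_cover_action (a.1 x) a.2.

Lemma zeta_mod_action x c :
  mod_cover_action (zeta x) c = zeta (mod_cover_action x c).
Proof.
have zeta_act y g : cover_act (zeta y) g = zeta (cover_act y g).
  by rewrite !permE /cover_act /=; case: ifP => //= _; rewrite addbN.
have zeta_fix A y :
  (zeta y \in 'Fix_cover_action(A)%g) = (y \in 'Fix_cover_action(A)%g).
  by apply/afixP/afixP=> fixy g /fixy; rewrite /= zeta_act;
     [apply: perm_inj | move->].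
by rewrite /= /modact zeta_fix; case: ifP => // _; apply: zeta_act.
Qed.

Lemma full_act_is_action : is_action two_PSigmaSp full_act.
Proof.
have zetaX_mod z x c : z \in <[zeta]>%g ->
    mod_cover_action (z x) c = z (mod_cover_action x c).
  case/cycleP=> k ->; elim: k => [|k IHk]; first by rewrite !perm1.
  by rewrite expgSr !permM zeta_mod_action IHk.
split=> [a x y /act_inj/perm_inj // | x [z c] [z' c']].
rewrite !in_setX /= => /andP[_ PGc] /andP[z'zeta PGc'].
by rewrite /full_act /= permM actMin // (zetaX_mod z').
Qed.
Canonical full_action := Action full_act_is_action.

End DualPolarCover.

(* Main.v *)
(** A symplectic frame adapted to a pair (X, Y) of Lagrangian subspaces shows
    that Sp(2n, q) is transitive on pairs at a given distance and, since the
    expression defining sigma does not depend on the adapted bases, that an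
    element g multiplies sigma(X, Y) by chi(lambda_(g,X)) chi(lambda_(g,Y)).
    Together with zeta this gives the orbits.

    For the automorphism group, fix an opposite pair of points of the cover.
    The points opposite to one of them correspond to the symmetric matrices,
    dist becoming the rank of a difference and sigma, on a difference
    a v^T v, becoming chi(a).  An automorphism fixing the pair thus induces a
    permutation phi of the symmetric matrices that preserves ranks and colours
    of rank one differences.  It maps lines S + F v^T v to lines, and on such a
    line it is a field automorphism by Carlitz's theorem; moving a line along
    other lines shows that phi is additive, and then phi(S) = P t(S) P^T (Hua).
    This phi is induced by a semi-isometry, and a Lagrangian is determined by
    its distances to the Lagrangians opposite to a given one.

    Carlitz's theorem (a map f with f(0) = 0, f(1) = 1 that preserves the
    quadratic character of differences is a field automorphism): with
    m = (q-1)/2, (f(x) - f(y))^m = (x - y)^m.  Expanding in y, f^j lies, for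
    suitable j, in the span of the functions (x - y)^m, whose exponents all have
    base p digits at most (p-1)/2.  Products of such functions have no carries
    among their leading exponents, so the leading exponent of f^m is a sum of
    (p-1)/2 copies of those of f, f^p, f^(p^2), etc.; as it is at most m, the
    function f is a monomial with digit sum one, that is a power of Frobenius. *)
From HB Require Import structures.
Require Import Defs.
From mathcomp Require Import all_boot all_fingroup all_solvable.
From mathcomp Require Import all_order all_algebra all_field.
From mathcomp Require Import zify ring.
Import GRing.Theory.
Local Open Scope ring_scope.

Set Implicit Arguments.
Unset Strict Implicit.
Unset Printing Implicit Defensive.

(** * Reduction of exponents modulo #|F| - 1 *)

(** For n = 1 the symmetric matrices form a single line, on which all differences have rank at most
    one: ranks then say nothing about phi, and only the colours can force a field automorphism. The
    condition q = 1 mod 4 makes -1 a square, whence the symmetry of [sigma] and the trivial action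
    of -I. It also gives 2 != 0 and q >= 5, hence a scalar other than 0, 1 and -1, which excludes a
    degenerate solution for the off-diagonal entries in Hua's theorem. The obstacle in Carlitz's
    theorem is cancellation: exponents of products wrap around modulo q - 1, and a leading term may
    be lost. Exponents are therefore ordered by digit sum first, a quantity that is subadditive
    under the reduction and additive in the absence of carries. The partial powers f^j on the way to
    f^m must lie in the span of the (x - y)^m, which needs C(m, j) prime to p; so j runs only
    through numbers whose base p digits are at most (p-1)/2. *)

Section ReducedExponents.
Variables (p e : nat).
Hypotheses (p_gt1 : (1 < p)%N) (e_gt0 : (0 < e)%N).
Local Notation q := (p ^ e)%N.
Local Notation Q := (p ^ e).-1.

(** On a field with q elements [X^(red j)] and [X^j] have the same values. Positive exponents land
    in 1..Q and 0 stays apart, since x^0 and x^Q differ at x = 0. *)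
Definition red (j : nat) : nat := if j == 0%N then 0%N else ((j.-1) %% Q).+1.

Lemma q_gt1 : (1 < q)%N. Proof. by rewrite -{1}(exp1n e) ltn_exp2r. Qed.

Lemma Q_gt0 : (0 < Q)%N. Proof. by have := q_gt1; lia. Qed.

Lemma red_le j : (red j <= j)%N.
Proof. by rewrite /red; case: j => //= j; rewrite ltnS leq_mod. Qed.

Lemma red_leQ j : (red j <= Q)%N.
Proof. by rewrite /red; case: j => //= j; rewrite ltn_mod Q_gt0. Qed.

Lemma red_gt0 j : (0 < red j)%N = (0 < j)%N.
Proof. by case: j. Qed.

Lemma red_id j : (j <= Q)%N -> red j = j.
Proof. by case: j => //= j ltjQ; rewrite /red /= modn_small. Qed.

Lemma red_mod j : red j = j %[mod Q].
Proof. by case: j => //= j; rewrite /red /= -addn1 modnDml addn1. Qed.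

Lemma red_uniq a b : (0 < a)%N = (0 < b)%N -> a = b %[mod Q] -> red a = red b.
Proof.
case: a b => [|a] [|b] //= _ Eab; rewrite /red /=; congr _.+1.
by apply/eqP; rewrite -(eqn_modDr 1) !addn1; apply/eqP.
Qed.

Lemma redD a b : red (red a + red b) = red (a + b).
Proof.
apply: red_uniq; first by rewrite !addn_gt0 !red_gt0.
by rewrite -modnDm !red_mod modnDm.
Qed.

Lemma red_leD a b : (red (a + b) <= red a + red b)%N.
Proof. by rewrite -redD red_le. Qed.

Lemma redM c a : red (c * red a) = red (c * a).
Proof.
apply: red_uniq; first by rewrite !muln_gt0 !red_gt0.
by rewrite -modnMmr red_mod modnMmr.
Qed.

Lemma red_expM a : red (q * a) = red a.
Proof.
apply: red_uniq; first by rewrite muln_gt0 expn_gt0 (ltnW p_gt1).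
by rewrite -[q in LHS](prednK (ltnW q_gt1)) mulSn addnC mulnC modnMDl.
Qed.

(** Multiplication by p^i is undone by p^(e-i), as p^e is 1 modulo Q. *)
Lemma red_orbit_inj i a b : (i <= e)%N -> (a <= Q)%N -> (b <= Q)%N ->
  red (p ^ i * a) = red (p ^ i * b) -> a = b.
Proof.
move=> lei aQ bQ Eab.
rewrite -(red_id aQ) -(red_id bQ) -[in LHS]red_expM -[in RHS]red_expM.
have -> : q = (p ^ (e - i) * p ^ i)%N by rewrite -expnD subnK.
by rewrite -!mulnA -[LHS]redM Eab redM.
Qed.

(* The sum of the reductions of j, pj, ..., p^(e-1) j: up to the factor         *)
(* (p^e - 1)/(p - 1), the sum of the base p digits of j.                       *)
Definition orbit_sum (j : nat) : nat := \sum_(i < e) red (p ^ i * j).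
Local Notation S := orbit_sum.

Lemma orbit_sum_red a : S (red a) = S a.
Proof. by apply: eq_bigr => i _; rewrite redM. Qed.

Lemma orbit_sum_leD a b : (S (a + b) <= S a + S b)%N.
Proof. by rewrite /S -big_split; apply: leq_sum => i _; rewrite mulnDr red_leD. Qed.

Lemma orbit_sumMp a : S (p * a) = S a.
Proof.
rewrite /S; case: e e_gt0 (red_expM a) => // e' _ Ea; rewrite big_ord_recr big_ord_recl /=.
rewrite mulnA -expnSr Ea addnC expn0 mul1n; congr (_ + _)%N.
by apply: eq_bigr => i _; rewrite mulnA -expnSr.
Qed.

Lemma orbit_sumMX i a : S (p ^ i * a) = S a.
Proof. by elim: i => [|i IHi]; rewrite ?mul1n // expnS -mulnA orbit_sumMp. Qed.

Definition repunit : nat := \sum_(i < e) p ^ i.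

Lemma repunitE : (p.-1 * repunit)%N = Q.
Proof. by rewrite predn_exp. Qed.

(** Multiplication by p modulo Q rotates the base p digits, and the quotient [d i] is the digit that
    leaves at the top. Summed over a full turn the relation reads p S = Q (sum of d) + S, where Q =
    (p-1) [repunit]. *)
Lemma orbit_sum_digits j : (j <= Q)%N ->
  exists2 d : 'I_e -> nat, forall i : 'I_e,
     (p * red (p ^ i * j) = d i * Q + red (p ^ i.+1 * j))%N
   & S j = (repunit * \sum_i d i)%N.
Proof.
move=> jQ; pose d (i : 'I_e) := ((p * red (p ^ i * j) - red (p ^ i.+1 * j)) %/ Q)%N.
have dE (i : 'I_e) : (p * red (p ^ i * j) = d i * Q + red (p ^ i.+1 * j))%N.
  have le : (red (p ^ i.+1 * j) <= p * red (p ^ i * j))%N.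
    by rewrite expnS -mulnA -redM red_le.
  rewrite /d divnK ?subnK // -eqn_mod_dvd //; apply/eqP.
  by rewrite red_mod -[in LHS]modnMmr red_mod modnMmr mulnA -expnS.
exists d => //.
apply/eqP; rewrite -(eqn_pmul2l (_ : 0 < p.-1)%N); last by lia.
rewrite mulnA repunitE -(eqn_add2r (S j)) -mulSnr prednK; last by lia.
rewrite /S big_distrr /= (eq_bigr _ (fun i _ => dE i)) big_split /= mulnC -big_distrl /=.
rewrite mulnC eqn_add2l -[X in _ == X]orbit_sumMp /S.
by apply/eqP/eq_bigr => i _; rewrite mulnA -expnSr.
Qed.

(** If all digits vanished, each rotation would be a multiplication by p, so p S = S although S >
    0. *)
Lemma orbit_sum_ge j : (0 < j <= Q)%N -> (repunit <= S j)%N.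
Proof.
case/andP=> j0 jQ; have [d dE ->] := orbit_sum_digits jQ.
rewrite leq_pmulr // lt0n; apply/eqP => d0; have := orbit_sum_digits jQ.
have Sj : (0 < S j)%N.
  rewrite /S; case: e e_gt0 => // e' _; rewrite big_ord_recl mul1n.
  by rewrite addn_gt0 red_gt0 j0.
have dz i : d i = 0%N by apply/eqP; move/eqP: d0; rewrite sum_nat_eq0 => /forallP/(_ i).
have : (p * S j = S j)%N.
  rewrite -[RHS]orbit_sumMp /S big_distrr /=; apply: eq_bigr => i _.
  by rewrite dE dz mul0n mulnA -expnSr.
nia.
Qed.

(** Equality leaves a single nonzero digit, equal to 1. *)
Lemma orbit_sum_min j : (j <= Q)%N -> S j = repunit -> exists i, j = (p ^ i)%N.
Proof.
move=> jQ Sj; have [d dE SE] := orbit_sum_digits jQ.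
have r0 : (0 < repunit)%N by have := Q_gt0; rewrite -repunitE muln_gt0 => /andP[].
have d1 : (\sum_i d i = 1)%N by move: SE; rewrite Sj; nia.
have [i di] : exists i, d i != 0%N.
  by apply/existsP; move: d1; case: existsP => // no; rewrite big1 // => i _;
     apply/eqP/negPn/negP => di; case: no; exists i.
have di1 : d i = 1%N by move: d1; rewrite (bigD1 i) //=; lia.
have d0 l : l != i -> d l = 0%N.
  move=> li; move: d1; rewrite (bigD1 i) //= di1 (bigD1 l) //=; lia.
pose r l := red (p ^ l * j).
have rper l : r (l + e)%N = r l.
  by rewrite /r addnC expnD -mulnA red_expM.
(* Past the only index with a nonzero digit, r is multiplied by p each time.   *)
have rS l : (l.+1 < e)%N -> r (i.+1 + l.+1)%N = (p * r (i.+1 + l))%N.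
  move=> ltl; have [lt | ge] := ltnP (i.+1 + l) e.
    rewrite addnS; have := dE (Ordinal lt); rewrite d0 //=.
    by rewrite -val_eqE /=; lia.
  have lt : (i.+1 + l - e < e)%N by have := ltn_ord i; lia.
  have := dE (Ordinal lt); rewrite d0 /=; last by rewrite -val_eqE /=; lia.
  have E1 : (i.+1 + l - e + e = i.+1 + l)%N by lia.
  have E2 : ((i.+1 + l - e).+1 + e = i.+1 + l.+1)%N by lia.
  by rewrite -/(r _) -/(r _) -[r (_ - _)%N]rper -[r _.+1]rper E1 E2 => ->.
have rX l : (l < e)%N -> r (i.+1 + l)%N = (p ^ l * r i.+1)%N.
  elim: l => [|l IHl] ltl; first by rewrite addn0 mul1n.
  by rewrite rS // IHl ?mulnA ?expnS // ltnW.
have ri : r i = (p ^ e.-1 * r i.+1)%N.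
  by rewrite -rX ?prednK // -[LHS]rper; congr r; lia.
have r1 : r i.+1 = 1%N.
  have := dE i; rewrite -/(r _) -/(r _) di1 ri mulnA -expnS prednK // mul1n.
  have := q_gt1; nia.
exists (e.-1 - i)%N; rewrite -[LHS]red_id //.
have -> : red j = r 0%N by rewrite /r mul1n.
have lti := ltn_ord i.
have -> : r 0%N = r (i.+1 + (e.-1 - i))%N by rewrite -rper; congr r; lia.
by rewrite rX ?r1 ?muln1; lia.
Qed.

(** Lexicographic order, by digit sum and then by size. Both parts are subadditive under reduction;
    the second one separates exponents with the same digit sum, so that leading exponents are
    unique. *)
Definition weight (j : nat) : nat := (q * S j + j)%N.

Lemma weight_inj a b : (a <= Q)%N -> (b <= Q)%N -> weight a = weight b -> a = b.
Proof.
move=> aQ bQ /(congr1 (modn^~ q)); rewrite /weight ![(q * _)%N]mulnC !modnMDl.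
by have := q_gt1 => q1; rewrite !modn_small //; lia.
Qed.

Lemma weight_leD a b : (weight (red (a + b)) <= weight a + weight b)%N.
Proof.
rewrite /weight orbit_sum_red addnACA -mulnDr leq_add ?red_le //.
by rewrite leq_mul2l orbit_sum_leD orbT.
Qed.

End ReducedExponents.

(** * Leading exponents of functions on a finite field *)

Lemma logn_fact_widen p n N : prime p -> (n < N)%N ->
  logn p n`! = (\sum_(1 <= k < N) n %/ p ^ k)%N.
Proof.
move=> pr_p ltnN; rewrite logn_fact // [RHS](@big_cat_nat _ _ _ n.+1) //=.
rewrite [X in (_ + X)%N](_ : _ = 0)%N ?addn0 //.
rewrite big_nat_cond big1 // => k /andP[/andP[ltnk _] _].
by rewrite divn_small // (ltn_trans ltnk) // ltn_expl // prime_gt1.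
Qed.

(** A direction of Kummer's theorem: under the condition on residues j and m - j add without carry
    in base p, so the Legendre sums of the three factorials balance term by term. *)
Lemma prime_ndvd_bin p m j : prime p -> (j <= m)%N ->
  (forall k, j %% p ^ k <= m %% p ^ k)%N -> ~~ (p %| 'C(m, j))%N.
Proof.
move=> pr_p lejm le_mod; have pC0 : (0 < 'C(m, j))%N by rewrite bin_gt0.
suff C0 : logn p 'C(m, j) = 0%N.
  by rewrite -[p in (p %| _)%N]expn1 pfactor_dvdn // C0.
have := congr1 (logn p) (bin_fact lejm).
rewrite !lognM ?muln_gt0 ?fact_gt0 // !(@logn_fact_widen p _ m.+1) ?ltnS ?leq_subr //.
rewrite -big_split /= [X in (_ + X)%N = _](_ : _ = \sum_(1 <= k < m.+1) m %/ p ^ k)%N.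
  by rewrite -[RHS]add0n => /addIn.
apply: eq_bigr => k _; rewrite -[in RHS](subnKC lejm).
have pk : (0 < p ^ k)%N by rewrite expn_gt0 prime_gt0.
apply/eqP; rewrite divnD // -[X in X == _]addn0 eqn_add2l eq_sym eqb0 -ltnNge.
have := le_mod k; rewrite -{1}(subnKC lejm) -modnDm.
have := ltn_pmod j pk; have := ltn_pmod (m - j) pk.
set a := (j %% _)%N; set b := (_ %% _)%N; rewrite -/a => bP aP.
have [//|ge le] := ltnP (a + b) (p ^ k).
have : ((a + b) %% p ^ k = a + b - p ^ k)%N.
  by rewrite -[in LHS](subnK ge) modnDr modn_small //; lia.
by move: le; lia.
Qed.

Section ReducedPolynomials.
Variables (F : finFieldType) (p e : nat).
Hypotheses (pr_p : prime p) (e_gt0 : (0 < e)%N) (cardF : #|F| = (p ^ e)%N).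
Local Notation q := (p ^ e)%N.
Local Notation Q := (p ^ e).-1.
Local Notation red := (red p e).
Local Notation weight := (weight p e).
Implicit Types P T : {poly F}.

Let p_gt1 : (1 < p)%N := prime_gt1 pr_p.

Lemma expf_red (x : F) j : x ^+ red j = x ^+ j.
Proof.
case: j => // j; rewrite /red /=; have [-> | x0] := eqVneq x 0.
  by rewrite !expr0n.
have xQ : x ^+ Q = 1.
  apply: (mulfI x0); rewrite mulr1 -exprS prednK ?expn_gt0 ?prime_gt0 //.
  by rewrite -cardF expf_card.
by rewrite [in RHS](divn_eq j Q) !exprS exprD mulnC exprM xQ expr1n mul1r.
Qed.

Lemma poly_eval_inj P T : (size P <= q)%N -> (size T <= q)%N ->
  (forall x, P.[x] = T.[x]) -> P = T.
Proof.
move=> sP sT PT; apply/eqP; rewrite -subr_eq0; apply/negPn/negP => nz.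
have := max_poly_roots nz (rs := enum F).
rewrite enum_uniq -cardE cardF => /(_ _ isT) lt.
have /lt : all (root (P - T)) (enum F).
  by apply/allP=> x _; rewrite /root !hornerE PT subrr.
by rewrite ltnNge (leq_trans (size_polyD _ _)) // geq_max size_polyN sP sT.
Qed.

(** The reduced polynomial of the function x -> P(x)^(p^i). For i = 0 it only reduces the exponents
    of P. *)
Definition conj_poly i P : {poly F} :=
  \sum_(j < size P) P`_j ^+ (p ^ i) *: 'X^(red (p ^ i * j)).

Lemma size_conj_poly i P : (size (conj_poly i P) <= q)%N.
Proof.
apply: (leq_trans (size_sum _ _ _)); apply/bigmax_leqP => j _.
apply: (leq_trans (size_scale_leq _ _)); rewrite size_polyXn.
by have := red_leQ p_gt1 e_gt0 (p ^ i * j); have := q_gt1 p_gt1 e_gt0; lia.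
Qed.

Lemma expr_sum_p (I : Type) (r : seq I) (E : I -> F) i :
  (\sum_(k <- r) E k) ^+ (p ^ i) = \sum_(k <- r) E k ^+ (p ^ i).
Proof.
have pF := card_finPcharP cardF pr_p.
apply: (big_morph (fun x : F => x ^+ (p ^ i))) => [x y|].
  by rewrite exprDn_pchar // (eq_pnat _ (pcharf_eq pF)) pnatX pnat_id ?orbT.
by rewrite expr0n expn_eq0 -[p == _]negbK -lt0n prime_gt0.
Qed.

Lemma horner_conj_poly i P x : (conj_poly i P).[x] = P.[x] ^+ (p ^ i).
Proof.
rewrite [in RHS]horner_coef expr_sum_p horner_sum; apply: eq_bigr => j _.
by rewrite !hornerE expf_red exprMn mulnC exprM.
Qed.

Lemma coef_conj_poly i P l :
  (conj_poly i P)`_l = \sum_(j < size P | red (p ^ i * j) == l) P`_j ^+ (p ^ i).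
Proof.
rewrite coef_sum [RHS]big_mkcond; apply: eq_bigr => j _.
by rewrite coefZ coefXn eq_sym; case: eqP; rewrite (mulr1, mulr0).
Qed.

Lemma coef_size_le P l : (size P <= q)%N -> P`_l != 0 -> (l <= Q)%N.
Proof.
move=> sP; apply: contraNT; rewrite -ltnNge => ltl.
by rewrite nth_default //; apply: (leq_trans sP); lia.
Qed.

(** Terms cannot cancel: j -> [red (p ^ i * j)] is injective on exponents at most Q. *)
Lemma conj_poly_supp i P j : (i <= e)%N -> (size P <= q)%N -> P`_j != 0 ->
  (conj_poly i P)`_(red (p ^ i * j)) != 0.
Proof.
move=> ie sP Pj; have jQ := coef_size_le sP Pj.
have ltj : (j < size P)%N by rewrite ltnNge; apply: contra Pj => /leq_sizeP->.
rewrite coef_conj_poly (bigD1 (Ordinal ltj)) ?eqxx //= big1 ?addr0 ?expf_neq0 //.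
move=> k /andP[/eqP Ek]; have [Pk | Pk] := eqVneq P`_k 0.
  by rewrite Pk expr0n expn_eq0 -[p == _]negbK -lt0n prime_gt0.
by have /(red_orbit_inj p_gt1 e_gt0 ie (coef_size_le sP Pk) jQ) := Ek => Ekj;
   rewrite -val_eqE /= Ekj eqxx.
Qed.

Lemma conj_poly_supp_inv i P l : (conj_poly i P)`_l != 0 ->
  exists2 j, P`_j != 0 & l = red (p ^ i * j).
Proof.
rewrite coef_conj_poly => nz; have [j /andP[/eqP <- Pj]|no] :=
  pickP [pred j : 'I_(size P) | (red (p ^ i * j) == l) && (P`_j != 0)].
  by exists j.
case/eqP: nz; apply: big1 => j Ej; have := no j; rewrite /= Ej /=.
by move/negbFE/eqP->; rewrite expr0n expn_eq0 -[p == _]negbK -lt0n prime_gt0.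
Qed.

Definition is_lead P j :=
  P`_j != 0 /\ forall l, P`_l != 0 -> l != j -> (weight l < weight j)%N.

Lemma lead_ex P : (size P <= q)%N -> P != 0 -> exists j, is_lead P j.
Proof.
move=> sP P0; have P0s : ((size P).-1 < size P)%N by rewrite prednK ?size_poly_gt0.
pose i0 := Ordinal P0s; have Pi0 : P`_i0 != 0 by rewrite -lead_coefE lead_coef_eq0.
case: (@arg_maxnP _ i0 (fun j => P`_j != 0) (fun j => weight j) Pi0) => j Pj maxj.
exists j; split=> // l Pl neq.
have ltl : (l < size P)%N by rewrite ltnNge; apply: contra Pl => /leq_sizeP->.
rewrite ltn_neqAle [X in _ && X](maxj (Ordinal ltl) Pl) andbT.
apply: contra neq => /eqP/(weight_inj p_gt1 e_gt0)->; rewrite ?(coef_size_le sP) //.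
Qed.

Lemma is_lead_ge P j l : is_lead P j -> P`_l != 0 -> (weight l <= weight j)%N.
Proof.
move=> [_ Lj] Pl; have [-> //|neq] := eqVneq l j.
by apply: ltnW; apply: Lj.
Qed.

(* Exponents whose orbit stays in the lower half: they add without reduction. *)
Definition balanced j := forall i, (i <= e)%N -> ((red (p ^ i * j)).*2 <= Q)%N.

Lemma balanced_leQ j : (j <= Q)%N -> balanced j -> (j.*2 <= Q)%N.
Proof. by move=> jQ /(_ 0%N (leq0n _)); rewrite mul1n red_id. Qed.

Lemma weight_balancedD j k : balanced j -> balanced k ->
  weight (j + k) = (weight j + weight k)%N.
Proof.
move=> bj bk; rewrite /weight addnACA -mulnDr; congr (_ * _ + _)%N.
rewrite /orbit_sum -big_split; apply: eq_bigr => i _; rewrite mulnDr -redD //.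
rewrite red_id //; have := bj i (ltnW (ltn_ord i)); have := bk i (ltnW (ltn_ord i)).
lia.
Qed.

(** By subadditivity every product of terms has weight at most that of j + k, and balancedness makes
    the latter the exact sum of the two leading weights. Only the pair (j, k) reaches it, so its
    coefficient survives. *)
Lemma lead_mul P T j k : (size P <= q)%N -> (size T <= q)%N ->
    balanced j -> balanced k -> is_lead P j -> is_lead T k ->
  is_lead (conj_poly 0 (P * T)) (j + k).
Proof.
move=> sP sT bj bk Lj Lk; have [[Pj _] [Tk _]] := (Lj, Lk).
have [jQ kQ] := (coef_size_le sP Pj, coef_size_le sT Tk).
have jkQ : (j + k <= Q)%N by have := balanced_leQ jQ bj; have := balanced_leQ kQ bk; lia.
have lt_w a b : P`_a != 0 -> T`_b != 0 -> (a, b) != (j, k) ->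
    (weight (red (a + b)) < weight (j + k))%N.
  move=> Pa Tb neq; rewrite weight_balancedD //.
  apply: (leq_ltn_trans (weight_leD _ _ a b)).
  have [wa wb] := (is_lead_ge Lj Pa, is_lead_ge Lk Tb).
  have [Ea | na] := eqVneq a j; last by rewrite -addSn leq_add // (proj2 Lj).
  have [Eb | nb] := eqVneq b k; first by rewrite Ea Eb eqxx in neq.
  by rewrite -addnS leq_add // (proj2 Lk).
have coef_ne s : (P * T)`_s != 0 -> s != (j + k)%N ->
    (weight (red s) < weight (j + k))%N.
  rewrite coefM => nz ne; apply/negPn/negP=> nlt; case/eqP: nz; apply: big1 => a _.
  apply/eqP; rewrite mulf_eq0; apply: contraR nlt; rewrite negb_or => /andP[Pa Tb].
  have Es : s = (a + (s - a))%N by have := ltn_ord a; lia.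
  rewrite [in red s]Es; apply: lt_w => //; apply: contra ne => /eqP[<- <-].
  by rewrite -Es.
have coefE : (P * T)`_(j + k) = P`_j * T`_k.
  have ltj : (j < (j + k).+1)%N by rewrite ltnS leq_addr.
  rewrite coefM (bigD1 (Ordinal ltj)) //= addKn big1 ?addr0 // => a neq.
  apply/eqP; rewrite mulf_eq0; apply/negPn/negP; rewrite negb_or => /andP[Pa Tb].
  have ne : (nat_of_ord a, j + k - a)%N != (j, k).
    by apply: contra neq => /eqP[Ea _]; rewrite -val_eqE /= Ea.
  have := lt_w _ _ Pa Tb ne; rewrite subnKC; last by have := ltn_ord a; lia.
  by rewrite red_id // ltnn.
have nz : (P * T)`_(j + k) != 0 by rewrite coefE mulf_neq0.
split=> [|l /conj_poly_supp_inv[s PTs ->]].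
  have lt : (j + k < size (P * T)%R)%N by rewrite ltnNge; apply: contra nz => /leq_sizeP->.
  rewrite coef_conj_poly (bigD1 (Ordinal lt)) /=; last by rewrite expn0 mul1n red_id.
  rewrite big1 ?addr0 ?expf_neq0 // => s /andP[/eqP Es ne]; apply/eqP/negPn/negP.
  rewrite expr1 => PTs; have := coef_ne s PTs ne.
  by rewrite mul1n in Es; rewrite Es ltnn.
rewrite mul1n => neq; apply: coef_ne => //.
by apply: contra neq => /eqP->; rewrite red_id.
Qed.

End ReducedPolynomials.

(** * Carlitz's theorem *)

Section Carlitz.
Variables (F : finFieldType) (f : F -> F).
Hypotheses (two_neq0 : 2%:R != 0 :> F) (f0 : f 0 = 0) (f1 : f 1 = 1).
Hypothesis f_chi : forall a b, a != b -> f a != f b /\ chi (f a - f b) = chi (a - b).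

Section WithCharacteristic.
Variables (p e : nat).
Hypotheses (pr_p : prime p) (e_gt0 : (0 < e)%N) (cardF : #|F| = (p ^ e)%N).
Local Notation q := (p ^ e)%N.
Local Notation Q := (p ^ e).-1.
Local Notation m := (p ^ e).-1./2.
Local Notation h := p.-1./2.
Local Notation red := (red p e).
Local Notation weight := (weight p e).
Local Notation conj_poly := (conj_poly p e).
Local Notation balanced := (balanced p e).
Local Notation is_lead := (is_lead p e).

Let p_gt1 : (1 < p)%N := prime_gt1 pr_p.
Let pF : p \in [pchar F] := card_finPcharP cardF pr_p.

Lemma odd_char : odd p.
Proof.
have [p2 | //] := even_prime pr_p.
by case/eqP: two_neq0; rewrite -p2; apply: pcharf0.
Qed.

Lemma half_p : (h.*2 = p.-1)%N.
Proof. by have := odd_char; lia. Qed.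

Lemma half_Q : (m.*2 = Q)%N.
Proof.
have: odd q by rewrite oddX odd_char orbT.
by have := q_gt1 p_gt1 e_gt0; lia.
Qed.

Lemma m_gt0 : (0 < m)%N.
Proof. by have := half_Q; have := Q_gt0 p_gt1 e_gt0; lia. Qed.

Lemma expQ (x : F) : x != 0 -> x ^+ Q = 1.
Proof.
move=> x0; apply: (mulfI x0); rewrite mulr1 -exprS prednK ?expn_gt0 ?prime_gt0 //.
by rewrite -cardF expf_card.
Qed.

(** From Euler's criterion: a b is a square c^2, so a^m b^m = c^Q = 1 = b^m b^m. *)
Lemma exp_half_chi (a b : F) : a != 0 -> b != 0 -> chi a = chi b -> a ^+ m = b ^+ m.
Proof.
move=> a0 b0 Eab; have : ~~ chi (a * b) by rewrite chiM // Eab addbb.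
rewrite negbK => /existsP[c Ec].
have c0 : c != 0 by apply: contraTneq Ec => ->; rewrite expr0n eq_sym mulf_neq0.
move/eqP: Ec => Ec.
have : a ^+ m * b ^+ m = b ^+ m * b ^+ m.
  by rewrite -exprMn -Ec -exprD -exprM mul2n addnn half_Q !expQ.
by apply: mulIf; rewrite expf_neq0.
Qed.

Lemma f_exp_half x y : (f x - f y) ^+ m = (x - y) ^+ m.
Proof.
have [-> | neq] := eqVneq x y; first by rewrite !subrr.
by have [neqf Ef] := f_chi neq; apply: exp_half_chi; rewrite ?subr_eq0.
Qed.

Lemma f_inj : injective f.
Proof.
move=> a b Eab; apply/eqP/negPn/negP => /f_chi[].
by rewrite Eab eqxx.
Qed.

(** An m-th power is 0, 1 or -1, and p^i is odd. *)
Lemma frob_exp_half (a : F) i : (a ^+ m) ^+ (p ^ i) = a ^+ m.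
Proof.
have [-> | a0] := eqVneq a 0.
  by rewrite expr0n eqn0Ngt m_gt0 expr0n expn_eq0 [p == _]eqn0Ngt prime_gt0.
have : odd (p ^ i) by rewrite oddX odd_char orbT.
move: (p ^ i)%N => r odd_r; rewrite -(odd_double_half r) odd_r add1n exprS.
by rewrite -mul2n (exprM _ 2) -(exprM _ m) muln2 half_Q expQ // expr1n mulr1.
Qed.

Lemma interpolation : exists2 P : {poly F}, (size P <= q)%N & forall x, P.[x] = f x.
Proof.
(* The function 1 - (x - a)^Q is the indicator of a. *)
exists (\sum_a f a *: (1 - ('X - a%:P) ^+ Q)).
  apply: (leq_trans (size_sum _ _ _)); apply/bigmax_leqP => a _.
  apply: (leq_trans (size_scale_leq _ _)); apply: (leq_trans (size_polyD _ _)).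
  rewrite size_polyN size_exp_XsubC size_poly1 prednK ?geq_max ?leqnn ?andbT //.
    by rewrite expn_gt0 prime_gt0.
  by rewrite expn_gt0 prime_gt0.
move=> x; rewrite horner_sum (bigD1 x) //= big1 ?addr0 => [|a ne].
  by rewrite !hornerE subrr expr0n eqn0Ngt Q_gt0 // subr0 mulr1.
by rewrite !hornerE expQ ?subrr ?mulr0 // subr_eq0 eq_sym.
Qed.

(** The function (x - y)^m is fixed by Frobenius, so its support is stable under multiplication by p
    modulo Q; and its degree is m = Q/2. *)
Lemma balanced_XsubC_exp y l : (('X - y%:P : {poly F}) ^+ m)`_l != 0 -> balanced l.
Proof.
move=> nz i ie.
have sX : (size (('X - y%:P : {poly F}) ^+ m) <= q)%N.
  by rewrite size_exp_XsubC; have := half_Q; have := Q_gt0 p_gt1 e_gt0; lia.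
have E : conj_poly i (('X - y%:P) ^+ m) = ('X - y%:P) ^+ m.
  apply: (poly_eval_inj cardF) => //; first exact: size_conj_poly.
  by move=> x; rewrite (horner_conj_poly pr_p cardF) !hornerE frob_exp_half.
have := conj_poly_supp pr_p e_gt0 cardF ie sX nz; rewrite E.
rewrite -[X in (_ <= X)%N]half_Q leq_double => nz'; rewrite leqNgt; apply: contra nz' => lt.
by rewrite nth_default // size_exp_XsubC.
Qed.

Variable P : {poly F}.
Hypotheses (sP : (size P <= q)%N) (Pf : forall x, P.[x] = f x).

Definition rep_exp k := conj_poly 0 (P ^+ k).

Lemma size_rep_exp k : (size (rep_exp k) <= q)%N.
Proof. exact: size_conj_poly. Qed.

Lemma horner_rep_exp k x : (rep_exp k).[x] = f x ^+ k.
Proof. by rewrite (horner_conj_poly pr_p cardF) horner_exp Pf expr1. Qed.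

(* f^k is a combination of the functions (f x - f y)^m = (x - y)^m.            *)
Lemma balanced_rep_exp k l : (k <= m)%N -> ~~ (p %| 'C(m, k))%N ->
  (rep_exp k)`_l != 0 -> balanced l.
Proof.
move=> km pC nz i ie; rewrite leqNgt; apply/negP => lt.
have unb y : (('X - y%:P : {poly F}) ^+ m)`_l = 0.
  apply/eqP/negPn/negP => /balanced_XsubC_exp/(_ i ie).
  by rewrite leqNgt lt.
(* The coefficient of X^l in (f x - f y)^m, as a polynomial in z = - f y. Since f is bijective, z
   takes all values; T vanishes everywhere and has degree below q, so each coefficient is 0, in
   particular the one at m - k. *)
pose T : {poly F} := \poly_(j < m.+1) ((rep_exp (m - j))`_l *+ 'C(m, m - j)).
have T0 : T = 0.
  apply: (poly_eval_inj cardF) => [||z]; last 1 first.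
  - have [g _ fg] := injF_bij f_inj; rewrite horner0 -[z]opprK -(fg (- z)).
    move: (g (- z)) => y.
    have E : \sum_(j < m.+1) ((- f y) ^+ j *+ 'C(m, j)) *: rep_exp (m - j)
             = ('X - y%:P) ^+ m.
      apply: (poly_eval_inj cardF) => [||x].
      - apply: (leq_trans (size_sum _ _ _)); apply/bigmax_leqP => j _.
        exact: (leq_trans (size_scale_leq _ _) (size_rep_exp _)).
      - by rewrite size_exp_XsubC; have := half_Q; have := Q_gt0 p_gt1 e_gt0; lia.
      rewrite !hornerE -f_exp_half exprDn horner_sum; apply: eq_bigr => j _.
      by rewrite hornerZ horner_rep_exp mulrC mulrnAr.
    rewrite horner_poly -[RHS](unb y) -E coef_sum; apply: eq_bigr => j _.
    rewrite coefZ mulrC mulrnAr mulrnAl bin_sub //.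
    by have := ltn_ord j; lia.
  - apply: (leq_trans (size_poly _ _)).
    by have := half_Q; have := Q_gt0 p_gt1 e_gt0; lia.
  - by rewrite size_poly0.
have := congr1 (fun A : {poly F} => A`_(m - k)) T0.
rewrite coef_poly coef0 ltnS leq_subr subKn // => /eqP.
rewrite -mulr_natr mulf_eq0 (negbTE nz) /=.
by rewrite -(dvdn_pcharf pF) (negbTE pC).
Qed.

(** [h * rep1 i] has i base p digits, all equal to h; for i = e it is m. *)
Definition rep1 i := (\sum_(l < i) p ^ l)%N.

Lemma rep1E i : (h * rep1 i).*2 = (p ^ i).-1.
Proof. by rewrite doubleMl half_p predn_exp. Qed.

Lemma rep1S i : rep1 i.+1 = (rep1 i + p ^ i)%N.
Proof. exact: big_ord_recr. Qed.

Lemma rep1D i j : rep1 (i + j) = (rep1 i + p ^ i * rep1 j)%N.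
Proof.
elim: j => [|j IHj]; first by rewrite addn0 /(rep1 0) big_ord0 muln0 addn0.
by rewrite addnS !rep1S IHj mulnDr expnD addnA.
Qed.

Lemma mE : m = (h * rep1 e)%N.
Proof. by apply: double_inj; rewrite half_Q rep1E. Qed.

Lemma chain_mod i k l : (k <= h)%N ->
  ((h * rep1 i + k * p ^ i) %% p ^ l <= h * rep1 l)%N.
Proof.
move=> kh; have lt j : (h * rep1 j < p ^ j)%N.
  have := rep1E j; have : (0 < p ^ j)%N by rewrite expn_gt0 prime_gt0.
  by move: (h * rep1 j)%N (p ^ j)%N; lia.
have [li | il] := leqP l i.
  rewrite -(subnKC li) rep1D expnD.
  have -> : (h * (rep1 l + p ^ l * rep1 (i - l)) + k * (p ^ l * p ^ (i - l)) =
            (h * rep1 (i - l) + k * p ^ (i - l)) * p ^ l + h * rep1 l)%N by ring.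
  by rewrite modnMDl leq_mod.
apply: (leq_trans (leq_mod _ _)); rewrite -(subnKC il) rep1D rep1S.
apply: leq_trans (_ : h * (rep1 i + p ^ i) <= _)%N.
  by rewrite mulnDr leq_add2l leq_mul2r kh orbT.
by rewrite leq_mul2l leq_addr orbT.
Qed.

(** In base p, j consists of i digits h followed by a top digit k <= h, while all digits of m are h.
    Hence j is dominated by m digit by digit, and [balanced_rep_exp] applies to f^j. *)
Lemma chain_bin i k : (i < e)%N -> (k <= h)%N ->
  let j := (h * rep1 i + k * p ^ i)%N in (j <= m)%N /\ ~~ (p %| 'C(m, j))%N.
Proof.
move=> ie kh j; have jm : (j <= m)%N.
  rewrite mE -(subnKC ie) rep1D mulnDr rep1S; apply: (leq_trans _ (leq_addr _ _)).
  by rewrite mulnDr leq_add2l leq_mul2r kh orbT.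
split=> //; apply: prime_ndvd_bin => // l.
have [le | lt] := leqP l e.
  apply: leq_trans (chain_mod i l kh) _.
  rewrite mE -(subnKC le) rep1D mulnDr mulnCA addnC [(p ^ l * _)%N]mulnC modnMDl.
  rewrite modn_small //; have := rep1E l; have : (0 < p ^ l)%N by rewrite expn_gt0 prime_gt0.
  by move: (h * rep1 l)%N (p ^ l)%N; lia.
rewrite [in X in (_ <= X)%N]modn_small ?(leq_trans (leq_mod _ _)) //.
have le_q : (q <= p ^ l)%N by rewrite leq_exp2l // ltnW.
by have := half_Q; have := q_gt1 p_gt1 e_gt0; lia.
Qed.

Lemma h_gt0 : (0 < h)%N.
Proof. by have := half_p; have := odd_char; have := p_gt1; lia. Qed.

Lemma conj_rep_exp i k :
  rep_exp (k + p ^ i) = conj_poly 0 (rep_exp k * conj_poly i P).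
Proof.
apply: (poly_eval_inj cardF); try exact: size_conj_poly.
move=> x; rewrite horner_rep_exp (horner_conj_poly pr_p cardF) hornerM horner_rep_exp.
by rewrite (horner_conj_poly pr_p cardF) Pf expr1 exprD.
Qed.

Lemma P_rep_exp : P = rep_exp 1.
Proof.
apply: (poly_eval_inj cardF) => // [|x]; first exact: size_conj_poly.
by rewrite horner_rep_exp expr1.
Qed.

Lemma balanced_suppP j : P`_j != 0 -> balanced j.
Proof.
have [_] := chain_bin e_gt0 h_gt0; rewrite /rep1 big_ord0 muln0 mul1n => pC.
by rewrite [in P`_j]P_rep_exp; apply: balanced_rep_exp => //; apply: m_gt0.
Qed.

Lemma balanced_supp_conj i j : (i <= e)%N -> (conj_poly i P)`_j != 0 -> balanced j.
Proof.
move=> ie /(conj_poly_supp_inv pr_p)[l /balanced_suppP bl ->] k ke.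
rewrite redM mulnA -expnD; have [le | lt] := leqP (k + i) e.
  exact: bl.
rewrite -(subnKC (ltnW lt)) expnD -mulnA (red_expM p_gt1 e_gt0).
by apply: bl; lia.
Qed.

Lemma leads_conj : exists N : nat -> nat, forall i, (i < e)%N -> is_lead (conj_poly i P) (N i).
Proof.
have /fin_all_exists[N LN] (i : 'I_e) : exists j, is_lead (conj_poly i P) j.
  apply: (lead_ex pr_p e_gt0 cardF); first exact: size_conj_poly.
  apply/eqP => /(congr1 (fun A : {poly F} => A.[1])).
  rewrite (horner_conj_poly pr_p cardF) Pf f1 expr1n horner0.
  by apply/eqP; apply: oner_neq0.
exists (fun i => oapp N 0%N (insub i)) => i ie.
by rewrite insubT /=; apply: (LN (Ordinal ie)).
Qed.

(** The conjugates are multiplied in order, each h times. Every partial exponent is covered by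
    [chain_bin], so both factors are balanced and [lead_mul] adds the leading exponents. *)
Lemma lead_chain (N : nat -> nat) :
    (forall i, (i < e)%N -> is_lead (conj_poly i P) (N i)) ->
  forall i, (i <= e)%N -> is_lead (rep_exp (h * rep1 i)) (h * \sum_(l < i) N l).
Proof.
move=> LN; elim=> [_ | i IHi ie].
  rewrite /rep1 !big_ord0 muln0.
  have -> : rep_exp 0 = 1.
    apply: (poly_eval_inj cardF) => [||x]; first exact: size_conj_poly.
      by rewrite size_poly1 expn_gt0 prime_gt0.
    by rewrite horner_rep_exp expr0 hornerE.
  by split=> [|l]; rewrite coef1 ?oner_neq0 //; case: l => //=; rewrite eqxx.
have chain k : (k <= h)%N ->
    is_lead (rep_exp (h * rep1 i + k * p ^ i)) (h * \sum_(l < i) N l + k * N i).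
  elim: k => [|k IHk] kh; first by rewrite !addn0; apply/IHi/ltnW.
  have [jm pC] := chain_bin ie (ltnW kh); have Lk := IHk (ltnW kh).
  rewrite !mulSnr !addnA conj_rep_exp; have Li := LN i ie.
  apply: (lead_mul pr_p e_gt0 cardF) => //; try exact: size_conj_poly.
    exact: balanced_rep_exp jm pC (proj1 Lk).
  exact: balanced_supp_conj (ltnW ie) (proj1 Li).
by have := chain h (leqnn h); rewrite -!mulnDr -rep1S big_ord_recr.
Qed.

Lemma frobenius_form : exists i, forall x, f x = x ^+ (p ^ i).
Proof.
have [N LN] := leads_conj; have Lm := lead_chain LN (leqnn e).
(* The leading exponent of f^m is h times this sum; being balanced, its double is at most Q = 2 h
   [repunit]. *)
have sumN : (\sum_(i < e) N i <= repunit p e)%N.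
  have [le pC] := chain_bin (i := e.-1) (k := h) ltac:(by rewrite prednK) (leqnn h).
  have E : (h * rep1 e.-1 + h * p ^ e.-1 = h * rep1 e)%N.
    by rewrite -mulnDr -rep1S prednK.
  have := balanced_rep_exp le pC; rewrite E => /(_ _ (proj1 Lm)) bal.
  have := balanced_leQ (coef_size_le pr_p e_gt0 cardF (size_rep_exp _) (proj1 Lm)) bal.
  rewrite doubleMl half_p -repunitE leq_pmul2l //.
  by have := p_gt1; lia.
have P0 : P != 0.
  apply/eqP => P0; have := Pf 1; rewrite P0 horner0 f1 => /esym/eqP.
  by rewrite oner_eq0.
have [j0 Lj0] := lead_ex pr_p e_gt0 cardF sP P0.
have suppQ j : P`_j != 0 -> (j <= Q)%N by apply: (coef_size_le pr_p e_gt0 cardF).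
have Smax j : P`_j != 0 -> (orbit_sum p e j <= orbit_sum p e j0)%N.
  move=> Pj; rewrite leqNgt; apply/negP => lt.
  have := is_lead_ge Lj0 Pj; rewrite /weight leqNgt => /negP; apply.
  have : (q * (orbit_sum p e j0).+1 <= q * orbit_sum p e j)%N by rewrite leq_mul2l lt orbT.
  by have := suppQ _ (proj1 Lj0); have := q_gt1 p_gt1 e_gt0; rewrite mulnS; lia.
(* The digit sum of [N i] is at most the maximal one, which j attains. As [N i] has the larger
   weight, the digit sums agree and the sizes compare. *)
have N_ge j i : P`_j != 0 -> orbit_sum p e j = orbit_sum p e j0 -> (i < e)%N ->
    (red (p ^ i * j) <= N i)%N.
  move=> Pj Sj ie; have Li := LN i ie.
  have nz := conj_poly_supp pr_p e_gt0 cardF (ltnW ie) sP Pj.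
  have := is_lead_ge Li nz; have [l Pl Nl] := conj_poly_supp_inv pr_p (proj1 Li).
  rewrite /weight orbit_sum_red (orbit_sumMX p_gt1 e_gt0) Sj.
  have : (orbit_sum p e (N i) <= orbit_sum p e j0)%N.
    by rewrite Nl orbit_sum_red (orbit_sumMX p_gt1 e_gt0) Smax.
  move=> leS; have : (q * orbit_sum p e (N i) <= q * orbit_sum p e j0)%N.
    by rewrite leq_mul2l leS orbT.
  lia.
have S0 : (orbit_sum p e j0 <= repunit p e)%N.
  apply: leq_trans sumN; apply: leq_sum => i _; apply: N_ge => //.
  exact: proj1 Lj0.
(* The bounds now meet: the terms of [orbit_sum] for j are at most the [N i], with the same total.
   Equality at i = 0 gives j = [N 0], so only one positive exponent occurs. *)
have S_supp j : (0 < j)%N -> P`_j != 0 -> orbit_sum p e j = repunit p e /\ j = N 0%N.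
  move=> j0' Pj; have ge : (repunit p e <= orbit_sum p e j)%N.
    by apply: (orbit_sum_ge p_gt1 e_gt0); rewrite j0' suppQ.
  have le := Smax j Pj; have Sj : orbit_sum p e j = orbit_sum p e j0 by lia.
  have SjE : orbit_sum p e j = repunit p e by lia.
  split=> //; have le0 := N_ge j 0%N Pj Sj e_gt0.
  rewrite mul1n (red_id (suppQ j Pj)) in le0.
  apply/eqP; rewrite eqn_leq le0 /=; move: sumN; rewrite -SjE /orbit_sum.
  rewrite (bigD1 (Ordinal e_gt0)) //= [X in (_ <= X)%N](bigD1 (Ordinal e_gt0)) //=.
  rewrite mul1n (red_id (suppQ j Pj)).
  set A := (X in (_ + X <= _)%N); set B := (X in (_ <= _ + X)%N).
  suff : (B <= A)%N by lia.
  by apply: leq_sum => i _; apply: N_ge.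
have P00 : P`_0 = 0 by rewrite -horner_coef0 Pf.
have [j Pj] : exists j, P`_j != 0 by exists j0; apply: proj1 Lj0.
have jgt0 : (0 < j)%N by case: j Pj => //; rewrite P00 eqxx.
have [Sj jN] := S_supp j jgt0 Pj.
have PE : P = P`_j *: 'X^j.
  apply/polyP => l; rewrite coefZ coefXn.
  have [-> | neq] := eqVneq l j; first by rewrite mulr1.
  rewrite mulr0; apply/eqP/negPn/negP => Pl; case/eqP: neq.
  have lgt0 : (0 < l)%N by case: l Pl => //; rewrite P00 eqxx.
  by have [_ ->] := S_supp l lgt0 Pl.
have Pj1 : P`_j = 1 by have := Pf 1; rewrite PE !hornerE expr1n mulr1 f1 coefZ coefXn eqxx mulr1.
have [i Ej] := orbit_sum_min p_gt1 e_gt0 (suppQ j Pj) Sj.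
by exists i => x; rewrite -Pf PE Pj1 scale1r hornerXn -Ej.
Qed.

End WithCharacteristic.

Lemma carlitz : exists2 t : {perm F}, field_aut t & f =1 t.
Proof.
have [p pr_p pF] := finPcharP F.
have cardF := card_pprimeChar pF.
set e := logn p _ in cardF; have e_gt0 : (0 < e)%N.
  by rewrite lt0n; apply: contraTneq (finNzRing_gt1 F) => e0; rewrite cardF e0.
have [P sP Pf] := interpolation pr_p e_gt0 cardF.
have [i fE] := frobenius_form pr_p e_gt0 cardF sP Pf.
exists (perm f_inj) => [|x]; last by rewrite permE.
apply/forallP => a; apply/forallP => b; rewrite !permE !fE exprMn eqxx andbT.
rewrite exprDn_pchar // (eq_pnat _ (pcharf_eq pF)) pnatX pnat_id ?orbT //.
Qed.

End Carlitz.

(** * Symmetric matrices and the adjacency of rank one differences *)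

Section RankOneSymmetric.
Variables (F : finFieldType) (n : nat).
Implicit Types (S T M : 'M[F]_n) (u v w x y z : 'rV[F]_n) (a b c : F).

Definition sq v : 'M[F]_n := \matrix_(i, j) (v 0 i * v 0 j).
Definition symmx M := M^T = M.
Definition dot u v : F := \sum_i u 0 i * v 0 i.
Definition bform M x y : F := \sum_i \sum_j x 0 i * M i j * y 0 j.
Definition par u v := [forall i, forall j, u 0 i * v 0 j == u 0 j * v 0 i].

Lemma sq_mulmx v : sq v = v^T *m v.
Proof. by apply/matrixP => i j; rewrite !mxE big_ord1 mxE. Qed.

Lemma sqZ c v : sq (c *: v) = c ^+ 2 *: sq v.
Proof. by apply/matrixP => i j; rewrite !mxE; ring. Qed.

Lemma sym_sq v : symmx (sq v).
Proof. by apply/matrixP => i j; rewrite !mxE mulrC. Qed.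

Lemma sym0 : symmx 0. Proof. exact: trmx0. Qed.

Lemma symD S T : symmx S -> symmx T -> symmx (S + T).
Proof. by rewrite /symmx linearD /= => -> ->. Qed.

Lemma symZ a S : symmx S -> symmx (a *: S).
Proof. by rewrite /symmx linearZ /= => ->. Qed.

Lemma symDsq S a v : symmx S -> symmx (S + a *: sq v).
Proof. by move=> symS; apply/symD/symZ/sym_sq. Qed.

Lemma symE S i j : symmx S -> S i j = S j i.
Proof. by move=> {1}<-; rewrite mxE. Qed.

Lemma rank_sq a v : (\rank (a *: sq v) <= 1)%N.
Proof. by rewrite sq_mulmx scalemxAr (leq_trans (mulmx_max_rank _ _)). Qed.

Lemma rank1_factor M : (\rank M <= 1)%N ->
  exists u v, forall i j, M i j = u 0 i * v 0 j.
Proof.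
have := mulmx_base M; move: (col_base M) (row_base M); move: (\rank M) => r.
case: r => [|[|//]] A R <- _; last first.
  by exists A^T, R => i j; rewrite mxE big_ord1 mxE.
by exists 0, 0 => i j; rewrite !mxE big_ord0 mul0r.
Qed.

Lemma rank1_minor M i j k l : (\rank M <= 1)%N -> M i j * M k l = M i l * M k j.
Proof. by move=> /rank1_factor[u [v E]]; rewrite !E; ring. Qed.

Lemma bformD M M' x y : bform (M + M') x y = bform M x y + bform M' x y.
Proof.
rewrite /bform -big_split /=; apply: eq_bigr => i _; rewrite -big_split /=.
by apply: eq_bigr => j _; rewrite mxE; ring.
Qed.

Lemma bformZ_sq a w x y : bform (a *: sq w) x y = a * (dot w x * dot w y).
Proof.
rewrite /bform /dot big_distrl mulr_sumr /=; apply: eq_bigr => i _.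
rewrite big_distrr mulr_sumr /=; apply: eq_bigr => j _.
by rewrite !mxE; ring.
Qed.

(** A 2 x 2 minor in arbitrary directions, to be evaluated on dual vectors of two image lines. *)
Lemma rank1_bform M x y x' y' : (\rank M <= 1)%N ->
  bform M x y * bform M x' y' = bform M x y' * bform M x' y.
Proof.
move=> /rank1_factor[u [v E]].
have bE z z' : bform M z z' = dot u z * dot v z'.
  rewrite /bform /dot big_distrl /=; apply: eq_bigr => i _.
  by rewrite big_distrr /=; apply: eq_bigr => j _; rewrite E; ring.
by rewrite !bE; ring.
Qed.

Lemma dotDr u x y : dot u (x + y) = dot u x + dot u y.
Proof. by rewrite -big_split /=; apply: eq_bigr => i _; rewrite mxE; ring. Qed.

Lemma dotZr u c x : dot u (c *: x) = c * dot u x.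
Proof. by rewrite mulr_sumr /=; apply: eq_bigr => i _; rewrite mxE; ring. Qed.

Lemma dot_delta u i : dot u (delta_mx 0 i) = u 0 i.
Proof.
rewrite /dot (bigD1 i) //= mxE !eqxx mulr1 big1 ?addr0 // => j ne.
by rewrite mxE (negbTE ne) mulr0.
Qed.

Lemma par_sym u v : par u v = par v u.
Proof.
by apply/idP/idP => /forallP p; apply/forallP => i; apply/forallP => j;
   have /forallP/(_ i)/eqP E := p j; rewrite mulrC [X in _ == X]mulrC E.
Qed.

Lemma par_scale u v : par u v -> v != 0 -> exists c, u = c *: v.
Proof.
move=> /forallP p /rV0Pn[i vi]; exists (u 0 i / v 0 i); apply/rowP => j.
have /forallP/(_ j)/eqP E := p i.
by rewrite mxE mulrAC E mulfK.
Qed.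

Lemma par0 v : par v 0.
Proof. by apply/forallP => i; apply/forallP => j; rewrite !mxE !mulr0. Qed.

(** The principal 2 x 2 minors of the sum are a b (u_i v_j - u_j v_i)^2. *)
Lemma rank1_par a b u v : a != 0 -> b != 0 ->
  (\rank (a *: sq u + b *: sq v)%R <= 1)%N -> par u v.
Proof.
move=> a0 b0 rk; apply/forallP => i; apply/forallP => j.
have := rank1_minor i i j j rk; rewrite !mxE => /eqP; rewrite -subr_eq0.
rewrite (_ : _ - _ = a * b * (u 0 i * v 0 j - u 0 j * v 0 i) ^+ 2); last by ring.
by rewrite !mulf_eq0 (negbTE a0) (negbTE b0) /= orbb subr_eq0 => /eqP->.
Qed.

Lemma par_rank1 a b u v : par u v -> v != 0 -> (\rank (a *: sq u + b *: sq v)%R <= 1)%N.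
Proof.
by move=> p /(par_scale p)[c ->]; rewrite sqZ scalerA -scalerDl rank_sq.
Qed.

Lemma dual_vector u v : ~~ par u v -> exists x, dot u x = 1 /\ dot v x = 0.
Proof.
rewrite negb_forall => /existsP[i]; rewrite negb_forall => /existsP[j].
rewrite -subr_eq0; set d := _ - _ => d0.
exists (d^-1 *: (v 0 j *: delta_mx 0 i + (- v 0 i) *: delta_mx 0 j)).
rewrite !dotZr !dotDr !dotZr !dot_delta; split; last by ring.
rewrite (_ : _ + _ = d); first by rewrite mulVf.
by rewrite /d; ring.
Qed.

Hypothesis two_neq0 : 2%:R != 0 :> F.

(** sq (u + v) - sq (u - v) is twice u^T v + v^T u, and the double sum counts T and its transpose,
    hence the 4. This makes induction along multiples of squares possible. *)
Lemma polarization T : symmx T -> T = \sum_i \sum_j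
   (T i j / 4%:R *: sq (delta_mx 0 i + delta_mx 0 j)
     + (- (T i j / 4%:R)) *: sq (delta_mx 0 i - delta_mx 0 j)).
Proof.
have four : 4%:R != 0 :> F by rewrite (natrM F 2 2) mulf_neq0.
move=> symT; apply/matrixP => k l; rewrite summxE.
rewrite (eq_bigr (fun i => (i == k)%:R * (T k l / 2%:R) + (i == l)%:R * (T l k / 2%:R))).
  rewrite big_split /= -!mulr_suml /= (bigD1 k) //= [in X in _ + X](bigD1 l) //= !eqxx.
  rewrite !big1 => [|i|i]; try by move=> /negbTE->.
  by rewrite !addr0 !mul1r (symE l k symT) -mulrDl -mulr2n -[T k l *+ 2]mulr_natr mulfK.
move=> i _; rewrite summxE (eq_bigr (fun j => (j == l)%:R * ((i == k)%:R * (T k l / 2%:R))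
  + (j == k)%:R * ((i == l)%:R * (T l k / 2%:R)))).
  rewrite big_split /= -!mulr_suml /= (bigD1 l) //= [in X in _ + X](bigD1 k) //= !eqxx.
  rewrite !big1 => [|j|j]; try by move=> /negbTE->.
  by rewrite !addr0 !mul1r.
move=> j _; rewrite !mxE /= !(eq_sym k) !(eq_sym l).
have -> : 4%:R = 2%:R * 2%:R :> F by rewrite -natrM.
have [ik|ik] := eqVneq i k; have [jk|jk] := eqVneq j k;
have [il|il] := eqVneq i l; have [jl|jl] := eqVneq j l; subst;
  try (match goal with H : is_true (?x != ?x) |- _ => by rewrite eqxx in H end);
  rewrite /=; try (by field; rewrite ?two_neq0).
Qed.

End RankOneSymmetric.

Lemma chi1 (F : finFieldType) : chi (1 : F) = false.
Proof. by apply/negbTE; rewrite negbK; apply/existsP; exists 1; rewrite expr1n. Qed.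

Lemma chi_sqrM (F : finFieldType) (a c : F) : c != 0 -> chi (a * c ^+ 2) = chi a.
Proof.
move=> c0; congr (~~ _); apply/existsP/existsP => -[b /eqP Eb].
  by exists (b / c); rewrite expr_div_n Eb mulfK // expf_neq0.
by exists (b * c); rewrite exprMn Eb.
Qed.

Lemma chi_square (F : finFieldType) (b : F) : chi b = false -> exists c, b = c ^+ 2.
Proof. by move/negbT; rewrite negbK => /existsP[c /eqP <-]; exists c. Qed.

Lemma field_aut_1 (F : finFieldType) (t : {perm F}) : field_aut t -> t 1 = 1.
Proof.
move=> tP; apply: (mulfI (x := t 1)); first by rewrite field_aut_eq0 // oner_neq0.
by rewrite -field_autM // !mulr1.
Qed.

Lemma field_autN (F : finFieldType) (t : {perm F}) a : field_aut t -> t (- a) = - t a.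
Proof. by move=> tP; apply: (addIr (t a)); rewrite -field_autD // !addNr field_aut0. Qed.

(** * Images of lines under maps that preserve ranks and colours *)

Section SymmetricMatrixGeometry.
Variables (F : finFieldType) (n : nat) (phi : 'M[F]_n -> 'M[F]_n).
Implicit Types (S T M : 'M[F]_n) (u v w x y z : 'rV[F]_n) (a b c : F).

Hypothesis two_neq0 : 2%:R != 0 :> F.
Hypothesis phi_rank : forall S T, symmx S -> symmx T ->
  \rank (phi S - phi T)%R = \rank (S - T)%R.
Hypothesis phi_line : forall S T a v, symmx S -> symmx T -> a != 0 -> v != 0 ->
  S - T = a *: sq v ->
  exists b w, [/\ b != 0, w != 0, chi b = chi a & phi S - phi T = b *: sq w].

Lemma scale_sq_inj a b v w : a != 0 -> v != 0 -> a *: sq v = b *: sq w ->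
  b != 0 /\ forall i, w 0 i != 0 -> v 0 i != 0.
Proof.
move=> a0 v0 E; have b0 : b != 0.
  have [i vi] := rV0Pn _ v0; apply: contraNneq vi => b0; move/matrixP/(_ i i): E.
  rewrite b0 scale0r !mxE => /eqP; rewrite !mulf_eq0 (negbTE a0) /= orbb.
  by [].
split=> // i; apply: contraNneq => vi; move/matrixP/(_ i i): E.
rewrite !mxE vi !mulr0 => /esym/eqP; rewrite !mulf_eq0 (negbTE b0) /= orbb.
by [].
Qed.

Lemma phi_on_line S v : symmx S -> v != 0 -> exists w (t : {perm F}),
  [/\ w != 0, field_aut t & forall a, phi (S + a *: sq v) = phi S + t a *: sq w].
Proof.
move=> symS v0; have symSv a : symmx (S + a *: sq v) by apply: symDsq.
have diffE a b : S + a *: sq v - (S + b *: sq v) = (a - b) *: sq v.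
  by rewrite opprD addrACA subrr add0r -scalerBl.
have diff0 a : S + a *: sq v - S = a *: sq v by rewrite addrAC subrr add0r.
have [b [w0 [b0 w00 chib E1]]] := phi_line (symSv 1) symS (oner_neq0 _) v0 (diff0 1).
(* The colour of 1 makes b a square, which is absorbed into w so that f 1 = 1. *)
rewrite chi1 in chib; have [c Ec] := chi_square chib.
have c0 : c != 0 by apply: contraNneq b0 => c0; rewrite Ec c0 expr0n.
pose w := c *: w0; have w0' : w != 0 by rewrite scaler_eq0 negb_or c0 w00.
have {}E1 : phi (S + 1 *: sq v) - phi S = sq w by rewrite E1 sqZ Ec.
clearbody w.
(* The images of a and 1 differ by rank at most one, so their directions from the image of 0 are
   parallel. *)
have on_w a : exists d, phi (S + a *: sq v) - phi S = d *: sq w.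
  have [-> | a0] := eqVneq a 0; first by exists 0; rewrite !scale0r addr0 subrr.
  have [-> | a1] := eqVneq a 1; first by exists 1; rewrite E1 scale1r.
  have [b' [w' [b'0 w'0 _ E]]] := phi_line (symSv a) symS a0 v0 (diff0 a).
  have : (\rank (phi (S + a *: sq v) - phi (S + 1 *: sq v))%R <= 1)%N.
    by rewrite phi_rank // diffE rank_sq.
  rewrite (_ : _ - _ = b' *: sq w' + (-1) *: sq w); last first.
    by rewrite scaleN1r -E -E1 opprB addrA subrK.
  move=> /(rank1_par b'0) p; have {}p : par w' w by apply: p; rewrite oppr_eq0 oner_neq0.
  by have [d Ed] := par_scale p w0'; exists (b' * d ^+ 2); rewrite E Ed sqZ scalerA.
have [i wi] := rV0Pn _ w0'.
pose f a := (phi (S + a *: sq v) - phi S) i i / w 0 i ^+ 2.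
have fE a : phi (S + a *: sq v) - phi S = f a *: sq w.
  have [d E] := on_w a; rewrite [in LHS]E /f E !mxE -expr2 mulfK //.
  by rewrite expf_neq0.
have fE' a : phi (S + a *: sq v) = phi S + f a *: sq w.
  by rewrite -fE addrCA subrr addr0.
have f0 : f 0 = 0 by rewrite /f scale0r addr0 subrr mxE mul0r.
have f1 : f 1 = 1 by rewrite /f E1 mxE -expr2 divff // expf_neq0.
have f_chi a a' : a != a' -> f a != f a' /\ chi (f a - f a') = chi (a - a').
  move=> ne; have ne0 : a - a' != 0 by rewrite subr_eq0.
  have [b' [w' [b'0 w'0 chib' E]]] := phi_line (symSv a) (symSv a') ne0 v0 (diffE a a').
  have Eff : b' *: sq w' = (f a - f a') *: sq w.
    by rewrite -E !fE' opprD addrACA subrr add0r -scalerBl.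
  have [ff0 w'i] := scale_sq_inj b'0 w'0 Eff; split; first by rewrite -subr_eq0.
  have := congr1 (fun M : 'M_n => M i i) Eff; rewrite !mxE -!expr2 => Ei.
  by rewrite -(chi_sqrM _ wi) -Ei chi_sqrM // w'i.
have [t tP tE] := carlitz two_neq0 f0 f1 f_chi.
by exists w, t; split=> // a; rewrite fE' tE.
Qed.

Definition incr S a v := phi (S + a *: sq v) - phi S.

Lemma incr_line S v : symmx S -> v != 0 -> exists w (t : {perm F}),
  [/\ w != 0, field_aut t & forall a, incr S a v = t a *: sq w].
Proof.
move=> symS v0; have [w [t [w0 tP E]]] := phi_on_line symS v0.
by exists w, t; split=> // a; rewrite /incr E addrAC subrr add0r.
Qed.

(** The line in direction v is mapped with data (w, t) at S and (w', t') at the shifted point. The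
    shift of S + a v^T v along u still has rank one, and the resulting minors force w to be a
    multiple of w' and the increments to agree. *)
Lemma incr_npar S a b u v : symmx S -> v != 0 -> ~~ par u v ->
  incr (S + b *: sq u) a v = incr S a v.
Proof.
move=> symS v0 npar_uv.
have [-> | b0] := eqVneq b 0; first by rewrite scale0r addr0.
have u0 : u != 0 by apply: contraNneq npar_uv => ->; rewrite par_sym par0.
have symSu : symmx (S + b *: sq u) by apply: symDsq.
have [w [t [w0 tP tE]]] := incr_line symS v0.
have [w' [t' [w'0 t'P t'E]]] := incr_line symSu v0.
have diffu T : T + b *: sq u - T = b *: sq u by rewrite addrAC subrr add0r.
have [be [u' [be0 u'0 _ Eu]]] := phi_line symSu symS b0 u0 (diffu S).
have phi_Su : phi (S + b *: sq u) = phi S + be *: sq u' by rewrite -Eu addrCA subrr addr0.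
(* Otherwise the images of S and S + b u^T u + v^T v would differ by rank at most one. *)
have npar_uw : ~~ par u' w'.
  apply: contra npar_uv => p; apply: (@rank1_par _ _ b 1) => //; first exact: oner_neq0.
  have -> : b *: sq u + 1 *: sq v = S + b *: sq u + 1 *: sq v - S.
    by apply/matrixP => i j; rewrite !mxE; ring.
  rewrite -phi_rank //; last by apply: symDsq.
  rewrite -[phi _](subrK (phi (S + b *: sq u))) -/(incr _ _ _) t'E phi_Su.
  rewrite [X in (\rank X <= _)%N](_ : _ = be *: sq u' + t' 1 *: sq w').
    exact: par_rank1.
  by apply/matrixP => i j; rewrite !mxE; ring.
(* The minor of the image of the shifted difference, on vectors dual to u' and w'. *)
have minor x y a' : dot u' x = 1 -> dot w' x = 0 -> dot u' y = 0 -> dot w' y = 1 ->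
   be * t' a' - be * t a' * dot w y ^+ 2 - dot w x ^+ 2 * t a' * t' a' = 0.
  move=> ux wx uy wy.
  have rk : (\rank (be *: sq u' + t' a' *: sq w' + (- t a') *: sq w)%R <= 1)%N.
    have -> : be *: sq u' + t' a' *: sq w' + (- t a') *: sq w =
              phi (S + b *: sq u + a' *: sq v) - phi (S + a' *: sq v).
      rewrite -[phi (_ + a' *: _)](subrK (phi (S + b *: sq u))) -/(incr _ _ _) t'E phi_Su.
      rewrite -[phi (S + _)](subrK (phi S)) -/(incr _ _ _) tE.
      by apply/matrixP => i j; rewrite !mxE; ring.
    rewrite phi_rank; do ?exact: symDsq.
    by rewrite [S + _ + _]addrAC diffu rank_sq.
  have := rank1_bform x x y y rk; rewrite !bformD !bformZ_sq ux wx uy wy => /eqP.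
  rewrite -subr_eq0 => /eqP E; rewrite -[RHS]E; ring.
have [x [ux wx]] := dual_vector npar_uw.
rewrite par_sym in npar_uw; have [y [wy uy]] := dual_vector npar_uw.
have wx0 x' : dot u' x' = 1 -> dot w' x' = 0 -> dot w x' = 0.
  move=> ux' wx'; apply/eqP/negPn/negP => al0.
  have := minor x' y _ ux' wx' uy wy; set al := dot w x' in al0 *; set ka := dot w y => mi.
  have ka0 : ka = 0.
    (* At this parameter the two terms in t' cancel, which leaves ka = 0. The parameters 1 and -1
       then give al^2 = be and al^2 = - be. *)
    have := mi (t^-1%g (be / al ^+ 2)); rewrite permKV; set s := t' _ => E.
    have {}E : be ^+ 2 * ka ^+ 2 = 0.
      by rewrite -[RHS](mulr0 (- al ^+ 2)) -E; field.
    by move/eqP: E; rewrite mulf_eq0 !expf_eq0 (negbTE be0) => /eqP.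
  have E1 := mi 1; have E2 := mi (-1).
  rewrite ka0 !(field_autN _ tP, field_autN _ t'P) !field_aut_1 // in E1 E2.
  have : 2%:R * be = 0.
    transitivity ((be * 1 - be * 1 * 0 ^+ 2 - al ^+ 2 * 1 * 1) -
      (be * - 1 - be * - 1 * 0 ^+ 2 - al ^+ 2 * - 1 * - 1)); first by ring.
    by rewrite E1 E2 subrr.
  by move/eqP; rewrite mulf_eq0 (negbTE two_neq0) (negbTE be0).
have wx_0 := wx0 x ux wx; pose ka := dot w y.
(* Adding to x a vector orthogonal to u' and w' keeps the conditions of [wx0], so w vanishes on such
   vectors. *)
have wE : w = ka *: w'.
  apply/rowP => i; rewrite mxE -!dot_delta; set z := delta_mx 0 i.
  have := wx0 (x + (z + ((- dot u' z) *: x + (- dot w' z) *: y))).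
  rewrite !dotDr !dotZr ux wx uy wy wx_0 => H.
  have {}H := H ltac:(ring) ltac:(ring).
  by apply/eqP; rewrite -subr_eq0 -[X in _ == X]H; apply/eqP; rewrite /ka; ring.
have := minor x y a ux wx uy wy; rewrite -/ka wx_0 => E.
have {}E : t' a = t a * ka ^+ 2.
  by apply: (mulfI be0); apply/eqP; rewrite -subr_eq0 -[X in _ == X]E; apply/eqP; ring.
by rewrite t'E tE wE sqZ scalerA E.
Qed.

Lemma incr_shift S a b u v : symmx S -> v != 0 -> incr (S + b *: sq u) a v = incr S a v.
Proof.
move=> symS v0; have [puv | npuv] := boolP (par u v); last exact: incr_npar.
have [c Eu] := par_scale puv v0.
have [/existsP[w nw] | /existsPn all_par] := boolP [exists w : 'rV[F]_n, ~~ par w v].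
  have half : b = b / 2%:R + b / 2%:R by rewrite -mulrDl -mulr2n -[b *+ 2]mulr_natr mulfK.
  (* A shift parallel to v is split into three shifts along u + w, u - w and w, none of them
     parallel to v. *)
  have -> : S + b *: sq u = S + (b / 2%:R) *: sq (u + w) + (b / 2%:R) *: sq (u - w)
              + (- b) *: sq w.
    by apply/matrixP => i j; rewrite !mxE; field.
  have np d : d != 0 -> ~~ par (u + d *: w) v.
    move=> d0; apply: contra nw => /forallP p; apply/forallP => i; apply/forallP => j.
    have /forallP/(_ j)/eqP := p i; rewrite Eu !mxE => E.
    apply/eqP/(mulfI d0)/eqP; rewrite -subr_eq0; apply/eqP.
    by apply/eqP; move/eqP: E; rewrite -subr_eq0; congr (_ == 0); ring.
  rewrite !incr_npar //; do ?[exact: symDsq | by do !apply: symDsq].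
    by rewrite -[w]scale1r np ?oner_neq0.
  by rewrite -scaleN1r np // oppr_eq0 oner_neq0.
(* Here all vectors are parallel to v, as for n = 1; the shift stays on the line, where phi is
   additive because t is. *)
have [w [t [w0 tP tE]]] := incr_line symS v0.
have lineE d : phi (S + d *: sq v) = phi S + t d *: sq w by rewrite -tE /incr addrCA subrr addr0.
rewrite /incr Eu sqZ scalerA -addrA -scalerDl !lineE field_autD // scalerDl.
by apply/matrixP => i j; rewrite !mxE; ring.
Qed.

End SymmetricMatrixGeometry.

(** * Hua's theorem for symmetric matrices *)

Lemma sym_ind (F : finFieldType) (n : nat) (P : 'M[F]_n -> Prop) :
    2%:R != 0 :> F -> P 0 ->
    (forall T b u, symmx T -> P T -> P (T + b *: sq u)) ->
  forall T, symmx T -> P T.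
Proof.
move=> two_neq0 P0 PS T symT; rewrite (polarization two_neq0 symT).
pose Q T := symmx T /\ P T.
have QS T' b u : Q T' -> Q (T' + b *: sq u).
  by move=> [sT' PT']; split; [apply: symDsq | apply: PS].
have Qsum (I : Type) (r : seq I) (A : I -> 'M[F]_n) :
    (forall i C, Q C -> Q (C + A i)) -> forall C, Q C -> Q (C + \sum_(i <- r) A i).
  move=> QA; elim: r => [|i r IHr] C QC; first by rewrite big_nil addr0.
  by rewrite big_cons addrA; apply/IHr/QA.
have Q0 : Q 0 by split=> //; apply: sym0.
rewrite -[X in P X]add0r; apply: (proj2 (_ : Q _)).
apply: (Qsum _ _ _ _ _ Q0) => i C QC; apply: (Qsum _ _ _ _ _ QC) => j C' QC'.
by rewrite addrA; do 2!apply: (QS).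
Qed.

Lemma sym_additive_sum (F : finFieldType) (n : nat) (psi : 'M[F]_n -> 'M[F]_n)
    (I : Type) (r : seq I) (A : I -> 'M[F]_n) :
    psi 0 = 0 ->
    (forall S T, symmx S -> symmx T -> psi (S + T) = psi S + psi T) ->
    (forall i, symmx (A i)) ->
  symmx (\sum_(i <- r) A i) /\ psi (\sum_(i <- r) A i) = \sum_(i <- r) psi (A i).
Proof.
move=> psi0 psiD symA; elim: r => [|i r [symr IHr]].
  by rewrite !big_nil psi0; split=> //; apply: sym0.
by rewrite !big_cons psiD // IHr; split=> //; apply: symD.
Qed.

(** * Additive rank one preservers that map each diagonal line to itself *)

Section AdditiveNormalForm.
Variables (F : finFieldType) (n : nat) (psi : 'M[F]_n -> 'M[F]_n).
Variable t_ : 'I_n -> {perm F}.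
Hypotheses (two_neq0 : 2%:R != 0 :> F) (s0 : F).
Hypotheses (s00 : s0 != 0) (s01 : s0 != 1) (s0N1 : s0 != -1).
Hypothesis psi_sym : forall S, symmx S -> symmx (psi S).
Hypothesis psiD : forall S T, symmx S -> symmx T -> psi (S + T) = psi S + psi T.
Hypothesis psi_rank1 : forall S, symmx S -> (\rank S <= 1)%N -> (\rank (psi S) <= 1)%N.
Hypothesis tP : forall i, field_aut (t_ i).
Local Notation e_ i := (delta_mx 0 i : 'rV[F]_n).
Hypothesis psi_diag : forall i a, psi (a *: sq (e_ i)) = t_ i a *: sq (e_ i).

Definition symE_ i j : 'M[F]_n := delta_mx i j + delta_mx j i.

Lemma sym_symE i j : symmx (symE_ i j).
Proof. by rewrite /symmx linearD /= !trmx_delta addrC. Qed.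

Lemma sq_delta i : sq (e_ i) = delta_mx i i.
Proof. by apply/matrixP => k l; rewrite !mxE /= -natrM mulnb. Qed.

(** For every s != 0 the matrix s E_ii + (c^2/s) E_jj + c (E_ij + E_ji) has rank one. Its image
    [N s] involves s only in two diagonal entries, so the minors for varying s determine the image M
    of the last summand up to sign. *)
Lemma psi_offdiag i j c : i != j -> c != 0 -> t_ i =1 t_ j /\
  exists2 C, C ^+ 2 = t_ i c ^+ 2 & psi (c *: symE_ i j) = C *: symE_ i j.
Proof.
move=> ij c0; set M := psi _; have symM : symmx M by apply/psi_sym/symZ/sym_symE.
have t0 := field_aut_eq0 (tP _).
pose N s := t_ i s *: sq (e_ i) + t_ j (c ^+ 2 / s) *: sq (e_ j) + M.
have rkN s : s != 0 -> (\rank (N s) <= 1)%N.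
  move=> sn0; have sa : symmx (s *: sq (e_ i)) by apply/symZ/sym_sq.
  have sb : symmx ((c ^+ 2 / s) *: sq (e_ j)) by apply/symZ/sym_sq.
  have sm : symmx (c *: symE_ i j) by apply/symZ/sym_symE.
  have sab := symD sa sb.
  rewrite /N -!psi_diag -psiD // -psiD //; apply: psi_rank1; first exact: symD.
  rewrite (_ : _ + _ = s^-1 *: sq (s *: e_ i + c *: e_ j)) ?rank_sq //.
  apply/matrixP => k l; rewrite !mxE /=.
  by case: (k == i) (k == j) (l == i) (l == j) => [] [] [] [] /=; field.
have NE s k l : N s k l = t_ i s * ((k == i) && (l == i))%:R
     + t_ j (c ^+ 2 / s) * ((k == j) && (l == j))%:R + M k l.
  by rewrite /N !sq_delta !mxE.
have ji : j != i by rewrite eq_sym.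
have minor s k l k' l' : s != 0 -> N s k l * N s k' l' = N s k l' * N s k' l.
  by move=> /rkN/rank1_minor.
set A := M i i; set D := M j j; set C := M i j.
have MC : M j i = C by rewrite symE.
pose k := t_ j (c ^+ 2); have k0 : k != 0 by rewrite t0 expf_neq0.
have key s : s != 0 -> (t_ i s + A) * (k + D * t_ j s) = C ^+ 2 * t_ j s.
  move=> sn0; have := minor s i i j j sn0; rewrite !NE !eqxx (negbTE ij) (negbTE ji) /=.
  rewrite !(mulr0, mulr1, addr0, add0r) -/A -/D -/C MC => E.
  have ts0 : t_ j s != 0 by rewrite t0.
  have tjk : t_ j (c ^+ 2 / s) * t_ j s = k by rewrite -field_autM // divfK.
  rewrite expr2 -E -mulrA; congr (_ * _); rewrite mulrDl tjk; ring.
have sum_key s : s != 0 -> A * k + D * (t_ i s * t_ j s) = 0.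
  move=> sn0; have E1 := key s sn0.
  have : - s != 0 by rewrite oppr_eq0.
  move=> /key; rewrite !field_autN // => E2; apply: (mulfI two_neq0).
  by have := congr2 +%R E1 E2; rewrite [C ^+ 2 * - _]mulrN subrr mulr0 => <-; ring.
have AD : A * k = - D.
  have := sum_key 1 (oner_neq0 _); rewrite !field_aut_1 // !mulr1 => E.
  by apply/eqP; rewrite -addr_eq0 E.
(* Otherwise t_i s and t_j s are inverse for all s != 0; comparing s with s + 1 makes their sum -1.
   For [s0] and [- s0] this gives 1 = -1; the exclusion of 0, 1 and -1 keeps all arguments
   nonzero. *)
have D0 : D = 0.
  apply/eqP/negPn/negP => Dn0.
  have inv s : s != 0 -> t_ i s * t_ j s = 1.
    move=> /sum_key; rewrite AD => /eqP; rewrite addrC subr_eq0 => /eqP E.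
    by apply: (mulfI Dn0); rewrite mulr1.
  have sum_inv s : s != 0 -> s + 1 != 0 -> t_ i s + t_ j s = -1.
    move=> sn0 /inv; rewrite !field_autD // !field_aut_1 // => E.
    have E' := inv s sn0.
    rewrite (_ : _ + _ = (t_ i s + 1) * (t_ j s + 1) - t_ i s * t_ j s - 1); last by ring.
    by rewrite E E' subrr add0r.
  have s1 : s0 + 1 != 0 by rewrite addr_eq0.
  have sN : - s0 != 0 by rewrite oppr_eq0.
  have sN1 : - s0 + 1 != 0 by rewrite addrC subr_eq0 eq_sym.
  have := sum_inv _ sN sN1; rewrite !field_autN // -opprD (sum_inv _ s00 s1) opprK.
  by move/eqP; rewrite -addr_eq0 -mulr2n (negbTE two_neq0).
have A0 : A = 0 by apply/eqP; move/eqP: AD; rewrite D0 oppr0 mulf_eq0 (negbTE k0) orbF.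
have kC : k = C ^+ 2.
  by have := key 1 (oner_neq0 _); rewrite A0 D0 !field_aut_1 //
     mul0r !addr0 mul1r mulr1.
have tij : t_ i =1 t_ j.
  move=> s; have [-> | sn0] := eqVneq s 0; first by rewrite !field_aut0.
  by have := key s sn0; rewrite A0 D0 mul0r !addr0 -kC mulrC; apply: mulfI.
split=> //; exists C; first by rewrite -kC /k -tij expr2 field_autM.
(* The entry at (i, l) does not depend on s, whereas its square is t_i(s) M_ll; s = 1 and s = -1
   give M_ll = 0. *)
have off l : l != i -> l != j -> [/\ M l l = 0, M i l = 0 & M j l = 0].
  move=> li lj; have minl s k' : s != 0 -> N s k' k' * M l l = M k' l ^+ 2.
    move=> sn0; have := minor s k' k' l l sn0.
    rewrite ![N s _ l]NE ![N s l _]NE (negbTE li) (negbTE lj) !andbF /= !mulr0 !add0r.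
    by rewrite (symE l k' symM) -expr2.
  have Nii s : N s i i = t_ i s.
    by rewrite NE eqxx (negbTE ij) mulr1 mulr0 -/A A0 !addr0.
  have E1 := minl 1 i (oner_neq0 _).
  have E2 := minl (-1) i; rewrite oppr_eq0 oner_eq0 in E2; have {}E2 := E2 isT.
  rewrite !Nii field_autN // field_aut_1 // mul1r in E1 E2.
  have Mll : M l l = 0.
    apply/eqP; have : 2%:R * M l l = 0 by rewrite mulrDl mul1r {1}E1 -E2; ring.
    by move/eqP; rewrite mulf_eq0 (negbTE two_neq0).
  split=> //; apply/eqP; rewrite -sqrf_eq0.
    by rewrite -E1 Mll.
  by rewrite -(minl 1 j) ?oner_neq0 // Mll mulr0.
have off2 l l' : l != i -> l != j -> l' != i -> l' != j -> M l l' = 0.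
  move=> li lj l'i l'j; have [Mll _ _] := off l li lj.
  have := minor 1 l l l' l' (oner_neq0 _).
  rewrite !NE (negbTE li) (negbTE lj) (negbTE l'i) (negbTE l'j) /= !mulr0 !add0r Mll.
  by rewrite mul0r (symE l' l symM) => /esym/eqP; rewrite mulf_eq0 orbb => /eqP.
apply/matrixP => l l'; rewrite !mxE.
have [-> | li] := eqVneq l i.
  have [-> | l'j] := eqVneq l' j; first by rewrite (negbTE ij) mulr1n addr0 mulr1.
  rewrite (negbTE ij) addr0 mulr0; have [-> //| l'i] := eqVneq l' i.
  by have [_ -> _] := off l' l'i l'j.
have [-> | lj] := eqVneq l j.
  have [-> | l'i] := eqVneq l' i; first by rewrite add0r mulr1.
  rewrite add0r mulr0; have [-> //| l'j] := eqVneq l' j.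
  by have [_ _ ->] := off l' l'i l'j.
rewrite /= addr0 mulr0; have [-> | l'i] := eqVneq l' i.
  by rewrite symE //; have [] := off l li lj.
have [-> | l'j] := eqVneq l' j; last exact: off2.
by rewrite symE //; have [] := off l li lj.
Qed.

Lemma psi0 (i : 'I_n) : psi 0 = 0.
Proof. by have := psi_diag i 0; rewrite field_aut0 // !scale0r. Qed.

Lemma mxE_symE (M : 'M[F]_n) k l i j : (M k l *: symE_ k l) i j
  = M k l * ((i == k) && (j == l))%:R + M k l * ((i == l) && (j == k))%:R.
Proof. by rewrite !mxE mulrDr. Qed.

Lemma sum_symE (M : 'M[F]_n) i j :
  (\sum_k \sum_l M k l *: symE_ k l) i j = M i j + M j i.
Proof.
rewrite summxE (eq_bigr (fun k => \sum_l M k l * ((i == k) && (j == l))%:R +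
    \sum_l M k l * ((i == l) && (j == k))%:R)); last first.
  move=> k _; rewrite summxE -big_split /=; apply: eq_bigr => l _; exact: mxE_symE.
rewrite big_split /=; congr (_ + _).
  rewrite (bigD1 i) //= [X in _ + X]big1 ?addr0 => [|k /negbTE ne].
    rewrite (bigD1 j) //= big1 ?addr0 => [|l /negbTE ne]; first by rewrite !eqxx mulr1.
    by rewrite [j == _]eq_sym ne andbF mulr0.
  by apply: big1 => l _; rewrite eq_sym ne mulr0.
rewrite (bigD1 j) //= [X in _ + X]big1 ?addr0 => [|k /negbTE ne].
  rewrite (bigD1 i) //= big1 ?addr0 => [|l /negbTE ne]; first by rewrite !eqxx mulr1.
  by rewrite [i == _]eq_sym ne mulr0.
by apply: big1 => l _; rewrite [j == _]eq_sym ne andbF mulr0.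
Qed.

(** Entry by entry psi is a common t up to signs [eps i j]; the signs split as products because the
    all-ones matrix has rank one. *)
Lemma additive_normal_form (i0 : 'I_n) : exists2 eta : 'I_n -> F,
  forall i, eta i != 0 &
  forall S, symmx S -> forall i j, psi S i j = eta i * eta j * t_ i0 (S i j).
Proof.
pose t := t_ i0.
have t_eq i : t_ i =1 t.
  have [-> // | ne] := eqVneq i i0.
  by have [] := psi_offdiag ne (oner_neq0 _).
have tP0 : field_aut t := tP i0.
have t1 : t 1 = 1 := field_aut_1 tP0.
pose eps i j := if i == j then 1 else psi (symE_ i j) i j.
have symE_ij i j : i != j -> symE_ i j i j = 1 /\ symE_ i j j i = 1.
  by move=> ne; rewrite !mxE !eqxx (eq_sym j) (negbTE ne) /= addr0 add0r.
have coefE i j C : i != j -> (C *: symE_ i j) i j = C.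
  by move=> ne; rewrite mxE (proj1 (symE_ij i j ne)) mulr1.
have psi1 i j : i != j -> psi (symE_ i j) = eps i j *: symE_ i j /\ eps i j ^+ 2 = 1.
  move=> ne; have [_ [C EC]] := psi_offdiag ne (oner_neq0 _).
  by rewrite scale1r /eps (negbTE ne) => ->; rewrite coefE // EC field_aut_1 // expr1n.
have psi_E i j c : psi (c *: symE_ i j) = (eps i j * t c) *: symE_ i j.
  have [<- | ne] := eqVneq i j.
    have -> : c *: symE_ i i = (c + c) *: sq (e_ i).
      by rewrite sq_delta scalerDr scalerDl.
    rewrite psi_diag /eps eqxx mul1r t_eq field_autD // scalerDl.
    by rewrite sq_delta scalerDr.
  have [-> | c0] := eqVneq c 0; first by rewrite field_aut0 // mulr0 !scale0r (psi0 i0).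
  have [_ [C2 EC2 E2]] := psi_offdiag ne c0; have [E1 EC1] := psi1 i j ne.
  (* [psi_offdiag] gives the coefficient at c only up to sign. Its square at 1 + c contains the
     mixed term eps C2, which fixes the sign; c = -1 is treated apart. *)
  have := psiD (sym_symE i j) (symZ c (sym_symE i j)).
  rewrite -[X in psi (X + _)]scale1r -scalerDl E1 E2 -scalerDl => E3.
  have [c1 | c1] := eqVneq (1 + c) 0.
    move: E3; rewrite c1 scale0r (psi0 i0) => /(congr1 (fun M : 'M_n => M i j)).
    rewrite coefE // mxE => /esym/eqP; rewrite addr_eq0 => /eqP EC.
    have -> : c = -1 by apply/eqP; rewrite -addr_eq0 addrC c1.
    by rewrite field_autN // t1 mulrN mulr1 EC opprK.
  have [_ [C3 EC3]] := psi_offdiag ne c1; rewrite E3 => /(congr1 (fun M : 'M_n => M i j)).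
  rewrite !coefE // => E; congr (_ *: _).
  rewrite !t_eq in EC2 EC3; rewrite -E field_autD // t1 in EC3.
  have : 2%:R * (eps i j * C2) = 2%:R * t c.
    transitivity ((eps i j + C2) ^+ 2 - eps i j ^+ 2 - C2 ^+ 2); first by ring.
    by rewrite EC3 EC1 EC2; ring.
  move=> /(mulfI two_neq0) <-; rewrite mulrA -expr2 EC1 mul1r //.
have eps_sym i j : eps i j = eps j i.
  rewrite /eps eq_sym; case: eqP => // _.
  by rewrite symE ?[symE_ i j]addrC //; apply/psi_sym/sym_symE.
have psiE S : symmx S -> forall i j, psi S i j = eps i j * t (S i j).
  move=> symS i j; apply: (mulfI two_neq0).
  (* Each off-diagonal pair occurs twice, and [symE_ k k] is twice a matrix unit. *)
  have E : S + S = \sum_k \sum_l S k l *: symE_ k l.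
    by apply/matrixP => k l; rewrite sum_symE mxE [in X in _ + X]symE.
  transitivity (psi (S + S) i j); first by rewrite psiD // mxE; ring.
  have sym1 k l : symmx (S k l *: symE_ k l) by apply/symZ/sym_symE.
  have sym2 k : symmx (\sum_l S k l *: symE_ k l).
    by have [] := sym_additive_sum (index_enum _) (psi0 i0) psiD (sym1 k).
  rewrite E (proj2 (sym_additive_sum _ (psi0 i0) psiD sym2)).
  pose M : 'M[F]_n := \matrix_(k, l) (eps k l * t (S k l)).
  rewrite (eq_bigr (fun k => \sum_l M k l *: symE_ k l)) => [|k _]; last first.
    rewrite (proj2 (sym_additive_sum _ (psi0 i0) psiD (sym1 k))); apply: eq_bigr => l _.
    by rewrite psi_E mxE.
  by rewrite sum_symE !mxE (eps_sym j) (symE j i symS); ring.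
have rkJ : (\rank (psi (sq (const_mx 1%R))) <= 1)%N.
  by apply: psi_rank1; [apply: sym_sq | rewrite -[sq _]scale1r rank_sq].
exists (eps i0) => [i | S symS i j].
  rewrite /eps; case: (eqVneq i0 i) => [_ | ne]; first exact: oner_neq0.
  have [_] := psi1 _ _ ne; rewrite /eps (negbTE ne) => E; apply: contraTneq (oner_neq0 F).
  by move=> Z; rewrite -E Z expr0n eqxx.
rewrite psiE //; congr (_ * _); have := rank1_minor i0 i0 i j rkJ.
rewrite !psiE; do ?exact: sym_sq.
by rewrite !mxE !mulr1 t1 !mulr1 {1}/eps eqxx mul1r => ->; rewrite (eps_sym i) mulrC.
Qed.

End AdditiveNormalForm.

Section Hua.
Variables (F : finFieldType) (n : nat) (phi : 'M[F]_n -> 'M[F]_n).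
Implicit Types (S T M : 'M[F]_n) (u v w x y z : 'rV[F]_n) (a b c : F).

Hypotheses (two_neq0 : 2%:R != 0 :> F) (s0 : F).
Hypotheses (s00 : s0 != 0) (s01 : s0 != 1) (s0N1 : s0 != -1).
Hypothesis n_gt0 : (0 < n)%N.
Hypothesis phi0 : phi 0 = 0.
Hypothesis phi_sym : forall S, symmx S -> symmx (phi S).
Hypothesis phi_rank : forall S T, symmx S -> symmx T ->
  \rank (phi S - phi T)%R = \rank (S - T)%R.
Hypothesis phi_line : forall S T a v, symmx S -> symmx T -> a != 0 -> v != 0 ->
  S - T = a *: sq v ->
  exists b w, [/\ b != 0, w != 0, chi b = chi a & phi S - phi T = b *: sq w].

(** By [incr_shift] the base point of an increment can be moved to 0 along squares, and squares
    generate all symmetric matrices. *)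
Lemma phi_additive S T : symmx S -> symmx T -> phi (S + T) = phi S + phi T.
Proof.
pose shift := incr_shift two_neq0 phi_rank phi_line.
have incr0 a v T' : v != 0 -> symmx T' -> incr phi T' a v = incr phi 0 a v.
  move=> v0; move: T'; apply: sym_ind => // T' b u symT' <-.
  exact: shift.
have addsq T' b u : symmx T' -> phi (T' + b *: sq u) = phi T' + phi (b *: sq u).
  move=> symT'; have [-> | u0] := eqVneq u 0.
    have -> : sq 0 = 0 :> 'M[F]_n by apply/matrixP => i j; rewrite !mxE mulr0.
    by rewrite scaler0 phi0 !addr0.
  have := incr0 b u T' u0 symT'; rewrite /incr add0r phi0 subr0 => <-.
  by rewrite addrCA subrr addr0.
move=> symS symT; move: T symT S symS.
apply: sym_ind => // [S _ | T b u symT IH S symS]; first by rewrite phi0 !addr0.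
by rewrite addrA !addsq // ?IH ?addrA //; apply: symD.
Qed.

Theorem symmetric_forms_automorphism : exists P : 'M[F]_n, exists t : {perm F},
  [/\ P \in unitmx, field_aut t &
      forall S, symmx S -> phi S = P *m map_mx t S *m P^T].
Proof.
pose e_ i := delta_mx 0 i : 'rV[F]_n.
have e0 i : e_ i != 0 by apply/rV0Pn; exists i; rewrite mxE !eqxx oner_neq0.
have /fin_all_exists[x /fin_all_exists[t tx]] i := phi_on_line two_neq0
  phi_rank phi_line (sym0 F n) (e0 i).
have tx0 := tx; have {}tx i a : phi (a *: sq (e_ i)) = t i a *: sq (x i).
  by have [_ _ E] := tx i; rewrite -[a *: _]add0r E phi0 add0r.
have tP i : field_aut (t i) by have [_] := tx0 i.
(* The rows are the directions of the images of the diagonal lines. The image of the identity is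
   P0^T P0 and has rank n, so [P0] is invertible; undoing it yields [psi], which keeps every
   diagonal line. *)
pose P0 : 'M[F]_n := \matrix_i x i; pose Q := invmx P0.
have sq_mulr v A : sq (v *m A) = A^T *m sq v *m A :> 'M[F]_n.
  by rewrite !sq_mulmx trmx_mul !mulmxA.
have xP i : x i = e_ i *m P0 by rewrite -rowE rowK.
have phi1 : phi 1%:M = P0^T *m P0.
  have -> : 1%:M = \sum_i 1 *: sq (e_ i) :> 'M[F]_n.
    by rewrite mx1_sum_delta; apply: eq_bigr => i _; rewrite scale1r sq_delta.
  have symi i : symmx (1 *: sq (e_ i)) by apply/symZ/sym_sq.
  rewrite (proj2 (sym_additive_sum _ phi0 phi_additive symi)).
  apply/matrixP => k l; rewrite summxE mxE; apply: eq_bigr => i _.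
  by rewrite tx field_aut_1 // scale1r !mxE.
have P0u : P0 \in unitmx.
  rewrite -row_full_unit /row_full eqn_leq rank_leq_row /=.
  have symI : symmx (1%:M : 'M[F]_n) by apply: trmx1.
  have := phi_rank symI (sym0 F n); rewrite phi0 !subr0 mxrank1 phi1 => rkn.
  by apply: leq_trans (mxrankM_maxr P0^T P0); rewrite rkn.
pose psi S := Q^T *m phi S *m Q.
have QP : Q^T *m P0^T = 1%:M by rewrite -trmx_mul mulmxV // trmx1.
have psi_sym S : symmx S -> symmx (psi S).
  by move=> /phi_sym symS; rewrite /symmx /psi !trmx_mul trmxK symS mulmxA.
have psiD S T : symmx S -> symmx T -> psi (S + T) = psi S + psi T.
  by move=> symS symT; rewrite /psi phi_additive // mulmxDr mulmxDl.
have psi_rank1 S : symmx S -> (\rank S <= 1)%N -> (\rank (psi S) <= 1)%N.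
  move=> symS rkS; apply: (leq_trans (mxrankM_maxl _ _)).
  apply: (leq_trans (mxrankM_maxr _ _)).
  by have := phi_rank symS (sym0 F n); rewrite phi0 !subr0 => ->.
have psi_diag i a : psi (a *: sq (e_ i)) = t i a *: sq (e_ i).
  rewrite /psi tx xP sq_mulr -!(scalemxAr, scalemxAl); congr (_ *: _).
  by rewrite !mulmxA QP mul1mx -mulmxA mulmxV // mulmx1.
pose i0 := Ordinal n_gt0.
have [eta eta0 etaE] := additive_normal_form two_neq0 s00 s01 s0N1 psi_sym psiD psi_rank1 tP
  psi_diag i0.
exists (P0^T *m diag_mx (\row_i eta i)), (t i0); split=> // [|S symS].
  rewrite unitmx_mul unitmx_tr P0u /= unitmxE det_diag unitfE.
  by apply/prodf_neq0 => i _; rewrite mxE.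
have phiE : phi S = P0^T *m psi S *m P0.
  by rewrite /psi !mulmxA -trmx_mul mulVmx // trmx1 mul1mx -mulmxA mulVmx // mulmx1.
have := etaE S symS; move: (psi S) phiE => M -> ME.
rewrite trmx_mul trmxK tr_diag_mx !mulmxA; congr (_ *m _).
rewrite -!mulmxA; congr (_ *m _); apply/matrixP => i j.
by rewrite ME mul_diag_mx mul_mx_diag !mxE; ring.
Qed.

End Hua.

(** * Linear combinations and determinant functions *)

Section LinearCombinations.
Variables (F : finFieldType) (V : vectType F) (n : nat).
Implicit Types (e x y : 'I_n -> V) (a b : 'rV[F]_n) (A C : 'M[F]_n) (U W : {vspace V}).

Definition comb e a : V := \sum_i a 0 i *: e i.

Lemma combD e a b : comb e (a + b) = comb e a + comb e b.
Proof. by rewrite -big_split; apply: eq_bigr => i _; rewrite mxE scalerDl. Qed.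

Lemma combZ e c a : comb e (c *: a) = c *: comb e a.
Proof. by rewrite scaler_sumr; apply: eq_bigr => i _; rewrite mxE scalerA. Qed.

Lemma comb0 e : comb e 0 = 0.
Proof. by rewrite /comb big1 // => i _; rewrite mxE scale0r. Qed.

Lemma combB e a b : comb e (a - b) = comb e a - comb e b.
Proof. by rewrite combD -scaleN1r combZ scaleN1r. Qed.

Lemma comb_delta e i : comb e (delta_mx 0 i) = e i.
Proof.
rewrite /comb (bigD1 i) //= mxE !eqxx scale1r big1 ?addr0 // => j ne.
by rewrite mxE (negbTE ne) scale0r.
Qed.

Lemma eq_comb e e' a : e =1 e' -> comb e a = comb e' a.
Proof. by move=> E; apply: eq_bigr => i _; rewrite E. Qed.

Lemma comb_in e a U : (forall i, e i \in U) -> comb e a \in U.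
Proof. by move=> eU; apply: memv_suml => i _; rewrite memvZ. Qed.

Definition indep e := forall a, comb e a = 0 -> a = 0.

Lemma codomE e : codom e = [tuple e i | i < n] :> seq V.
Proof. by []. Qed.

Lemma indep_free e : indep e <-> free (codom e).
Proof.
rewrite codomE; split=> [ie | /freeP fe a Ea].
  apply/freeP => k Ek i.
  have : comb e (\row_j k j) = 0.
    rewrite -[RHS]Ek; apply: eq_bigr => j _; by rewrite mxE -tnth_nth tnth_mktuple.
  by move=> /ie/rowP/(_ i); rewrite !mxE.
apply/rowP => i; rewrite mxE; apply: fe => //.
by rewrite -[RHS]Ea; apply: eq_bigr => j _; rewrite -tnth_nth tnth_mktuple.
Qed.

Lemma indep_free_image e (A : {pred 'I_n}) : indep e -> free [seq e i | i in A].
Proof.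
move=> /indep_free fe.
have pe : perm_eq (enum A ++ enum (predC (mem A))) (enum 'I_n).
  apply: uniq_perm; rewrite ?enum_uniq //.
    rewrite cat_uniq !enum_uniq andbT; apply/hasPn => i.
    by rewrite !mem_enum.
  by move=> i; rewrite mem_cat !mem_enum !inE orbN.
by have := perm_free (perm_map e pe); rewrite map_cat fe => /catl_free.
Qed.

Lemma basis_image e (A : {pred 'I_n}) U : indep e -> (forall i, i \in A -> e i \in U) ->
  #|A| = \dim U -> basis_of U [seq e i | i in A].
Proof.
move=> ie eU dimU; rewrite basisEfree size_image dimU leqnn andbT indep_free_image //=.
by apply/span_subvP => v /imageP[i Ai ->]; apply: eU.
Qed.

Lemma basis_codom e U : indep e -> (forall i, e i \in U) -> \dim U = n ->
  basis_of U (codom e).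
Proof. by move=> ie eU dimU; apply: basis_image => //; rewrite dimU card_ord. Qed.

Lemma span_image e (A : {pred 'I_n}) v : v \in <<[seq e i | i in A]>>%VS ->
  exists2 a : 'rV[F]_n, forall i, i \notin A -> a 0 i = 0 & v = comb e a.
Proof.
move=> /coord_span->; elim/big_rec: _ => [|i _ v' [a az ->]].
  by exists 0 => [i|]; rewrite ?mxE ?comb0.
have /imageP[j Aj ->] : [seq e i | i in A]`_i \in [seq e i | i in A].
  by rewrite mem_nth // size_image.
set c := coord _ _ _; exists (c *: delta_mx 0 j + a).
  move=> k nAk; rewrite !mxE az // addr0 [k == j](_ : _ = false) ?andbF ?mulr0 //.
  by apply: contraNF nAk => /eqP->.
by rewrite combD combZ comb_delta.
Qed.

Lemma span_codom e v : v \in <<codom e>>%VS -> exists a, v = comb e a.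
Proof. by case/span_image=> a _ ->; exists a. Qed.

Lemma basis_codomP e U : basis_of U (codom e) ->
  [/\ indep e, forall i, e i \in U & forall v, v \in U -> exists a, v = comb e a].
Proof.
move=> be; split=> [|i|v].
- by apply/indep_free/(basis_free be).
- by apply: (basis_mem be); apply: codom_f.
by rewrite -(span_basis be) => /span_codom.
Qed.

Section DeterminantFunction.
Variables (U : {vspace V}) (d : detfun n U).
Hypothesis dimU : \dim U = n.

(* The determinant in coordinates is another determinant function on U, and    *)
(* determinant functions are proportional.                                     *)
Lemma detfun_comb (x y : {ffun 'I_n -> V}) A : indep x -> (forall i, x i \in U) ->
  (forall i, y i = comb x (row i A)) -> d y = \det A * d x.
Proof.
move=> ix xU yE; pose X := [tuple x i | i < n].
have fX : free X by apply/indep_free.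
pose d2 (u : {ffun 'I_n -> V}) : F := \det (\matrix_(i, j) coord X j (u i)).
have coordE a j : coord X j (comb x a) = a 0 j.
  rewrite /comb linear_sum (bigD1 j) //= linearZ /=.
  have Xx i : x i = X`_i by rewrite -tnth_nth tnth_mktuple.
  rewrite Xx coord_free // eqxx mulr1 big1 ?addr0 // => i ne.
  by rewrite linearZ /= Xx coord_free // (negbTE ne) mulr0.
have replE u i v : \matrix_(k, j) coord X j (replace u i v k)
   = \matrix_(k, j) (if k == i then coord X j v else coord X j (u k)).
  by apply/matrixP => k j; rewrite !mxE ffunE; case: eqP.
have d2M : multilinear_on U d2.
  move=> u i c v w _ _ _; rewrite /d2 !replE -[X in _ = _ + X]mul1r.
  apply: (determinant_multilinear (i0 := i)).
  - by apply/rowP => j; rewrite !mxE !eqxx linearP mul1r.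
  - by apply/matrixP => k j; rewrite !mxE eq_sym (negbTE (neq_lift _ _)).
  by apply/matrixP => k j; rewrite !mxE eq_sym (negbTE (neq_lift _ _)).
have d2A : alternating_on U d2.
  move=> u i j _ ne Eij; apply: (determinant_alternate ne) => k.
  by rewrite !mxE Eij.
have yU : family_in U y by move=> i; rewrite yE; apply: comb_in.
have := alternating_proportional dimU (@detfun_multilinear _ _ _ _ d)
  (@detfun_alternating _ _ _ _ d) d2M d2A yU xU.
have -> : d2 x = 1.
  rewrite /d2 -[RHS](det1 F n); congr (\det _); apply/matrixP => i j.
  by rewrite !mxE -[x i]comb_delta coordE mxE eqxx [j == i]eq_sym.
have -> : d2 y = \det A.
  by rewrite /d2; congr (\det _); apply/matrixP => i j; rewrite !mxE yE coordE mxE.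
by rewrite mulr1 mulrC.
Qed.

Lemma detfun_neq0_basis (x : {ffun 'I_n -> V}) :
  indep x -> (forall i, x i \in U) -> d x != 0.
Proof.
move=> ix xU; have [u uU du] := detfun_neq0 d.
have bx := basis_codom ix xU dimU; have [_ _ sp] := basis_codomP bx.
have /fin_all_exists[r rE] i : exists a, u i = comb x a by apply/sp/uU.
have uE i : u i = comb x (row i (\matrix_k r k)) by rewrite rowK.
by apply: contraNneq du => dx; rewrite (detfun_comb ix xU uE) dx mulr0.
Qed.

End DeterminantFunction.
End LinearCombinations.

Lemma comb_mulmx (F : finFieldType) (V : vectType F) m n (e : 'I_n -> V)
    (A : 'M[F]_(m, n)) (a : 'rV[F]_m) :
  comb (fun i => comb e (row i A)) a = comb e (a *m A).
Proof.
rewrite /comb (eq_bigr (fun i => \sum_j (a 0 i * A i j) *: e j)) => [|i _].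
  rewrite exchange_big; apply: eq_bigr => j _; rewrite mxE scaler_suml.
  by apply: eq_bigr => i _.
by rewrite scaler_sumr; apply: eq_bigr => j _; rewrite mxE scalerA.
Qed.

(** * Gram determinants under block triangular changes of basis *)

Section BlockDeterminants.
Variables (F : fieldType).

(** The common lower right block contributes its determinant twice, and each upper left block
    appears once in det A or det C and once in the new Gram block: the total factor is a square. *)
Lemma gram_change_block k r (A C G : 'M[F]_(k + r)) :
    dlsubmx A = 0 -> dlsubmx C = 0 -> drsubmx A = drsubmx C ->
    ursubmx G = 0 -> dlsubmx G = 0 -> drsubmx G = 0 ->
  \det A * \det C * \det (ulsubmx (A *m G *m C^T)) =
    (\det (ulsubmx A) * \det C) ^+ 2 * \det (ulsubmx G).
Proof.
move=> A0 C0 AC G1 G2 G3.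
rewrite -[A in LHS]submxK -[C in LHS]submxK -[G in LHS]submxK A0 C0 G1 G2 G3 AC.
rewrite tr_block_mx !mulmx_block !(mul0mx, mulmx0, addr0, add0r, trmx0) block_mxKul.
rewrite !det_ublock !det_mulmx det_tr -[C in RHS]submxK C0 det_ublock; ring.
Qed.

(** The index form that matches [sigma]; for chi it only matters that the factor is a nonzero
    square. *)
Lemma gram_change n k (kn : (k <= n)%N) (A C G : 'M[F]_n) :
    let w := widen_ord kn in
    (forall i j : 'I_n, (k <= i)%N -> (j < k)%N -> A i j = 0) ->
    (forall i j : 'I_n, (k <= i)%N -> (j < k)%N -> C i j = 0) ->
    (forall i j : 'I_n, (k <= i)%N -> A i j = C i j) ->
    (forall i j : 'I_n, (k <= i)%N || (k <= j)%N -> G i j = 0) ->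
  exists c, (\det A != 0 -> \det C != 0 -> c != 0) /\
  \det A * \det C * \det (\matrix_(i, j) (A *m G *m C^T) (w i) (w j)) =
    c ^+ 2 * \det (\matrix_(i, j) G (w i) (w j)).
Proof.
have [r Er] : exists r, n = (k + r)%N by exists (n - k)%N; rewrite subnKC.
move: kn A C G; rewrite Er => kn A C G w A0 C0 AC G0.
have wE i : w i = lshift r i by apply: val_inj.
have ulE (M : 'M[F]_(k + r)) : \matrix_(i, j) M (w i) (w j) = ulsubmx M.
  by apply/matrixP => i j; rewrite !mxE !wE.
have dlA : dlsubmx A = 0 by apply/matrixP => i j; rewrite !mxE A0 ?leq_addr //=.
have dlC : dlsubmx C = 0 by apply/matrixP => i j; rewrite !mxE C0 ?leq_addr //=.
exists (\det (ulsubmx A) * \det C); split.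
  move=> dA dC; rewrite mulf_neq0 //; apply: contraNneq dA => dulA.
  by rewrite -[A]submxK dlA det_ublock dulA mul0r.
rewrite !ulE gram_change_block //; apply/matrixP => i j; rewrite !mxE.
- by rewrite AC //= leq_addr.
- by rewrite G0 //= leq_addr orbT.
- by rewrite G0 //= leq_addr.
by rewrite G0 //= leq_addr.
Qed.

End BlockDeterminants.

(** * Lagrangian subspaces and symplectic frames *)

Section SymplecticSpace.
Variables (F : finFieldType) (n : nat) (V : vectType F) (B : {biscalar V}).
Hypothesis dimV : \dim {:V} = (2 * n)%N.
Hypothesis B_alternating : forall x : V, B x x = 0.
Hypothesis B_nondegenerate : forall x : V, (forall y : V, B x y = 0) -> x = 0.
Implicit Types (U W Z : {vspace V}) (x y v w : V) (a b c : 'rV[F]_n) (X Y L : lagr B n).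
Implicit Types (e f : 'I_n -> V).

Lemma altDl x y v : B (x + y) v = B x v + B y v. Proof. exact: linearDl. Qed.
Lemma altZl k x v : B (k *: x) v = k * B x v. Proof. exact: linearZl_LR. Qed.
Lemma altDr x y v : B v (x + y) = B v x + B v y. Proof. exact: linearD. Qed.
Lemma altZr k x v : B v (k *: x) = k * B v x. Proof. exact: linearZr_LR. Qed.
Lemma alt0r v : B v 0 = 0. Proof. exact: linear0. Qed.
Lemma alt0l v : B 0 v = 0. Proof. exact: linear0l. Qed.

Lemma altC x y : B x y = - B y x.
Proof.
apply/eqP; rewrite -addr_eq0; apply/eqP.
have := B_alternating (x + y).
by rewrite altDl !altDr !B_alternating addr0 add0r.
Qed.

Lemma form_comb e f a b : B (comb e a) (comb f b) =
  \sum_i \sum_j a 0 i * B (e i) (f j) * b 0 j.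
Proof.
rewrite linear_sumlz; apply: eq_bigr => i _; rewrite linear_sumr.
by apply: eq_bigr => j _; rewrite altZl altZr [b 0 j * _]mulrC mulrA.
Qed.

Definition perp_map U (v : V) : 'rV[F]_(\dim U) := \row_i B (vbasis U)`_i v.

Lemma perp_map_linear U : linear (perp_map U).
Proof. by move=> c x y; apply/rowP => i; rewrite !mxE altDr altZr. Qed.

HB.instance Definition _ U :=
  GRing.isLinear.Build F V 'rV[F]_(\dim U) *:%R (perp_map U) (perp_map_linear U).

Definition perp U : {vspace V} := lker (linfun (perp_map U)).

Lemma perpP U v : reflect (forall u, u \in U -> B u v = 0) (v \in perp U).
Proof.
apply: (iffP idP) => [|UV].
  rewrite memv_ker lfunE /= => /eqP/rowP Uv u /coord_vbasis->.
  rewrite linear_sumlz big1 // => i _; rewrite altZl.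
  by have := Uv i; rewrite !mxE => ->; rewrite mulr0.
rewrite memv_ker lfunE; apply/eqP/rowP => i; rewrite !mxE; apply: UV.
by apply: vbasis_mem; rewrite mem_nth // size_tuple.
Qed.

Lemma perp_dim_ge U : (2 * n <= \dim (perp U) + \dim U)%N.
Proof.
have := limg_ker_dim (linfun (perp_map U)) fullv; rewrite capfv dimV => <-.
by rewrite leq_add2l (leq_trans (dimvS (subvf _))) // dimvf /dim /= mul1n.
Qed.

(** Let W be a complement of perp U. A vector of U orthogonal to W is orthogonal to the whole space,
    so U meets perp W trivially; counting dimensions gives the missing inequality. *)
Lemma perp_dim U : (\dim (perp U) + \dim U = 2 * n)%N.
Proof.
apply/eqP; rewrite eqn_leq perp_dim_ge andbT.
pose W := ((perp U)^C)%VS.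
have dimW : (\dim W = 2 * n - \dim (perp U))%N by rewrite dimv_compl dimV.
have UW0 : (U :&: perp W = 0)%VS.
  apply/eqP; rewrite -subv0; apply/subvP => u; rewrite memv_cap memv0 => /andP[Uu /perpP Wu].
  apply/eqP/B_nondegenerate => y; have : y \in (perp U + W)%VS by rewrite addv_complf memvf.
  case/memv_addP=> y1 /perpP Uy1 [y2 Wy2 ->]; rewrite altDr Uy1 // add0r.
  by rewrite altC Wu // oppr0.
have := dimv_sum_cap U (perp W); rewrite UW0 dimv0 addn0.
have := perp_dim_ge W; have := dimvS (subvf (U + perp W)); rewrite dimV => le1 le2 E.
have := dimvS (subvf (perp U)); rewrite dimV; lia.
Qed.

Lemma perpK U : perp (perp U) = U.
Proof.
apply/esym/eqP; rewrite eqEdim; apply/andP; split.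
  by apply/subvP => u Uu; apply/perpP => v /perpP Uv; rewrite altC Uv // oppr0.
by have := perp_dim U; have := perp_dim (perp U); lia.
Qed.

Definition iso U := forall x y, x \in U -> y \in U -> B x y = 0.

Lemma isoP U : reflect (iso U) (totally_isotropic B U).
Proof.
apply: (iffP idP) => [/forallP isoU x y Ux Uy | isoU].
  by have /forallP/(_ y)/implyP/(_ _)/eqP := isoU x; apply; rewrite Ux Uy.
apply/forallP => x; apply/forallP => y; apply/implyP => /andP[Ux Uy].
by apply/eqP/isoU.
Qed.

Lemma lagr_dim X : \dim (val X) = n.
Proof. by have /andP[/eqP] := valP X. Qed.

Lemma lagr_iso X : iso (val X).
Proof. by have /andP[_ /isoP] := valP X. Qed.

Lemma lagr_make U : \dim U = n -> iso U -> exists L, val L = U.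
Proof.
move=> dU /isoP iU.
have P : (\dim U == n) && totally_isotropic B U by rewrite dU eqxx iU.
by exists (exist _ U P).
Qed.

Lemma iso_perp U : iso U -> (U <= perp U)%VS.
Proof. by move=> iU; apply/subvP => u Uu; apply/perpP => v Uv; apply: iU. Qed.

Lemma iso_dim U : iso U -> (\dim U <= n)%N.
Proof. by move=> /iso_perp/dimvS; have := perp_dim U; lia. Qed.

Lemma lagr_perp X : perp (val X) = val X.
Proof.
apply/esym/eqP; rewrite eqEdim iso_perp; last exact: lagr_iso.
by have := perp_dim (val X); rewrite lagr_dim; lia.
Qed.

Lemma lagr_mem X v : (forall u, u \in val X -> B u v = 0) -> v \in val X.
Proof. by move=> Xv; rewrite -lagr_perp; apply/perpP. Qed.

Lemma iso_add_line U z : iso U -> z \in perp U -> iso (U + <[z]>)%VS.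
Proof.
move=> iU /perpP Uz x y /memv_addP[x1 Ux1 [x2 /vlineP[k ->] ->]].
move=> /memv_addP[y1 Uy1 [y2 /vlineP[l ->] ->]].
rewrite !(altDl, altDr, altZl, altZr) iU // Uz // (altC z) Uz // B_alternating.
by rewrite oppr0 !(mulr0, addr0).
Qed.

(** Growth by one vector at a time; the invariant P serves to keep the space disjoint from given
    Lagrangians. *)
Lemma extend_lagr (P : {vspace V} -> Prop) :
    (forall Z, iso Z -> P Z -> (\dim Z < n)%N ->
       exists z, [/\ z \in perp Z, z \notin Z & P (Z + <[z]>)%VS]) ->
  forall Z, iso Z -> P Z -> exists L, (Z <= val L)%VS /\ P (val L).
Proof.
move=> step Z; have [m] := ubnP (n - \dim Z); elim: m Z => // m IHm Z ltm iZ PZ.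
have := iso_dim iZ; rewrite leq_eqVlt => /orP[/eqP dZ | lt].
  by have [L LZ] := lagr_make dZ iZ; exists L; rewrite LZ.
have [z [pz nz PZz]] := step Z iZ PZ lt.
have dimZz : (\dim Z < \dim (Z + <[z]>))%N.
  rewrite ltnNge; apply: contra nz => le.
  have /eqP -> : Z == (Z + <[z]>)%VS by rewrite eqEdim addvSl.
  by apply: (subvP (addvSr _ _)); apply: memv_line.
have [|L [ZL PL]] := IHm _ _ (iso_add_line iZ pz) PZz; first by lia.
by exists L; split=> //; apply: subv_trans ZL; apply: addvSl.
Qed.

Lemma iso_in_lagr Z : iso Z -> exists L, (Z <= val L)%VS.
Proof.
move=> iZ; have [|L [ZL _]] := @extend_lagr (fun _ => True) _ Z iZ I; last by exists L.
move=> {iZ}Z iZ _ lt; have /subvPn[z pz nz] : ~~ (perp Z <= Z)%VS; last by exists z.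
by apply: contraL lt => /dimvS; have := perp_dim Z; lia.
Qed.

Definition disj U W := forall v, v \in U -> v \in W -> v = 0.

Lemma disj_cap U W : disj U W -> (U :&: W = 0)%VS.
Proof.
move=> d; apply/eqP; rewrite -subv0; apply/subvP => v.
by rewrite memv_cap memv0 => /andP[Uv Wv]; apply/eqP/d.
Qed.

Lemma cap_disj U W : \dim (U :&: W) = 0%N -> disj U W.
Proof.
move=> /eqP; rewrite dimv_eq0 => /eqP d v Uv Wv; apply/eqP.
by rewrite -memv0 -d memv_cap Uv.
Qed.

Lemma disj_add_line U W z : disj U W -> z \notin (W + U)%VS -> disj (U + <[z]>)%VS W.
Proof.
move=> d nz v /memv_addP[u Uu [z' /vlineP[k ->] ->]] Wv.
have [k0 | k0] := eqVneq k 0.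
  by move: Wv; rewrite k0 scale0r addr0; apply: d.
case/negP: nz; have -> : z = k^-1 *: (u + k *: z) + (- (k^-1 *: u)).
  by rewrite scalerDr scalerA mulVf // scale1r addrAC subrr add0r.
by apply: memv_add; [apply: memvZ | rewrite memvN memvZ].
Qed.

(** No space is the union of two proper subspaces: if u and w fail, u + w works. *)
Lemma avoid_two U W1 W2 : ~~ (U <= W1)%VS -> ~~ (U <= W2)%VS ->
  exists u, [/\ u \in U, u \notin W1 & u \notin W2].
Proof.
move=> /subvPn[u Uu nu] /subvPn[w Uw nw].
have [u2 | nu2] := boolP (u \in W2); last by exists u.
have [w1 | nw1] := boolP (w \in W1); last by exists w.
exists (u + w); split; first exact: memvD.
  by rewrite rpredDr.
by rewrite rpredDl.
Qed.

(** By dimension X contains a nonzero w orthogonal to Z. If perp Z were inside X + Z, then w would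
    be orthogonal to perp Z, hence in Z, against disjointness. *)
Lemma perp_not_sub X Z : iso Z -> (\dim Z < n)%N -> disj Z (val X) ->
  ~~ (perp Z <= val X + Z)%VS.
Proof.
move=> iZ lt d; apply/negP => sub.
have : (0 < \dim (val X :&: perp Z))%N.
  have := dimv_sum_cap (val X) (perp Z); have := perp_dim Z; rewrite lagr_dim.
  by have := dimvS (subvf (val X + perp Z)); rewrite dimV; lia.
rewrite lt0n; apply/negP; rewrite negbK dimv_eq0 -subv0; apply/subvP => w.
rewrite memv_cap memv0 => /andP[Xw Zw]; apply/eqP/d => //.
rewrite -(perpK Z); apply/perpP => u /(subvP sub)/memv_addP[x Xx [z Zz ->]].
by rewrite altDl (lagr_iso Xx Xw) add0r; have /perpP -> := Zw.
Qed.

(* A common opposite of X and Y, grown from Z one vector at a time.            *)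
Lemma iso_in_opposite X Y Z : iso Z -> disj Z (val X) -> disj Z (val Y) ->
  exists L, [/\ (Z <= val L)%VS, disj (val L) (val X) & disj (val L) (val Y)].
Proof.
move=> iZ dX dY; pose P U := disj U (val X) /\ disj U (val Y).
have [|L [ZL [LX LY]]] := @extend_lagr P _ Z iZ (conj dX dY); last by exists L.
move=> {iZ dX dY}Z iZ [dX dY] lt.
have [z [pz nX nY]] := avoid_two (perp_not_sub iZ lt dX) (perp_not_sub iZ lt dY).
exists z; split=> //; last by split; apply: disj_add_line.
by apply: contra nX => Zz; rewrite -[z]add0r memv_add ?mem0v.
Qed.

Definition frame e f : Prop :=
  [/\ forall i j, B (e i) (e j) = 0, forall i j, B (f i) (f j) = 0 &
      forall i j, B (e i) (f j) = (i == j)%:R].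

Section Frame.
Variables (e f : 'I_n -> V).
Hypothesis ef : frame e f.

Lemma frame_ee a b : B (comb e a) (comb e b) = 0.
Proof.
have [ee _ _] := ef; rewrite form_comb big1 // => i _.
by rewrite big1 // => j _; rewrite ee mulr0 mul0r.
Qed.

Lemma frame_ff a b : B (comb f a) (comb f b) = 0.
Proof.
have [_ ff _] := ef; rewrite form_comb big1 // => i _.
by rewrite big1 // => j _; rewrite ff mulr0 mul0r.
Qed.

Lemma frame_ef a b : B (comb e a) (comb f b) = dot a b.
Proof.
have [_ _ E] := ef; rewrite form_comb; apply: eq_bigr => i _.
rewrite (bigD1 i) //= E eqxx mulr1 big1 ?addr0 // => j ne.
by rewrite E eq_sym (negbTE ne) mulr0 mul0r.
Qed.

Lemma frame_e_f a i : B (comb e a) (f i) = a 0 i.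
Proof. by rewrite -[f i]comb_delta frame_ef dot_delta. Qed.

Lemma frame_f_e a i : B (e i) (comb f a) = a 0 i.
Proof.
rewrite -[e i]comb_delta frame_ef /dot (bigD1 i) //= mxE !eqxx mul1r big1 ?addr0 // => j ne.
by rewrite mxE (negbTE ne) mul0r.
Qed.

Lemma frame_indep_e : indep e.
Proof. by move=> a Ea; apply/rowP => i; rewrite -frame_e_f Ea alt0l mxE. Qed.

Lemma frame_indep_f : indep f.
Proof. by move=> a Ea; apply/rowP => i; rewrite -frame_f_e Ea alt0r mxE. Qed.

Definition fcoord_e (v : V) : 'rV[F]_n := \row_i B v (f i).
Definition fcoord_f (v : V) : 'rV[F]_n := \row_i B (e i) v.

Lemma fcoord_eK a b : fcoord_e (comb e a + comb f b) = a.
Proof.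
apply/rowP => i; rewrite mxE altDl frame_e_f -[f i]comb_delta frame_ff addr0 //.
Qed.

Lemma fcoord_fK a b : fcoord_f (comb e a + comb f b) = b.
Proof.
apply/rowP => i; rewrite mxE altDr frame_f_e -[e i]comb_delta frame_ee add0r //.
Qed.

Lemma span_frame_dim (g : 'I_n -> V) : indep g -> \dim <<codom g>>%VS = n.
Proof.
move=> /indep_free; rewrite /free => /eqP->.
by rewrite size_image card_ord.
Qed.

Lemma frame_decomp v : v = comb e (fcoord_e v) + comb f (fcoord_f v).
Proof.
have /memv_addP[x ex [y fy ->]] : v \in (<<codom e>> + <<codom f>>)%VS.
  suff /eqP -> : (<<codom e>> + <<codom f>>)%VS == fullv by apply: memvf.
  rewrite eqEdim subvf dimV dimv_disjoint_sum; last first.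
    apply/disj_cap => x /span_codom[a ->] /span_codom[b E].
    have -> : a = 0 by apply/rowP => i; rewrite -frame_e_f E -[f i]comb_delta frame_ff mxE.
    exact: comb0.
  rewrite !span_frame_dim; [lia | exact: frame_indep_f | exact: frame_indep_e].
have [[a ->] [b ->]] := (span_codom ex, span_codom fy).
by rewrite fcoord_eK fcoord_fK.
Qed.

End Frame.
End SymplecticSpace.

Lemma unitmx_left_inj (F : fieldType) (n : nat) (A : 'M[F]_n) :
  (forall a : 'rV_n, a *m A = 0 -> a = 0) -> A \in unitmx.
Proof.
move=> A0; rewrite -row_free_unit -kermx_eq0; apply/eqP/row_matrixP => i.
by rewrite row0; apply: A0; rewrite -row_mul mulmx_ker row0.
Qed.

(** * Frames adapted to pairs of Lagrangians; semi-isometries between frames *)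

Section Frames.
Variables (F : finFieldType) (n : nat) (V : vectType F) (B : {biscalar V}).
Hypothesis dimV : \dim {:V} = (2 * n)%N.
Hypothesis B_alternating : forall x : V, B x x = 0.
Hypothesis B_nondegenerate : forall x : V, (forall y : V, B x y = 0) -> x = 0.
Implicit Types (U W Z : {vspace V}) (v : V) (a b c : 'rV[F]_n) (X Y L : lagr B n).
Implicit Types (e f x y w : 'I_n -> V).
Local Notation fV := (finvect_type V).
Local Notation altC := (altC B_alternating).

Lemma dual_frame X (Z : lagr B n) w : disj (val X) (val Z) -> indep w -> (forall i, w i \in val Z) ->
  exists2 e, frame B e w & forall i, e i \in val X.
Proof.
move=> d iw wZ; pose x := tnth (tcast (lagr_dim X) (vbasis (val X))).
have bx : basis_of (val X) (codom x).
  have -> : codom x = tcast (lagr_dim X) (vbasis (val X)) by apply: map_tnth_enum.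
  by rewrite val_tcast vbasisP.
have [ix xX spx] := basis_codomP bx.
have [_ _ spw] := basis_codomP (basis_codom iw wZ (lagr_dim Z)).
pose G : 'M[F]_n := \matrix_(i, j) B (x i) (w j).
have GE a j : B (comb x a) (w j) = (a *m G) 0 j.
  rewrite linear_sumlz mxE; apply: eq_bigr => i _.
  by rewrite altZl mxE.
(* A vector of X orthogonal to Z lies in Z, which is its own perp, and so is 0. *)
have Gu : G \in unitmx.
  apply: unitmx_left_inj => a aG; apply: ix; apply: d; first exact: comb_in.
  apply: lagr_mem => // u /spw[b ->]; rewrite altC linear_sumr big1 ?oppr0 // => j _.
  by rewrite altZr GE aG mxE mulr0.
exists (fun i => comb x (row i (invmx G))) => [|i]; last exact: comb_in.
split=> [i j|i j|i j].
- by apply: (lagr_iso (X := X)); apply: comb_in.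
- by apply: (lagr_iso (X := Z)).
by rewrite GE -row_mul mulVmx // !mxE.
Qed.

Lemma basis_extends W Z : (W <= Z)%VS -> \dim Z = n -> exists w,
  [/\ indep w, forall i, w i \in Z, forall i : 'I_n, (i < \dim W)%N -> w i \in W &
      forall v, v \in W -> exists2 a : 'rV[F]_n,
        forall i : 'I_n, (\dim W <= i)%N -> a 0 i = 0 & v = comb w a].
Proof.
move=> WZ dZ; pose s := vbasis W ++ vbasis (Z :\: W).
have ZW : (Z :&: W = W)%VS by apply/capv_idPr.
have ZE : (W + (Z :\: W) = Z)%VS by rewrite addvC -[X in (_ + X)%VS]ZW addv_diff_cap.
have bs : basis_of Z s.
  rewrite -[Z in basis_of Z]ZE; apply: cat_basis; [|exact: vbasisP..].
  by apply/directv_addP; rewrite capvC capv_diff.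
have ss : size s == n.
  by have /andP[/eqP sZ /eqP sf] := bs; rewrite -sf sZ dZ.
pose w := tnth (Tuple ss); have cw : codom w = s by apply: map_tnth_enum.
have bw : basis_of Z (codom w) by rewrite cw.
have [iw wZ _] := basis_codomP bw; exists w; split=> // [i lti|v Wv].
  by rewrite /w (tnth_nth 0) /= nth_cat size_tuple lti vbasis_mem // mem_nth // size_tuple.
have : v \in <<vbasis W>>%VS by rewrite (span_basis (vbasisP W)).
move=> /coord_span->; elim/big_rec: _ => [|i _ v' [a az ->]].
  by exists 0 => [i|]; rewrite ?mxE ?comb0.
have lti : (i < n)%N.
  by apply: leq_trans (ltn_ord i) _; rewrite -dZ dimvS.
have wi : w (Ordinal lti) = (vbasis W)`_i.
  by rewrite /w (tnth_nth 0) /= nth_cat size_tuple ltn_ord.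
set c := coord _ _ _; exists (c *: delta_mx 0 (Ordinal lti) + a).
  move=> k lek; rewrite !mxE az // addr0 [k == _](_ : _ = false) ?andbF ?mulr0 //.
  apply/negP => /eqP Ek; move: lek; rewrite Ek /= leqNgt.
  by rewrite ltn_ord.
by rewrite combD combZ comb_delta wi.
Qed.

(** A complement W of the intersection in Y is extended to a Lagrangian Z disjoint from X, with a
    basis that starts in W. The dual vectors e_i with i >= k are orthogonal to W and to the
    intersection, hence to Y, and so lie in Y. *)
Lemma adapted_frame X Y : exists e f, [/\ frame B e f, forall i, e i \in val X &
  forall i : 'I_n, (if (i < dist X Y)%N then f i else e i) \in val Y].
Proof.
pose W := (val Y :\: val X)%VS.
have dW : \dim W = dist X Y.
  by have := dimv_cap_compl (val Y) (val X); rewrite lagr_dim capvC -/W /dist; lia.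
have WY : (W <= val Y)%VS by apply: diffvSl.
have iW : iso B W by move=> u v /(subvP WY) Yu /(subvP WY) Yv; apply: lagr_iso Yu Yv.
have dWX : disj W (val X) by apply: cap_disj; rewrite capv_diff dimv0.
have [Z [WZ ZX _]] := iso_in_opposite dimV B_alternating B_nondegenerate iW dWX dWX.
have [w [iw wZ wW Wsp]] := basis_extends WZ (lagr_dim Z).
have XZ : disj (val X) (val Z) by move=> v Xv Zv; apply: ZX.
have [e ew eX] := dual_frame XZ iw wZ; exists e, w; split=> // i.
case: ifP => lti; first by apply: (subvP WY); apply: wW; rewrite dW.
apply: lagr_mem => // u Yu; have : u \in (W + val Y :&: val X)%VS by rewrite addv_diff_cap.
case/memv_addP=> u1 /Wsp[a az ->] [u2]; rewrite memv_cap => /andP[_ Xu2] ->.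
rewrite altDl (lagr_iso Xu2 (eX i)) addr0 altC -[e i]comb_delta (frame_ef ew).
rewrite /dot (bigD1 i) //= big1 ?addr0 => [|j ne]; last by rewrite mxE (negbTE ne) mul0r.
by rewrite az ?mulr0 ?oppr0 // dW leqNgt lti.
Qed.

Lemma dot_aut (t : {perm F}) a b : field_aut t ->
  t (dot a b) = dot (map_mx t a) (map_mx t b).
Proof.
move=> tP; rewrite /dot (big_morph t (field_autD tP) (field_aut0 tP)).
by apply: eq_bigr => i _; rewrite field_autM // !mxE.
Qed.

Lemma frame_form e f a b a' b' : frame B e f ->
  B (comb e a + comb f b) (comb e a' + comb f b') = dot a b' - dot a' b.
Proof.
move=> ef; rewrite altDl !altDr (frame_ee ef) (frame_ff ef) (frame_ef ef) add0r addr0.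
by rewrite [B (comb f b) _]altC (frame_ef ef).
Qed.

Lemma frame_semi_isometry e f e' f' (t : {perm F}) :
    frame B e f -> frame B e' f' -> field_aut t ->
  exists2 g : {perm fV}, semi_isometry B t g &
    forall a b, g (comb e a + comb f b) = comb e' (map_mx t a) + comb f' (map_mx t b).
Proof.
move=> ef ef' tP.
pose h (v : fV) : fV := comb e' (map_mx t (fcoord_e B f v)) + comb f' (map_mx t (fcoord_f B e v)).
have hE a b : h (comb e a + comb f b) = comb e' (map_mx t a) + comb f' (map_mx t b).
  by rewrite /h fcoord_eK // fcoord_fK.
have dec := frame_decomp dimV ef.
have h_form u v : B (h u) (h v) = t (B u v).
  rewrite (dec u) (dec v) !hE !frame_form // field_autD // field_autN //.
  by rewrite !dot_aut.
(* Injectivity comes from preserving a nondegenerate form. *)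
have h_inj : injective h.
  move=> u v E; apply/eqP; rewrite -subr_eq0; apply/eqP/B_nondegenerate => z.
  rewrite altDl -scaleN1r altZl mulN1r; apply/eqP; rewrite subr_eq0; apply/eqP.
  by apply: (@perm_inj _ t); rewrite -!h_form E.
exists (perm h_inj) => [|a b]; last by rewrite permE hE.
apply/and3P; split=> //; last first.
  by apply/forallP => u; apply/forallP => v; rewrite !permE h_form.
apply/forallP => k; apply/forallP => u; apply/forallP => v; rewrite !permE /h.
rewrite (_ : fcoord_e B f (k *: u + v) = k *: fcoord_e B f u + fcoord_e B f v); last first.
  by apply/rowP => i; rewrite !mxE altDl altZl.
rewrite (_ : fcoord_f B e (k *: u + v) = k *: fcoord_f B e u + fcoord_f B e v); last first.
  by apply/rowP => i; rewrite !mxE altDr altZr.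
have tD a b : map_mx t (k *: a + b) = t k *: map_mx t a + map_mx t b.
  by apply/rowP => i; rewrite !mxE field_autD // field_autM.
by rewrite !tD !combD !combZ scalerDr addrACA.
Qed.

Section Sigma.
Variable delta : forall X : lagr B n, detfun n (val X).

Definition gram_det X Y (x y : {ffun 'I_n -> V}) : F :=
  let i0 := widen_ord (leq_subr (\dim (val X :&: val Y)) n) in
  \det (\matrix_(i < dist X Y, j < dist X Y) B (x (i0 i)) (y (i0 j))).

(** Both changes of basis preserve the intersection and agree there, and the Gram matrix vanishes
    outside its first k rows and columns. By [gram_change] the product changes by a nonzero
    square. *)
Lemma adapted_gram_change X Y (x y x' y' : {ffun 'I_n -> V}) :
    adapted_bases X Y x y -> adapted_bases X Y x' y' ->
  chi (delta X x' * delta Y y' * gram_det X Y x' y') =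
  chi (delta X x * delta Y y * gram_det X Y x y).
Proof.
move=> /and4P[bx by_ /forallP xy bxy] /and4P[bx' by' /forallP xy' bxy'].
have [ix xX spx] := basis_codomP bx; have [iy yY spy] := basis_codomP by_.
have [ix' xX' _] := basis_codomP bx'; have [iy' yY' _] := basis_codomP by'.
have xyE (i : 'I_n) : (dist X Y <= i)%N -> x i = y i by move=> le; have := xy i; rewrite le => /eqP.
have xyE' (i : 'I_n) : (dist X Y <= i)%N -> x' i = y' i by move=> le; have := xy' i; rewrite le => /eqP.
set k := dist X Y in xyE xyE' *.
have row_ex (i : 'I_n) : exists p : 'rV[F]_n * 'rV[F]_n,
    [/\ x' i = comb x p.1, y' i = comb y p.2 &
        (k <= i)%N -> p.1 = p.2 /\ forall j : 'I_n, (j < k)%N -> p.1 0 j = 0].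
  have [lt | ge] := ltnP i k.
    have [[a Ea] [c Ec]] := (spx _ (xX' i), spy _ (yY' i)).
    by exists (a, c).
  have : x' i \in (val X :&: val Y)%VS by rewrite memv_cap xX' xyE' // yY'.
  rewrite -(span_basis bxy) => /span_image[a az Ea]; have az' (j : 'I_n) : (j < k)%N -> a 0 j = 0.
    by move=> lt; apply: az; rewrite inE -ltnNge.
  exists (a, a); split=> //=; rewrite -xyE' // Ea; apply: eq_bigr => j _.
  by have [/az' -> | /xyE ->] := ltnP j k; rewrite ?scale0r.
have [p pP] := fin_all_exists row_ex.
pose A : 'M[F]_n := \matrix_i (p i).1; pose C : 'M[F]_n := \matrix_i (p i).2.
have x'E i : x' i = comb x (row i A) by rewrite rowK; have [] := pP i.
have y'E i : y' i = comb y (row i C) by rewrite rowK; have [] := pP i.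
rewrite (detfun_comb (delta X) (lagr_dim X) ix xX x'E).
rewrite (detfun_comb (delta Y) (lagr_dim Y) iy yY y'E).
pose G : 'M[F]_n := \matrix_(i, j) B (x i) (y j).
have G'E i j : B (x' i) (y' j) = (A *m G *m C^T) i j.
  rewrite x'E y'E form_comb mxE exchange_big; apply: eq_bigr => l _ /=.
  rewrite !mxE mulr_suml; apply: eq_bigr => m _; by rewrite !mxE.
have cap (i : 'I_n) : (k <= i)%N -> x i \in val X /\ x i \in val Y.
  by move=> le; rewrite xX; rewrite (xyE _ le) yY.
pose lek := leq_subr (\dim (val X :&: val Y)) n; pose w := widen_ord lek.
have [||||c [c0 Ec]] := @gram_change F n k lek A C G.
- by move=> i j ge lt; rewrite !mxE; have [_ _ /(_ ge)[_ ->]] := pP i.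
- by move=> i j ge lt; rewrite !mxE; have [_ _ /(_ ge)[<- ->]] := pP i.
- by move=> i j ge; rewrite !mxE; have [_ _ /(_ ge)[-> _]] := pP i.
- move=> i j; rewrite mxE => /orP[/cap[_ Yi] | le].
    by apply: (lagr_iso Yi).
  by rewrite -(xyE _ le); apply: (lagr_iso (X := X)).
have dA : \det A != 0.
  have := detfun_neq0_basis (delta X) (lagr_dim X) ix' xX'.
  by rewrite (detfun_comb (delta X) (lagr_dim X) ix xX x'E) mulf_eq0 negb_or => /andP[].
have dC : \det C != 0.
  have := detfun_neq0_basis (delta Y) (lagr_dim Y) iy' yY'.
  by rewrite (detfun_comb (delta Y) (lagr_dim Y) iy yY y'E) mulf_eq0 negb_or => /andP[].
rewrite -[RHS](chi_sqrM _ (c0 dA dC)); congr chi.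
have gE (M : 'M[F]_n) (u1 v1 : {ffun 'I_n -> V}) : (forall i j, B (u1 i) (v1 j) = M i j) ->
  gram_det X Y u1 v1 = \det (\matrix_(i < k, j < k) M (w i) (w j)).
  by move=> E; rewrite /gram_det /=; apply: congr1; apply/matrixP => i j; rewrite !mxE E.
rewrite (gE _ _ _ G'E) (gE G x y); last by move=> i j; rewrite mxE.
transitivity (delta X x * delta Y y * (\det A * \det C *
  \det (\matrix_(i < k, j < k) (A *m G *m C^T) (w i) (w j)))); first by ring.
by rewrite Ec; ring.
Qed.

End Sigma.
End Frames.

(** * The signs sigma *)

Section OrderOneModFour.
Variable F : finFieldType.
Hypothesis q_mod4 : #|F| = 1 %[mod 4].

Lemma q_ge5 : (4 < #|F|)%N.
Proof.
have q1 : (1 < #|F|)%N := finNzRing_gt1 F.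
by move: q_mod4 q1; move: #|F| => q; lia.
Qed.

Lemma two_neq0_mod4 : 2%:R != 0 :> F.
Proof.
apply/eqP => two0; have pF : 2 \in [pchar F] by rewrite inE /= two0.
have := card_pprimeChar pF; set e := logn _ _ => cardF.
have : odd #|F| by have := divn_eq #|F| 4; rewrite q_mod4 => ->; rewrite oddD oddM andbF.
have := finNzRing_gt1 F; rewrite cardF oddX orbF /= => lt /eqP e0.
by move: lt; rewrite e0.
Qed.

(** Supplies the scalar [s0] of Hua's theorem. *)
Lemma third_unit : exists s : F, [/\ s != 0, s != 1 & s != -1].
Proof.
have : exists s : F, s \notin [:: 0; 1; -1].
  apply/existsP; rewrite -negb_forall; apply/negP => /forallP all3.
  have : (#|F| <= size ([:: 0; 1; -1]%R : seq F))%N.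
    by apply: leq_trans (card_size _); apply/subset_leq_card/subsetP => s _; apply: all3.
  by have := q_ge5 => /= lt le; have := leq_trans lt le.
by case=> s; rewrite !inE !negb_or => /and3P[]; exists s.
Qed.

(** With q = 4 r + 1, some x != 0 has x^(2r) != 1, because X^(2r) - 1 has at most 2r roots. Then
    x^(2r) = -1 is the square of x^r. *)
Lemma chiN1 : chi (-1 : F) = false.
Proof.
pose r := (#|F| %/ 4)%N; have qr : #|F| = (4 * r).+1.
  by have := divn_eq #|F| 4; rewrite q_mod4 mulnC addn1.
have r0 : (0 < r)%N by have := q_ge5; rewrite qr; lia.
have [x x0 xr] : exists2 x : F, x != 0 & x ^+ (2 * r) != 1.
  have [/existsP[x /andP[x0 xr]] | ] := boolP [exists x : F, (x != 0) && (x ^+ (2 * r) != 1)].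
    by exists x.
  rewrite negb_exists => /forallP all1.
  have nz : 'X^(2 * r) - 1%:P != 0 :> {poly F}.
    by rewrite -size_poly_gt0 size_XnsubC // muln_gt0.
  have := max_poly_roots nz (rs := rem 0 (enum F)); rewrite rem_uniq ?enum_uniq //.
  rewrite size_rem ?mem_enum // -cardE qr size_XnsubC ?muln_gt0 // => /(_ _ isT) lt.
  have : (4 * r < (2 * r).+1)%N; last by lia.
  apply: lt; apply/allP => x; rewrite mem_rem_uniq ?enum_uniq // !inE => /andP[x0 _].
  by rewrite /root !hornerE subr_eq0; have := all1 x; rewrite x0 negbK.
apply/negbTE; rewrite negbK; apply/existsP; exists (x ^+ r); rewrite -exprM mulnC.
have : (x ^+ (2 * r) - 1) * (x ^+ (2 * r) + 1) = 0.
  rewrite -subr_sqr expr1n -exprM [X in x ^+ X](_ : _ = (4 * r)%N); last by ring.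
  apply: (mulfI x0); rewrite mulr0 mulrBr mulr1 -exprS -qr expf_card.
  exact: subrr.
by move=> /eqP; rewrite mulf_eq0 subr_eq0 (negbTE xr) addr_eq0.
Qed.

Lemma chi_sign k (a : F) : chi (a * (-1) ^+ k) = chi a.
Proof.
have /chi_square[i Ei] := chiN1; rewrite Ei exprAC -{2}[a]mulr1.
have i0 : i != 0 by apply: contra_eq_neq Ei => ->; rewrite expr0n oppr_eq0 oner_eq0.
by rewrite chi_sqrM ?mulr1 // expf_neq0.
Qed.

End OrderOneModFour.

Lemma det_dim0 (R : comRingType) k (M : 'M[R]_k) : k = 0%N -> \det M = 1.
Proof. by move=> k0; move: M; rewrite k0 => M; apply: det_mx00. Qed.

Lemma det_dim1 (R : comRingType) k (M : 'M[R]_k) (i : 'I_k) : k = 1%N -> \det M = M i i.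
Proof. by move=> k1; move: M i; rewrite k1 => M i; rewrite det_mx11 (ord1 i). Qed.

Lemma card_ord_ge n k : (k <= n)%N -> #|[pred i : 'I_n | (k <= i)%N]| = (n - k)%N.
Proof.
move=> kn; have := cardC [pred i : 'I_n | (i < k)%N].
rewrite -[in X in (X + _)%N = _]sum1_card (big_ord_narrow kn) sum1_card !card_ord => E.
rewrite -[X in (X - k)%N]E addKn; apply: eq_card => i.
by rewrite !inE leqNgt.
Qed.

Section Sigma.
Variables (F : finFieldType) (n : nat) (V : vectType F) (B : {biscalar V}).
Hypothesis q_mod4 : #|F| = 1 %[mod 4].
Hypothesis dimV : \dim {:V} = (2 * n)%N.
Hypothesis B_alternating : forall x : V, B x x = 0.
Hypothesis B_nondegenerate : forall x : V, (forall y : V, B x y = 0) -> x = 0.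
Variable delta : forall X : lagr B n, detfun n (val X).
Implicit Types (X Y : lagr B n).
Local Notation fV := (finvect_type V).
Local Notation sigma := (sigma delta).

Lemma distC X Y : dist X Y = dist Y X.
Proof. by rewrite /dist capvC. Qed.

Lemma dist_eq0 X Y : (dist X Y == 0%N) = (X == Y).
Proof.
rewrite /dist subn_eq0; apply/idP/eqP => [le | ->]; last by rewrite capvv lagr_dim.
have sub U W : \dim U = n -> (n <= \dim (U :&: W))%N -> (U <= W)%VS.
  move=> dU leU; have /eqP <- : (U :&: W)%VS == U by rewrite eqEdim capvSl dU.
  exact: capvSr.
by apply/val_inj/eqP; rewrite eqEdim !lagr_dim leqnn andbT; apply: sub; rewrite ?lagr_dim.
Qed.

Lemma dist_le X Y : (dist X Y <= n)%N. Proof. exact: leq_subr. Qed.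

Lemma dim_cap_dist X Y : \dim (val X :&: val Y) = (n - dist X Y)%N.
Proof. by rewrite /dist subKn // -[n in (_ <= n)%N](lagr_dim X) dimvS // capvSl. Qed.

(** For X = Y the formula agrees with the convention: the determinant is empty and the value of
    [delta X] is squared. *)
Lemma sigmaE X Y (x y : {ffun 'I_n -> V}) : adapted_bases X Y x y ->
  sigma X Y = chi (delta X x * delta Y y * gram_det X Y x y).
Proof.
move=> ad; rewrite /sigma; case: eqP => [EXY | _]; last first.
  case: pickP => [[x' y'] /= ad' | /(_ (x, y))]; last by rewrite /= ad.
  exact: adapted_gram_change ad ad'.
subst Y; have d0 : dist X X = 0%N by apply/eqP; rewrite dist_eq0.
have /and4P[_ _ /forallP xy _] := ad.
have -> : y = x by apply/ffunP => i; have := xy i; rewrite d0 /= => /eqP.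
rewrite /gram_det /= det_dim0 // mulr1; apply/esym/negbTE; rewrite negbK.
by apply/existsP; exists (delta X x); rewrite expr2.
Qed.

(** For an adapted frame and k = [dist X Y], a basis of Y. *)
Definition mixed k (e f : 'I_n -> V) (i : 'I_n) : V := if (i < k)%N then f i else e i.

Lemma mixed_indep k e f : frame B e f -> indep (mixed k e f).
Proof.
move=> ef a Ea; pose a1 := \row_i (if (i < k)%N then 0 else a 0 i).
pose a2 := \row_i (if (i < k)%N then a 0 i else 0).
have E : comb (mixed k e f) a = comb e a1 + comb f a2.
  rewrite -big_split; apply: eq_bigr => i _ /=; rewrite !mxE /mixed.
  by case: ifP; rewrite scale0r ?addr0 ?add0r.
have Z1 : a1 = 0.
  by rewrite -(fcoord_eK ef a1 a2) -E Ea; apply/rowP => i; rewrite !mxE alt0l.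
have Z2 : a2 = 0.
  by rewrite -(fcoord_fK ef a1 a2) -E Ea; apply/rowP => i; rewrite !mxE alt0r.
apply/rowP => i; rewrite mxE.
have := congr1 (fun r : 'rV_n => r 0 i) Z1; have := congr1 (fun r : 'rV_n => r 0 i) Z2.
by rewrite !mxE; case: ifP.
Qed.

Lemma frame_adapted X Y e f (x y : {ffun 'I_n -> V}) : frame B e f ->
    (forall i, e i \in val X) -> (forall i, mixed (dist X Y) e f i \in val Y) ->
    x =1 e -> y =1 mixed (dist X Y) e f ->
  [/\ adapted_bases X Y x y, gram_det X Y x y = 1,
      adapted_bases Y X y x & gram_det Y X y x = (-1) ^+ dist Y X].
Proof.
move=> ef eX yY xE yE; set k := dist X Y in yY yE *.
have ix : indep x by move=> a; rewrite (eq_comb _ xE); apply: frame_indep_e ef _.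
have iy : indep y by move=> a; rewrite (eq_comb _ yE); apply: mixed_indep ef _.
have xX i : x i \in val X by rewrite xE.
have yY' i : y i \in val Y by rewrite yE.
have bx := basis_codom ix xX (lagr_dim X); have by_ := basis_codom iy yY' (lagr_dim Y).
have xy (i : 'I_n) : (k <= i)%N -> x i = y i by rewrite leqNgt xE yE /mixed => /negbTE->.
have bxy (z : 'I_n -> V) : indep z -> (forall i : 'I_n, (k <= i)%N -> z i = x i) ->
    basis_of (val X :&: val Y) [seq z i | i in [pred i : 'I_n | (k <= i)%N]].
  move=> iz zx; apply: basis_image => // [i|]; last first.
    by rewrite dim_cap_dist card_ord_ge // dist_le.
  by rewrite inE memv_cap => ki; rewrite zx // xX xy // yY'.
have kYX : dist Y X = k by rewrite distC.
split.
- by apply/and4P; split=> //; [apply/forallP => i; apply/implyP => /xy->| apply: bxy].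
- rewrite /gram_det /= -[RHS](det1 F (dist X Y)); congr (\det _); apply/matrixP => i j.
  have [_ _ E] := ef; rewrite !mxE xE yE /mixed /= ltn_ord E.
  by congr (_%:R); rewrite -!val_eqE.
- apply/and4P; split=> //; first by apply/forallP => i; apply/implyP; rewrite kYX => /xy->.
  by rewrite kYX capvC; apply: bxy => // i /xy.
rewrite /gram_det /= -[RHS]det_scalar; congr (\det _).
apply/matrixP => i j; have [_ _ E] := ef.
rewrite !mxE xE yE /mixed /= -{1}kYX ltn_ord (altC B_alternating) E mulNrn.
by congr (- _%:R); rewrite eq_sym -!val_eqE.
Qed.

Lemma delta_neq0 X (x : {ffun 'I_n -> V}) :
  indep x -> (forall i, x i \in val X) -> delta X x != 0.
Proof. exact: detfun_neq0_basis (lagr_dim X) x. Qed.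

(** On an adapted frame the Gram matrix is the identity, so only the determinant functions
    remain. *)
Lemma frame_sigma X Y e f (x y : {ffun 'I_n -> V}) : frame B e f ->
    (forall i, e i \in val X) -> (forall i, mixed (dist X Y) e f i \in val Y) ->
    x =1 e -> y =1 mixed (dist X Y) e f ->
  sigma X Y = chi (delta X x) (+) chi (delta Y y).
Proof.
move=> ef eX yY xE yE; have [ad g1 _ _] := frame_adapted ef eX yY xE yE.
rewrite (sigmaE ad) g1 mulr1 chiM //; apply: delta_neq0.
- by move=> a; rewrite (eq_comb _ xE); apply: frame_indep_e ef _.
- by move=> i; rewrite xE.
- by move=> a; rewrite (eq_comb _ yE); apply: mixed_indep ef _.
by move=> i; rewrite yE.
Qed.

(** The exchange of X and Y turns the identity Gram matrix into its negative, of determinant (-1)^k,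
    a square. *)
Lemma sigmaC X Y : sigma X Y = sigma Y X.
Proof.
have [e [f [ef eX yY]]] := adapted_frame dimV B_alternating B_nondegenerate X Y.
have xE : [ffun i => e i] =1 e by move=> i; rewrite ffunE.
have yE : [ffun i => mixed (dist X Y) e f i] =1 mixed (dist X Y) e f by move=> i; rewrite ffunE.
have [ad g1 ad' g2] := frame_adapted ef eX yY xE yE.
by rewrite (sigmaE ad) (sigmaE ad') g1 g2 chi_sign // mulr1 mulrC.
Qed.

Section SemiIsometries.
Variable g : {perm fV}.
Hypothesis Gg : g \in SigmaSp B.
Let gP := autFP Gg.
Let tP := semi_field_aut gP.

Lemma semi_frame (e f : 'I_n -> V) : frame B e f -> frame B (fun i => g (e i)) (fun i => g (f i)).
Proof.
move=> [ee ff E]; split=> i j; rewrite (semi_form gP).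
- by rewrite ee field_aut0.
- by rewrite ff field_aut0.
by rewrite E; case: eqP; rewrite ?field_aut0 ?field_aut_1.
Qed.

Lemma im_space_cap (U W : {vspace V}) :
  (im_space g U :&: im_space g W)%VS = im_space g (U :&: W).
Proof.
apply/vspaceP => v; rewrite memv_cap; apply/andP/(mem_im_spaceP gP) => [[] | [u]].
  move=> /(mem_im_spaceP gP)[u Uu ->]; rewrite (mem_im_space gP) => Wu.
  by exists u; rewrite // memv_cap Uu.
by rewrite memv_cap => /andP[Uu Wu] ->; rewrite !(mem_im_space gP).
Qed.

Lemma dist_im X Y : dist (lagr_im g X) (lagr_im g Y) = dist X Y.
Proof. by rewrite /dist !val_lagr_im // im_space_cap (dim_im_space gP). Qed.

(** An adapted frame of (X, Y) is mapped to one of the images, and [lambda] measures the change of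
    the two determinant functions. *)
Lemma sigma_im X Y : sigma (lagr_im g X) (lagr_im g Y) =
  sigma X Y (+) chi (lambda delta g X) (+) chi (lambda delta g Y).
Proof.
have [e [f [ef eX yY]]] := adapted_frame dimV B_alternating B_nondegenerate X Y.
pose x : {ffun 'I_n -> V} := [ffun i => e i].
pose y : {ffun 'I_n -> V} := [ffun i => mixed (dist X Y) e f i].
have xE : x =1 e by move=> i; rewrite ffunE.
have yE : y =1 mixed (dist X Y) e f by move=> i; rewrite ffunE.
have xX : family_in (val X) x by move=> i; rewrite xE.
have yY' : family_in (val Y) y by move=> i; rewrite yE; apply: yY.
have dx : delta X x != 0.
  apply: (delta_neq0 _ xX) => a.
  by rewrite (eq_comb _ xE); apply: frame_indep_e ef _.
have dy : delta Y y != 0.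
  apply: (delta_neq0 _ yY') => a.
  by rewrite (eq_comb _ yE); apply: mixed_indep ef _.
have [gx _ Ex] := chi_lambda Gg xX dx; have [gy _ Ey] := chi_lambda Gg yY' dy.
have gxE : gframe g x =1 (fun i => g (e i)) by move=> i; rewrite ffunE xE.
have gyE : gframe g y =1 mixed (dist (lagr_im g X) (lagr_im g Y))
    (fun i => g (e i)) (fun i => g (f i)).
  by move=> i; rewrite ffunE yE dist_im /mixed; case: ifP.
rewrite (frame_sigma (semi_frame ef) _ _ gxE gyE); last 2 first.
- by move=> i; rewrite -gxE; apply: gx.
- by move=> i; rewrite -gyE; apply: gy.
rewrite Ex Ey (frame_sigma ef eX yY xE yE).
by do 4!case: (chi _).
Qed.

End SemiIsometries.
End Sigma.

(** * The action on the double cover *)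

Section Orbitals.
Variables (aT : finGroupType) (D : {group aT}) (T : finType) (to : action D T) (d : nat).
Variables (R : 'I_d.+1 -> {set T * T}) (G : {group aT}).
Hypotheses (GD : G \subset D).
Hypothesis R_total : forall x y, exists i, (x, y) \in R i.
Hypothesis R_inh : forall i, exists x y, (x, y) \in R i.
Hypothesis R_inv : forall i x y a, a \in G -> (x, y) \in R i -> (to x a, to y a) \in R i.
Hypothesis R_trans : forall i x y x' y', (x, y) \in R i -> (x', y') \in R i ->
  exists2 a, a \in G & to x a = x' /\ to y a = y'.

Lemma orbitalsP : orbitals to G = relations R.
Proof.
have orbE i x y : (x, y) \in R i -> orbit (diag_action to) G (x, y) = R i.
  move=> Rxy; apply/setP => -[x' y']; apply/orbitP/idP => [[a Ga [<- <-]] | Rxy'].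
    exact: R_inv.
  have [a Ga [Ex Ey]] := R_trans Rxy Rxy'; exists a => //.
  by rewrite /= /diag_act /= Ex Ey.
apply/setP => A; apply/imsetP/imsetP => [[[x y] _ ->] | [i _ ->]].
  by have [i Ri] := R_total x y; exists i; rewrite ?inE // (orbE i).
by have [x [y Rxy]] := R_inh i; exists (x, y); rewrite ?inE // (orbE i).
Qed.

End Orbitals.

Section RelationIndices.
Variable n : nat.

(** An index amounts to a distance and a sign: k stands for (k, +1) and 2n+1-k for (k, -1). *)
Definition rdist (i : 'I_(n.*2.+2)) : nat := if (i <= n)%N then (i : nat) else (n.*2.+1 - i)%N.
Definition rsgn (i : 'I_(n.*2.+2)) : bool := ~~ (i <= n)%N.

Lemma rdist_le i : (rdist i <= n)%N.
Proof. by rewrite /rdist; case: ifP => // /negbT; rewrite -ltnNge; lia. Qed.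

Lemma rel_index (k : nat) (b : bool) : (k <= n)%N -> exists i, rdist i = k /\ rsgn i = b.
Proof.
move=> kn; have lt : ((if b then n.*2.+1 - k else k) < n.*2.+2)%N by case: b; lia.
exists (Ordinal lt); rewrite /rdist /rsgn /=; case: b {lt}; last by rewrite kn.
have -> : (n.*2.+1 - k <= n)%N = false by apply/negbTE; rewrite -ltnNge; lia.
by split=> //; lia.
Qed.

Lemma rel_index_inj i j : rdist i = rdist j -> rsgn i = rsgn j -> i = j.
Proof.
rewrite /rdist /rsgn => E1 /negb_inj E2; apply: val_inj => /=.
have := ltn_ord i; have := ltn_ord j; move: E1; rewrite E2; case: ifP => //; lia.
Qed.

End RelationIndices.

(** * Invariants of pairs of points of the cover, and transitivity *)

Section Cover.
Variables (F : finFieldType) (n : nat) (V : vectType F) (B : {biscalar V}).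
Hypothesis q_mod4 : #|F| = 1 %[mod 4].
Hypothesis dimV : \dim {:V} = (2 * n)%N.
Hypothesis B_alternating : forall x : V, B x x = 0.
Hypothesis B_nondegenerate : forall x : V, (forall y : V, B x y = 0) -> x = 0.
Variable delta : forall X : lagr B n, detfun n (val X).
Implicit Types (X Y U : lagr B n) (x y z : Defs.cover B n).
Local Notation fV := (finvect_type V).
Local Notation sigma := (sigma delta).
Local Notation R := (cover_rel delta).
Local Notation neg := (negV V).

(** The product of both signs and [sigma]; together with the distance it determines the relation of
    x and y. *)
Definition csgn x y : bool := x.2 (+) y.2 (+) sigma x.1 y.1.
Lemma cover_relE i x y :
  ((x, y) \in R i) = (dist x.1 y.1 == rdist i) && (csgn x y == rsgn i).
Proof.
rewrite /cover_rel /rdist /rsgn /csgn; case: ifP => _; rewrite inE /=; congr (_ && _).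
  by case: (x.2 (+) y.2); case: (sigma _ _).
by case: (x.2 (+) y.2); case: (sigma _ _).
Qed.

Lemma cover_rel_total x y : exists i, (x, y) \in R i.
Proof.
have [i [Ed Es]] := rel_index (csgn x y) (dist_le x.1 y.1).
by exists i; rewrite cover_relE Ed Es !eqxx.
Qed.

Lemma same_rel i j x y x' y' : (x, y) \in R i -> (x', y') \in R j ->
  (i == j) = (dist x.1 y.1 == dist x'.1 y'.1) && (csgn x y == csgn x' y').
Proof.
rewrite !cover_relE => /andP[/eqP-> /eqP->] /andP[/eqP-> /eqP->].
apply/eqP/andP => [-> // | [/eqP E1 /eqP E2]]; exact: rel_index_inj.
Qed.

Lemma sgnC x y : csgn x y = csgn y x.
Proof. by rewrite /csgn sigmaC // [x.2 (+) _]addbC. Qed.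

Lemma cover_act_dist_sgn g x y : g \in SigmaSp B ->
  dist (cover_act delta x g).1 (cover_act delta y g).1 = dist x.1 y.1 /\
  csgn (cover_act delta x g) (cover_act delta y g) = csgn x y.
Proof.
move=> Gg; rewrite /cover_act Gg /= dist_im //; split=> //.
rewrite /csgn /= sigma_im //.
by do 2!case: (chi _); case: x.2 y.2 (sigma _ _) => [] [] [].
Qed.

Lemma zetaP (s : {perm Defs.cover B n}) : s \in <[zeta B n]>%g -> exists b, forall x, s x = (x.1, b (+) x.2).
Proof.
case/cycleP=> k ->; exists (odd k) => x; elim: k x => [|k IHk] [U c] /=.
  by rewrite perm1.
by rewrite expgSr permM IHk permE /= addNb.
Qed.

Lemma zeta_ex b : exists2 s : {perm Defs.cover B n}, s \in <[zeta B n]>%g & forall x, s x = (x.1, b (+) x.2).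
Proof.
case: b; first by exists (zeta B n) => [|[U c]]; rewrite ?cycle_id // permE.
by exists 1%g => [|[U c]]; rewrite ?group1 // perm1.
Qed.

Lemma negV_Sp : neg \in Sp B.
Proof.
rewrite inE; apply/and3P; split.
- by apply/forallP => a; apply/forallP => b; rewrite !perm1 !eqxx.
- apply/forallP => a; apply/forallP => u; apply/forallP => v; rewrite perm1 !permE.
  by rewrite opprD scalerN.
apply/forallP => u; apply/forallP => v; rewrite perm1 !permE.
by rewrite linearNl linearNr opprK.
Qed.

Lemma Sp_sub : Sp B \subset SigmaSp B.
Proof. by apply/subsetP => g; rewrite !inE => gP; apply/existsP; exists 1%g. Qed.

Lemma negV_SigmaSp : neg \in SigmaSp B.
Proof. exact: (subsetP Sp_sub) negV_Sp. Qed.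

Lemma negV_norm g : g \in SigmaSp B -> g \in 'N(<[neg]>)%g.
Proof.
move=> /autFP gP; apply: (subsetP (cent_sub _)); rewrite cent_cycle; apply/cent1P.
apply/permP => v; rewrite !permM !permE.
have gN : g (- v) = - g v.
  by apply: (addIr (g v)); rewrite addNr -(semiD gP) addNr (semi0 gP).
by rewrite gN.
Qed.

(** -I multiplies each determinant function by (-1)^n, a square. *)
Lemma negV_act x : cover_act delta x neg = x.
Proof.
have Gn := negV_SigmaSp; rewrite /cover_act Gn; case: x => U c /=.
have EU : lagr_im neg U = U.
  apply: val_inj; rewrite val_lagr_im //; apply/eqP; rewrite eqEdim.
  rewrite (dim_im_space (autFP Gn)) leqnn andbT; apply/subvP => v.
  by move=> /(mem_im_spaceP (autFP Gn))[u Uu ->]; rewrite permE memvN.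
have [e [f [ef eU _]]] := adapted_frame dimV B_alternating B_nondegenerate U U.
pose u : {ffun 'I_n -> V} := [ffun i => e i].
have uE : u =1 e by move=> i; rewrite ffunE.
have uU : family_in (val U) u by move=> i; rewrite uE.
have iu : indep u by move=> a; rewrite (eq_comb _ uE); apply: frame_indep_e ef _.
have du := delta_neq0 delta iu uU; have [_ _] := chi_lambda Gn uU du.
rewrite EU (@detfun_comb _ _ _ _ (delta U) (lagr_dim U) u _ (-1)%:M) //; last first.
  move=> i; rewrite !ffunE permE -[e i]comb_delta -scaleN1r -combZ.
  rewrite (eq_comb _ uE); congr (comb e _); apply/rowP => j.
  by rewrite !mxE eqxx mulr_natr eq_sym.
rewrite det_scalar mulrC chi_sign // => E; congr (_, _).
by move: E; case: (chi (lambda _ _ _)); case: (chi _).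
Qed.

(** The quotient action moves only points fixed by the kernel; here these are all points. *)
Lemma negV_fix x : x \in 'Fix_(cover_action delta)(SigmaSp B :&: <[neg]>)%g.
Proof.
apply/afixP => a /setIP[_ /cycleP[k ->]]; rewrite actXin ?negV_SigmaSp //.
by elim: k => //= k ->; apply: negV_act.
Qed.

Lemma full_act_coset x (z : {perm Defs.cover B n}) g : g \in SigmaSp B ->
  full_act delta x (z, coset <[neg]> g) = cover_act delta (z x) g.
Proof.
move=> Gg; rewrite /full_act /mod_cover_action /=.
by rewrite modactE ?negV_norm // negV_fix.
Qed.

Lemma two_PSp_sub : two_PSp B n \subset two_PSigmaSp B n.
Proof. by rewrite setXS // quotientS // Sp_sub. Qed.

Lemma full_act_elem a : a \in two_PSigmaSp B n -> exists g b, g \in SigmaSp B /\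
  forall x, full_act delta x a = cover_act delta (x.1, b (+) x.2) g.
Proof.
case: a => z c; rewrite in_setX /= => /andP[/zetaP[b zE]].
case/morphimP=> g _ Gg ->; exists g, b; split=> // x.
by rewrite full_act_coset // zE.
Qed.

Lemma full_act_ex g b : g \in SigmaSp B -> exists a,
  [/\ a \in two_PSigmaSp B n, g \in Sp B -> a \in two_PSp B n &
      forall x, full_act delta x a = cover_act delta (x.1, b (+) x.2) g].
Proof.
move=> Gg; have [z zeta_z zE] := zeta_ex b; exists (z, coset <[neg]> g).
split=> [|Sg|x]; last by rewrite full_act_coset // zE.
  by rewrite in_setX zeta_z mem_quotient.
by rewrite in_setX zeta_z mem_quotient.
Qed.

Lemma full_act_dist_sgn a x y : a \in two_PSigmaSp B n ->
  dist (full_act delta x a).1 (full_act delta y a).1 = dist x.1 y.1 /\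
  csgn (full_act delta x a) (full_act delta y a) = csgn x y.
Proof.
case/full_act_elem=> g [b [Gg E]]; rewrite !E.
have [-> ->] := cover_act_dist_sgn (x.1, b (+) x.2) (y.1, b (+) y.2) Gg.
by rewrite /csgn /=; split=> //; case: b x.2 y.2 (sigma _ _) {E} => [] [] [] [].
Qed.

Lemma cover_rel_inv i x y a : a \in two_PSigmaSp B n ->
  ((full_act delta x a, full_act delta y a) \in R i) = ((x, y) \in R i).
Proof. by move=> Ga; rewrite !cover_relE; have [-> ->] := full_act_dist_sgn x y Ga. Qed.

Lemma full_act_transitive x y x' y' : dist x.1 y.1 = dist x'.1 y'.1 ->
    csgn x y = csgn x' y' ->
  exists2 a, a \in two_PSp B n & full_act delta x a = x' /\ full_act delta y a = y'.
Proof.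
case: x y x' y' => [X c] [Y d] [X' c'] [Y' d'] /= Ed Es.
have [e [f [ef eX yY]]] := adapted_frame dimV B_alternating B_nondegenerate X Y.
have [e' [f' [ef' eX' yY']]] := adapted_frame dimV B_alternating B_nondegenerate X' Y'.
have t1 : field_aut (1%g : {perm F}).
  by apply/forallP => a; apply/forallP => b; rewrite !perm1 !eqxx.
have [g gP gE] := frame_semi_isometry dimV B_alternating B_nondegenerate ef ef' t1.
have Sg : g \in Sp B by rewrite inE.
have Gg := subsetP Sp_sub _ Sg.
have m1 (a : 'rV[F]_n) : map_mx (1%g : {perm F}) a = a.
  by apply/rowP => i; rewrite mxE perm1.
have ge i : g (e i) = e' i.
  have := gE (delta_mx 0 i) 0; rewrite !m1 !comb0 !addr0 !comb_delta.
  by [].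
have gf i : g (f i) = f' i.
  have := gE 0 (delta_mx 0 i); rewrite !m1 !comb0 !add0r !comb_delta.
  by [].
have im_sub (U U' : lagr B n) (u : 'I_n -> V) : indep u -> (forall i, u i \in val U) ->
    (forall i, g (u i) \in val U') -> lagr_im g U = U'.
  move=> iu uU guU'; apply/val_inj/eqP; rewrite val_lagr_im // eqEdim.
  rewrite (dim_im_space (autFP Gg)) !lagr_dim leqnn andbT; apply/subvP => v.
  case/(mem_im_spaceP (autFP Gg))=> w Uw ->.
  have [_ _ /(_ w Uw)[a ->]] := basis_codomP (basis_codom iu uU (lagr_dim U)).
  rewrite /comb (big_morph g (semiD (autFP Gg)) (semi0 (autFP Gg))).
  by apply: memv_suml => i _; rewrite (semiZ (autFP Gg)) memvZ.
have gX : lagr_im g X = X'.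
  by apply: (im_sub _ _ e) => [|//|i]; [apply: frame_indep_e ef | rewrite ge].
have gY : lagr_im g Y = Y'.
  apply: (im_sub _ _ (mixed (dist X Y) e f)) => [|//|i]; first exact: mixed_indep ef.
  by have := yY' i; rewrite -Ed /mixed; case: ifP; rewrite (ge, gf).
(* This power of [zeta] corrects the sign of the first point; invariance of [csgn] then forces the
   sign of the second. *)
pose b := chi (lambda delta g X) (+) c (+) c'.
have [a [_ /(_ Sg) Ga aE]] := full_act_ex b Gg; exists a => //.
have aG := subsetP two_PSp_sub _ Ga.
have [_] := full_act_dist_sgn (X, c) (Y, d) aG; rewrite {}Es.
rewrite !aE /cover_act Gg /= gX gY /csgn /= /b => E {aE Ga aG a}.
move: E; move: (chi _) (chi _) (sigma _ _) => l1 l2 s E; split; congr (_, _).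
  by move: l2 c c' {E b} => [] [] [].
by move: l1 l2 s c d c' d' E {b} => [] [] [] [] [] [] [].
Qed.

Lemma exists_frame : exists e f : 'I_n -> V, frame B e f.
Proof.
have i0 : iso B (0%VS : {vspace V}).
  by move=> u v; rewrite !memv0 => /eqP-> _; apply: alt0l.
have [X _] := iso_in_lagr dimV B_alternating B_nondegenerate i0.
have [e [f [ef _ _]]] := adapted_frame dimV B_alternating B_nondegenerate X X.
by exists e, f.
Qed.

Lemma frame_lagr (u : 'I_n -> V) : indep u -> (forall i j, B (u i) (u j) = 0) ->
  exists X : lagr B n, val X = <<codom u>>%VS.
Proof.
move=> iu uu; apply: lagr_make; first exact: span_frame_dim.
move=> v w /span_codom[a ->] /span_codom[b ->]; rewrite form_comb big1 // => i _.
by rewrite big1 // => j _; rewrite uu mulr0 mul0r.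
Qed.

Lemma dist_onto k : (k <= n)%N -> exists X Y : lagr B n, dist X Y = k.
Proof.
move=> kn; have [e [f ef]] := exists_frame; have [ee ff E] := ef.
have ie := frame_indep_e ef; have im := mixed_indep (k := k) ef.
have [X EX] := frame_lagr ie ee.
have [|Y EY] := frame_lagr im.
  move=> i j; rewrite /mixed; case: ifP => lti; case: ifP => ltj //.
    rewrite (altC B_alternating) E (_ : (j == i) = false) ?oppr0 //.
    by apply/negbTE; apply: contraFneq ltj => ->.
  by rewrite E (_ : (i == j) = false) //; apply: contraFF lti => /eqP->.
exists X, Y; rewrite /dist EX EY.
have -> : (<<codom e>> :&: <<codom (mixed k e f)>>)%VS =
    <<[seq e i | i in [pred i : 'I_n | (k <= i)%N]]>>%VS.
  apply/eqP; rewrite eqEsubv; apply/andP; split; apply/subvP => v.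
    rewrite memv_cap => /andP[/span_codom[a ->] /span_codom[b Eab]].
    have az (i : 'I_n) : (i < k)%N -> a 0 i = 0.
      move=> ltik; rewrite -(frame_e_f ef) Eab linear_sumlz big1 // => j _.
      rewrite altZl /mixed; case: ifP => ltj; first by rewrite ff mulr0.
      by rewrite E (_ : (j == i) = false) ?mulr0 //; apply: contraFF ltj => /eqP->.
    apply: memv_suml => i _; have [/az-> | ge] := ltnP i k; first by rewrite scale0r mem0v.
    by apply: memvZ; apply: memv_span; apply: image_f.
  case/span_image=> a az ->; rewrite memv_cap; apply/andP; split.
    by apply: comb_in => i; apply: memv_span; apply: codom_f.
  apply: memv_suml => i _; have [lt | ge] := ltnP i k.
    by rewrite az ?scale0r ?mem0v // inE -ltnNge.
  have -> : e i = mixed k e f i by rewrite /mixed ltnNge ge.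
  by apply: memvZ; apply: memv_span; apply: codom_f.
have /eqP -> := indep_free_image [pred i : 'I_n | (k <= i)%N] ie.
by rewrite size_image card_ord_ge // subKn.
Qed.

End Cover.

(** * The association scheme and faithfulness *)

Section Scheme.
Variables (F : finFieldType) (n : nat) (V : vectType F) (B : {biscalar V}).
Hypothesis n_gt0 : (0 < n)%N.
Hypothesis q_mod4 : #|F| = 1 %[mod 4].
Hypothesis dimV : \dim {:V} = (2 * n)%N.
Hypothesis B_alternating : forall x : V, B x x = 0.
Hypothesis B_nondegenerate : forall x : V, (forall y : V, B x y = 0) -> x = 0.
Variable delta : forall X : lagr B n, detfun n (val X).
Implicit Types (X Y U : lagr B n) (x y z : Defs.cover B n).
Local Notation fV := (finvect_type V).
Local Notation sigma := (sigma delta).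
Local Notation R := (cover_rel delta).
Local Notation neg := (negV V).
Local Notation to := (full_action delta).

Lemma cover_rel_inh i : exists x y, (x, y) \in R i.
Proof.
have [X [Y dXY]] := dist_onto dimV B_alternating B_nondegenerate (rdist_le i).
exists (X, false), (Y, rsgn i (+) sigma X Y); rewrite cover_relE /csgn /= dXY eqxx.
by rewrite addbK eqxx.
Qed.

Lemma cover_rel_trans i x y x' y' : (x, y) \in R i -> (x', y') \in R i ->
  exists2 a, a \in two_PSp B n & to x a = x' /\ to y a = y'.
Proof.
rewrite !cover_relE => /andP[/eqP Ed /eqP Es] /andP[/eqP Ed' /eqP Es'].
by apply: full_act_transitive; rewrite ?Ed ?Es.
Qed.

Lemma orbitals_two_PSp : orbitals to (two_PSp B n) = relations R.
Proof.
apply: orbitalsP.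
- exact: cover_rel_total.
- exact: cover_rel_inh.
- by move=> i x y a /(subsetP (two_PSp_sub n B)) Ga; rewrite cover_rel_inv.
exact: cover_rel_trans.
Qed.

Lemma orbitals_two_PSigmaSp : orbitals to (two_PSigmaSp B n) = relations R.
Proof.
apply: orbitalsP.
- exact: cover_rel_total.
- exact: cover_rel_inh.
- by move=> i x y a Ga; rewrite cover_rel_inv.
move=> i x y x' y' Rxy Rxy'; have [a Ga E] := cover_rel_trans Rxy Rxy'.
by exists a => //; apply: (subsetP (two_PSp_sub n B)).
Qed.

Lemma cover_rel0 : R ord0 = [set p | p.1 == p.2].
Proof.
apply/setP => -[[X c] [Y d]]; rewrite cover_relE inE /rdist /rsgn /csgn /= dist_eq0.
rewrite -pair_eqE /pair_eq /=; case: eqP => //= ->.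
by rewrite /Defs.sigma eqxx addbF; case: c d => [] [].
Qed.

Lemma cover_rel_inj : injective R.
Proof.
move=> i j Eij; have [x [y Rxy]] := cover_rel_inh i.
have Rxy' := Rxy; rewrite Eij in Rxy'.
by apply/eqP; rewrite (same_rel Rxy Rxy') !eqxx.
Qed.

Lemma cover_symmetric_scheme : symmetric_scheme R.
Proof.
split.
- split; first exact: cover_rel_inj.
  apply/and3P; split.
  + apply/eqP/setP => -[x y]; rewrite inE; apply/bigcupP.
    by have [i Ri] := cover_rel_total delta x y; exists (R i); rewrite ?imset_f.
  + apply/trivIsetP => A1 A2 /imsetP[i _ ->] /imsetP[j _ ->] ne.
    rewrite -setI_eq0; apply/eqP/setP => -[x y]; rewrite inE [RHS]inE.
    apply/negP => /andP[Ri Rj]; case/eqP: ne; congr (R _).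
    by apply/eqP; rewrite (same_rel Ri Rj) !eqxx.
  apply/imsetP => -[i _ E]; have [x [y]] := cover_rel_inh i.
  by rewrite -E inE.
- exact: cover_rel0.
- by move=> k x y; rewrite !cover_relE distC sgnC.
move=> i j k; have [x0 [y0 R0]] := cover_rel_inh k.
(* The count at one representative pair, carried to every other pair by a group element. *)
exists #|[set z | ((x0, z) \in R i) && ((z, y0) \in R j)]| => x y Rxy.
have [a Ga [<- <-]] := cover_rel_trans R0 Rxy.
have aG := subsetP (two_PSp_sub n B) _ Ga.
rewrite -[RHS](card_imset _ (act_inj to a)); apply: eq_card => z; rewrite [LHS]inE.
apply/andP/imsetP => [[Ri Rj] | [w]].
  have [w Ew] : exists w, z = to w a.
    by exists (to z a^-1%g); rewrite actKVin.
  exists w => //; rewrite Ew in Ri Rj.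
  by rewrite inE -(cover_rel_inv _ _ _ _ _ _ _ _ aG) // Ri -(cover_rel_inv _ _ _ _ _ _ _ _ aG).
rewrite inE => /andP[Ri Rj] ->.
by split; rewrite cover_rel_inv.
Qed.

Lemma cover_schurian : schurian R.
Proof.
pose G := (actperm to @* two_PSigmaSp B n)%G.
have Gto a x : a \in two_PSigmaSp B n -> actperm to a x = to x a by move=> Ga; rewrite actpermE.
have G_trans i x y x' y' : (x, y) \in R i -> (x', y') \in R i ->
    exists2 s, s \in G & s x = x' /\ s y = y'.
  move=> Rxy Rxy'; have [a Ga [<- <-]] := cover_rel_trans Rxy Rxy'.
  have aG := subsetP (two_PSp_sub n B) _ Ga.
  by exists (actperm to a); rewrite ?mem_morphim // !Gto.
exists G.
  have [X _] := dist_onto dimV B_alternating B_nondegenerate (leq0n n).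
  apply/imsetP; exists (X, false) => //; apply/esym/setP => y; rewrite inE.
  have R0 z : (z, z) \in R ord0 by rewrite cover_rel0 inE.
  have [s Gs [Es _]] := G_trans _ _ _ _ _ (R0 (X, false)) (R0 y).
  by apply/orbitP; exists s.
apply: orbitalsP.
- exact: cover_rel_total.
- exact: cover_rel_inh.
- move=> i x y s /morphimP[a Ga _ ->] Rxy.
  by rewrite /= /aperm !Gto // cover_rel_inv.
exact: G_trans.
Qed.

Lemma iso_line (v : V) : iso B <[v]>%VS.
Proof. by move=> x y /vlineP[k ->] /vlineP[l ->]; rewrite altZl altZr B_alternating !mulr0. Qed.

Lemma perp_line (v u : V) : (u \in perp B <[v]>%VS) = (B v u == 0).
Proof.
apply/perpP/eqP => [H | E w /vlineP[k ->]]; first exact/H/memv_line.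
by rewrite altZl E mulr0.
Qed.

(** Every line is fixed, so g is a scalar c. Evaluating the form on a pair with B = 1, which field
    automorphisms fix, gives c^2 = 1. *)
Lemma fix_lagr_sign g : g \in SigmaSp B -> (forall U, lagr_im g U = U) -> g \in <[neg]>%g.
Proof.
move=> Gg fixU; have gP := autFP Gg.
have gline (v : V) : (g v : V) \in <[v]>%VS.
  apply/negPn/negP => nv.
  (* Some u is orthogonal to v but not to g v, whereas a Lagrangian through v and u also contains g
     v. *)
  have /subvPn[u vu gvu] : ~~ (perp B <[v]> <= perp B <[g v : V]>)%VS.
    apply: contra nv => sub.
    rewrite -(perpK dimV B_alternating B_nondegenerate <[v]>%VS); apply/perpP => u vu.
    have := subvP sub _ vu; rewrite perp_line => /eqP E.
    by rewrite (altC B_alternating) E oppr0.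
  have iZ := iso_add_line B_alternating (@iso_line v) vu.
  have [L ZL] := iso_in_lagr dimV B_alternating B_nondegenerate iZ.
  have Lv : v \in val L by apply: (subvP ZL); rewrite (subvP (addvSl _ _)) ?memv_line.
  have Lu : u \in val L by apply: (subvP ZL); rewrite (subvP (addvSr _ _)) ?memv_line.
  case/negP: gvu; rewrite perp_line; apply/eqP; apply: (lagr_iso (X := L)) => //.
  by rewrite -[L]fixU val_lagr_im // (mem_im_space gP).
(* The sum u + v is also an eigenvector, which forces equal eigenvalues. *)
have gscal (u v : V) c : u != 0 -> v \notin <[u]>%VS -> g u = c *: u -> g v = c *: v.
  move=> u0 nv gu; have /vlineP[d gv] := gline v; have /vlineP[m guv] := gline (u + v).
  have E : (d - m) *: v = (m - c) *: u.
    move: guv; rewrite (semiD gP) gu gv scalerDr => E.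
    apply/eqP; rewrite !scalerBl subr_eq addrAC -E eq_sym subr_eq.
    by rewrite addrC.
  have [dm | dm] := eqVneq (d - m) 0.
    move: E; rewrite dm scale0r => /esym/eqP; rewrite scaler_eq0 (negbTE u0) orbF.
    by rewrite subr_eq0 => /eqP mc; rewrite gv -mc; congr (_ *: _); apply/eqP; rewrite -subr_eq0 dm.
  case/negP: nv; rewrite -[v](scalerK dm) E.
  by rewrite !memvZ ?memv_line.
have [e [f ef]] := exists_frame dimV B_alternating B_nondegenerate.
pose i0 : 'I_n := Ordinal n_gt0; have [_ _ Eef] := ef.
have Bef : B (e i0) (f i0) = 1 by rewrite Eef eqxx.
have e0 : e i0 != 0 by apply: contra_eq_neq Bef => ->; rewrite alt0l eq_sym oner_neq0.
have f0 : f i0 != 0 by apply: contra_eq_neq Bef => ->; rewrite alt0r eq_sym oner_neq0.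
have nfe : f i0 \notin <[e i0]>%VS.
  apply: contra_eqN Bef => /vlineP[k ->].
  by rewrite altZr B_alternating mulr0 eq_sym oner_neq0.
have /vlineP[c ge] := gline (e i0).
have gf := gscal _ _ _ e0 nfe ge.
have gE v : g v = c *: v.
  have [vf | nv] := boolP (v \in <[f i0]>%VS); last exact: gscal f0 nv gf.
  have [-> | v0] := eqVneq v 0; first by rewrite (semi0 gP) scaler0.
  apply: gscal e0 _ ge; apply/negP => /vlineP[k Ek]; case/negP: nfe.
  have /vlineP[l El] := vf; have l0 : l != 0 by apply: contraNneq v0 => l0; rewrite El l0 scale0r.
  by rewrite -[f i0](scalerK l0) -El Ek !memvZ ?memv_line.
have : c ^+ 2 = 1.
  have := semi_form gP (e i0) (f i0); rewrite !gE altZl altZr Bef.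
  by rewrite field_aut_1 ?mulr1 // (semi_field_aut gP).
move/eqP; rewrite sqrf_eq1 => /orP[] /eqP c1.
  by rewrite (_ : g = 1%g) ?group1 //; apply/permP => v; rewrite perm1 gE c1 scale1r.
rewrite (_ : g = neg) ?cycle_id //; apply/permP => v.
by rewrite permE gE c1 scaleN1r.
Qed.

Lemma cover_isom_inj : ('injm (actperm to))%g.
Proof.
apply/subsetP => a /morphpreP[Ga /set1P Ka]; apply/set1P.
have fixa x : to x a = x by rewrite -[in RHS](perm1 x) -Ka actpermE.
case: a Ga Ka fixa => s c Ga _ fixa; move: (Ga); rewrite in_setX /=.
case/andP=> /zetaP[b sE] /morphimP[g _ Gg Ec]; subst c.
have fixg x : cover_act delta (x.1, b (+) x.2) g = x.
  by rewrite -sE -full_act_coset //; apply: fixa.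
have gneg : g \in <[neg]>%g.
  apply: fix_lagr_sign => // U; have := fixg (U, false).
  by rewrite /cover_act Gg => -[].
have cg : coset <[neg]>%g g = 1%g by apply: coset_id.
have gact x : cover_act delta x g = x.
  have : x \in 'Fix_(cover_action delta)(SigmaSp B :&: <[neg]>)%g by apply: negV_fix.
  by move/afixP/(_ g); apply; rewrite inE Gg.
have s1 : s = 1%g; last by rewrite s1; congr (_, _); apply: cg.
apply/permP => x; rewrite perm1 sE.
by have := fixg x; rewrite gact.
Qed.

End Scheme.

(** * Lagrangians opposite to a given one *)

Lemma dot_mulmx (F : finFieldType) n (u v : 'rV[F]_n) : dot u v = (u *m v^T) 0 0.
Proof. by rewrite mxE; apply: eq_bigr => i _; rewrite mxE. Qed.

Lemma sym_rank1 (F : finFieldType) n (M : 'M[F]_n) : symmx M -> \rank M = 1%N ->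
  exists b w, [/\ b != 0, w != 0 & M = b *: sq w].
Proof.
move=> symM rk; have [|u [v E]] := @rank1_factor F n M; first by rewrite rk.
have M0 : M != 0 by rewrite -mxrank_eq0 rk.
have v0 : v != 0.
  by apply: contraNneq M0 => v0; apply/eqP/matrixP => i j; rewrite E v0 !mxE mulr0.
have [i vi] := rV0Pn _ v0; exists (u 0 i / v 0 i), v.
have ME : M = (u 0 i / v 0 i) *: sq v.
  apply/matrixP => k l; rewrite !mxE E; have := symE i k symM; rewrite !E => Ek.
  by rewrite mulrA; congr (_ * _); rewrite mulrAC Ek mulfK.
split=> //; apply: contraNneq M0 => b0; apply/eqP; rewrite ME b0 scale0r //.
Qed.

(** Allows bases of two Lagrangians whose matrices differ by k v^T v to be chosen equal except for
    one vector. *)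
Lemma unitmx_to_delta (F : finFieldType) n (n_gt0 : (0 < n)%N) (v : 'rV[F]_n) : v != 0 ->
  exists2 Q : 'M[F]_n, Q \in unitmx &
    forall i, dot (row i Q) v = (i == Ordinal n_gt0)%:R.
Proof.
move=> v0; have rk : \rank v = 1%N by apply/eqP; rewrite eqn_leq rank_leq_row lt0n mxrank_eq0.
pose E := row_ebase v; pose c := col_ebase v 0 0.
have Eu : E \in unitmx := row_ebase_unit v.
have vE : v = c *: (delta_mx 0 (Ordinal n_gt0) *m E).
  rewrite -[LHS]mulmx_ebase rk -/E scalemxAl; congr (_ *m _); apply/rowP => j.
  rewrite mxE big_ord1 !mxE /= andbT eq_sym -[j == _]val_eqE /=; congr (_ * _).
have c0 : c != 0 by apply: contraNneq v0 => c0; rewrite vE c0 scale0r.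
exists (c^-1 *: (invmx E)^T) => [|i].
  by rewrite unitmxZ ?unitmx_tr ?unitmx_inv // unitfE invr_eq0.
have QvE : (c^-1 *: (invmx E)^T) *m v^T = (delta_mx 0 (Ordinal n_gt0))^T.
  rewrite [in LHS]vE linearZ /= -scalemxAl -scalemxAr scalerA mulVf // scale1r.
  by rewrite trmx_mul mulmxA -trmx_mul mulmxV // trmx1 mul1mx.
by rewrite dot_mulmx -row_mul QvE trmx_delta !mxE eqxx andbT.
Qed.

Section Rigidity.
Variables (F : finFieldType) (n : nat) (V : vectType F) (B : {biscalar V}).
Hypothesis n_gt0 : (0 < n)%N.
Hypothesis q_mod4 : #|F| = 1 %[mod 4].
Hypothesis dimV : \dim {:V} = (2 * n)%N.
Hypothesis B_alternating : forall x : V, B x x = 0.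
Hypothesis B_nondegenerate : forall x : V, (forall y : V, B x y = 0) -> x = 0.
Variable delta : forall X : lagr B n, detfun n (val X).
Implicit Types (X Y U : lagr B n) (x y z : Defs.cover B n) (S T : 'M[F]_n).
Implicit Types (a b w : 'rV[F]_n) (v : V).
Local Notation fV := (finvect_type V).
Local Notation sigma := (sigma delta).
Local Notation R := (cover_rel delta).
Local Notation to := (full_action delta).

Section Affine.
Variables (e f : 'I_n -> V).
Hypothesis ef : frame B e f.
Variable Y0 : lagr B n.
Hypothesis Y0E : val Y0 = <<codom f>>%VS.

Let dec v := frame_decomp dimV ef v.
Local Notation ce := (fcoord_e B f).
Local Notation cf := (fcoord_f B e).

Lemma mem_Y0 v : (v \in val Y0) = (ce v == 0).
Proof.
rewrite Y0E; apply/idP/eqP => [/span_codom[b ->] | E].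
  by apply/rowP => i; rewrite !mxE -[f i]comb_delta (frame_ff ef).
rewrite (dec v) E comb0 add0r; apply: comb_in => i; apply: memv_span; exact: codom_f.
Qed.

(** For symmetric S, a basis of the graph of S, which consists of the vectors
    [comb e a + comb f (a *m S)]. These graphs are the Lagrangians opposite to [Y0]. *)
Definition zfam S (i : 'I_n) : V := e i + comb f (row i S).
(* Zl and zhat are locked to keep conversion from evaluating insubd and sigma. *)
Definition Zl : 'M[F]_n -> lagr B n :=
  locked (fun S => insubd Y0 <<codom (zfam S)>>%VS).

Lemma comb_zfam S a : comb (zfam S) a = comb e a + comb f (a *m S).
Proof.
rewrite -(comb_mulmx f S a) -big_split /=; apply: eq_bigr => i _.
by rewrite -scalerDr.
Qed.

Lemma zfam_frame S : symmx S -> frame B (zfam S) f.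
Proof.
move=> symS; have [_ ff E] := ef; split=> // i j.
  rewrite /zfam -[e i]comb_delta -[e j]comb_delta (frame_form B_alternating _ _ _ _ ef).
  have dd k l : dot (delta_mx 0 k) (row l S) = S l k.
    rewrite /dot (bigD1 k) //= !mxE !eqxx mul1r big1 ?addr0 // => m ne.
    by rewrite !mxE (negbTE ne) mul0r.
  by rewrite !dd (symE i j symS) subrr.
by rewrite altDl E -[f j]comb_delta (frame_ff ef) addr0.
Qed.

Lemma val_Zl S : symmx S -> val (Zl S) = <<codom (zfam S)>>%VS.
Proof.
move=> /zfam_frame zf; have [zz _ _] := zf.
have [Z ZE] := frame_lagr (frame_indep_e zf) zz.
by rewrite /Zl -lock val_insubd -ZE (valP Z).
Qed.

Lemma mem_Zl S v : symmx S -> (v \in val (Zl S)) = (cf v == ce v *m S).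
Proof.
move=> symS; rewrite val_Zl //; apply/idP/eqP => [/span_codom[a ->] | E].
  by rewrite comb_zfam (fcoord_eK ef) (fcoord_fK ef).
rewrite (dec v) E -comb_zfam; apply: comb_in => i; apply: memv_span; exact: codom_f.
Qed.

Lemma Zl_disj S : symmx S -> disj (val (Zl S)) (val Y0).
Proof.
move=> symS v; rewrite mem_Zl // mem_Y0 => /eqP Ev /eqP E.
by rewrite (dec v) Ev E mul0mx !comb0 addr0.
Qed.

Lemma dist_disj X Y : disj (val X) (val Y) -> dist X Y = n.
Proof. by move=> /disj_cap E; rewrite /dist E dimv0 subn0. Qed.

Lemma disj_dist X Y : dist X Y = n -> disj (val X) (val Y).
Proof. by move=> d; apply: cap_disj; rewrite dim_cap_dist d subnn. Qed.

Lemma Zl_opposite S : symmx S -> dist (Zl S) Y0 = n.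
Proof. by move=> symS; apply/dist_disj/Zl_disj. Qed.

(** The basis of U dual to f has identity e-coordinates; its f-coordinates form S, symmetric because
    U is isotropic. *)
Lemma opposite_Zl U : dist U Y0 = n -> exists2 S, symmx S & U = Zl S.
Proof.
move=> /disj_dist d.
have fY i : f i \in val Y0 by rewrite Y0E; apply: memv_span; apply: codom_f.
have [e' ef' eU] := dual_frame dimV B_alternating B_nondegenerate d (frame_indep_f ef) fY.
have [ee' _ E'] := ef'; pose S := \matrix_(i, j) B (e j) (e' i).
have cfS i : cf (e' i) = row i S by apply/rowP => j; rewrite !mxE.
have ceE i : ce (e' i) = delta_mx 0 i.
  by apply/rowP => j; rewrite !mxE E' eq_sym.
have symS : symmx S.
  apply/matrixP => i j; rewrite mxE; have := ee' i j.
  rewrite (dec (e' i)) (dec (e' j)) (frame_form B_alternating _ _ _ _ ef) !ceE !cfS.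
  have dd k l : dot (delta_mx 0 k) (row l S) = S l k.
    rewrite /dot (bigD1 k) //= !mxE !eqxx mul1r big1 ?addr0 // => m ne.
    by rewrite !mxE (negbTE ne) mul0r.
  by rewrite !dd => /eqP; rewrite subr_eq0 => /eqP.
exists S => //; apply/val_inj/eqP; rewrite eqEdim !lagr_dim leqnn andbT.
have [_ _ sp] := basis_codomP (basis_codom (frame_indep_e ef') eU (lagr_dim U)).
apply/subvP => v /sp[a ->]; apply: comb_in => i.
by rewrite mem_Zl // cfS ceE -rowE.
Qed.

(** The graphs of S and T meet over the kernel of S - T. *)
Lemma dist_Zl S T : symmx S -> symmx T -> dist (Zl S) (Zl T) = \rank (S - T)%R.
Proof.
move=> symS symT; have zf := zfam_frame symS; have iz := frame_indep_e zf.
pose K := row_base (kermx (S - T)%R).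
pose g i := comb (zfam S) (row i K).
have gE c : comb g c = comb (zfam S) (c *m K) by apply: comb_mulmx.
have ig : indep g.
  move=> c; rewrite gE => /iz cK; apply: (row_free_inj (row_base_free (kermx (S - T)%R))).
  by rewrite cK mul0mx.
have E : (val (Zl S) :&: val (Zl T))%VS = <<codom g>>%VS.
  apply/eqP; rewrite eqEsubv; apply/andP; split; apply/subvP => v.
    rewrite memv_cap !mem_Zl // => /andP[/eqP ES /eqP ET].
    have : (ce v <= kermx (S - T)%R)%MS.
      by apply/sub_kermxP; rewrite mulmxBr -ES -ET subrr.
    rewrite -(eq_row_base (kermx _)) => /submxP[c Ec].
    rewrite (dec v) ES -comb_zfam Ec -gE; apply: comb_in => i.
    by apply: memv_span; apply: codom_f.
  move=> /span_codom[c ->]; rewrite gE comb_zfam memv_cap !mem_Zl //.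
  rewrite (fcoord_eK ef) (fcoord_fK ef) eqxx /=.
  have : (c *m K <= kermx (S - T)%R)%MS.
    by rewrite -(eq_row_base (kermx _)) submxMl.
  by move/sub_kermxP; rewrite mulmxBr => /eqP; rewrite subr_eq0.
rewrite /dist E (span_frame_dim ig) mxrank_ker subKn //.
exact: rank_leq_row.
Qed.

(** Of the two points above [Zl S], the one with sign +1 relative to [yhat]. *)
Definition zhat : 'M[F]_n -> Defs.cover B n :=
  locked (fun S => (Zl S, sigma (Zl S) Y0)).
Definition yhat : Defs.cover B n := (Y0, false).

Lemma zhatE S : zhat S = (Zl S, sigma (Zl S) Y0).
Proof. by rewrite /zhat -lock. Qed.

Lemma zhat1 S : (zhat S).1 = Zl S.
Proof. by rewrite zhatE. Qed.

Lemma csgn_zhat_yhat S : csgn delta (zhat S) yhat = false.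
Proof. by rewrite /csgn zhatE /= addbF addbb. Qed.

Lemma opposite_zhat x : dist x.1 Y0 = n -> csgn delta x yhat = false ->
  exists2 S, symmx S & x = zhat S.
Proof.
case: x => U d /= /opposite_Zl[S symS ->]; rewrite /csgn /= addbF => E.
by exists S => //; rewrite zhatE; congr (_, _); move: E; case: d; case: (sigma _ _).
Qed.

Lemma zhat_inj S T : symmx S -> symmx T -> zhat S = zhat T -> S = T.
Proof.
rewrite !zhatE => symS symT [E _]; apply/eqP; rewrite -subr_eq0 -mxrank_eq0 -dist_Zl //.
by rewrite E dist_eq0.
Qed.

(** After the change of basis Q the bases of the two graphs differ only in their first vectors and
    the Gram determinant is -k. The two factors det Q form a square, and the signs relative to [Y0]
    cancel the determinant functions. *)
Lemma csgn_zhat S T k (v : 'rV[F]_n) : symmx S -> symmx T -> k != 0 -> v != 0 ->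
  S - T = k *: sq v -> csgn delta (zhat S) (zhat T) = chi k.
Proof.
move=> symS symT k0 v0 E; have [Q Qu Qv] := unitmx_to_delta n_gt0 v0.
set i0 := Ordinal n_gt0 in Qv.
have rk1 : \rank (S - T)%R = 1%N.
  apply/eqP; rewrite eqn_leq E rank_sq lt0n mxrank_eq0.
  have [i vi] := rV0Pn _ v0; apply: contraNneq vi => /matrixP/(_ i i).
  by rewrite !mxE => /eqP; rewrite !mulf_eq0 (negbTE k0) /= orbb.
have d1 : dist (Zl S) (Zl T) = 1%N by rewrite dist_Zl.
have [zfS zfT] := (zfam_frame symS, zfam_frame symT).
pose zS : {ffun 'I_n -> V} := [ffun i => zfam S i].
pose zT : {ffun 'I_n -> V} := [ffun i => zfam T i].
pose x : {ffun 'I_n -> V} := [ffun i => comb (zfam S) (row i Q)].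
pose y : {ffun 'I_n -> V} := [ffun i => comb (zfam T) (row i Q)].
pose fy : {ffun 'I_n -> V} := [ffun i => f i].
have zSE : zS =1 zfam S by move=> i; rewrite ffunE.
have zTE : zT =1 zfam T by move=> i; rewrite ffunE.
have inS i : zfam S i \in val (Zl S) by rewrite val_Zl //; apply: memv_span; apply: codom_f.
have inT i : zfam T i \in val (Zl T) by rewrite val_Zl //; apply: memv_span; apply: codom_f.
have inY i : f i \in val Y0 by rewrite Y0E; apply: memv_span; apply: codom_f.
have sY (S' : 'M[F]_n) (z' : {ffun 'I_n -> V}) : symmx S' -> z' =1 zfam S' ->
    (forall i, zfam S' i \in val (Zl S')) ->
    sigma (Zl S') Y0 = chi (delta (Zl S') z') (+) chi (delta Y0 fy).
  move=> symS' zE' inS'; have fyE : fy =1 mixed (dist (Zl S') Y0) (zfam S') f.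
    by move=> i; rewrite ffunE /mixed Zl_opposite // ltn_ord.
  apply: (frame_sigma B_alternating delta (zfam_frame symS') inS' _ zE' fyE) => i.
  by rewrite -(fyE i) ffunE.
have indep_fam (z' : 'I_n -> V) : indep z' -> indep (fun i => comb z' (row i Q)).
  move=> iz a; rewrite comb_mulmx => /iz aQ.
  by rewrite -[a](mulmxK Qu) aQ mul0mx.
have ix : indep x.
  move=> a; rewrite (eq_comb (e' := fun i => comb (zfam S) (row i Q))) => [|i]; last by rewrite ffunE.
  exact/indep_fam/(frame_indep_e zfS).
have iy : indep y.
  move=> a; rewrite (eq_comb (e' := fun i => comb (zfam T) (row i Q))) => [|i]; last by rewrite ffunE.
  exact/indep_fam/(frame_indep_e zfT).
have xS i : x i \in val (Zl S) by rewrite ffunE; apply: comb_in.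
have yT i : y i \in val (Zl T) by rewrite ffunE; apply: comb_in.
have xyE i : x i = y i + (k * (i == i0)%:R) *: comb f v.
  rewrite !ffunE !comb_zfam -addrA; congr (_ + _).
  have -> : S = T + k *: sq v by rewrite -E addrC subrK.
  rewrite mulmxDr combD; congr (_ + _).
  by rewrite sq_mulmx -scalemxAr combZ mulmxA [row i Q *m _]mx11_scalar -dot_mulmx Qv
    mul_scalar_mx combZ scalerA.
have i0E (i : 'I_n) : (1 <= i)%N -> (i == i0) = false.
  by move=> lt; apply/negbTE; rewrite -val_eqE /= -lt0n.
have xy (i : 'I_n) : (1 <= i)%N -> x i = y i.
  by move=> lt; rewrite xyE i0E // mulr0 scale0r addr0.
have ad : adapted_bases (Zl S) (Zl T) x y.
  apply/and4P; split.
  - exact: basis_codom (lagr_dim _).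
  - exact: basis_codom (lagr_dim _).
  - by apply/forallP => i; apply/implyP; rewrite d1 => /xy->.
  rewrite d1; apply: basis_image => // [i|]; last first.
    by rewrite dim_cap_dist d1 card_ord_ge.
  by rewrite inE memv_cap => lt; rewrite xS xy // yT.
have gd : gram_det (Zl S) (Zl T) x y = - k.
  rewrite /gram_det /=; set w0 := widen_ord _.
  have lt0 : (0 < dist (Zl S) (Zl T))%N by rewrite d1.
  rewrite (det_dim1 _ (Ordinal lt0)) // mxE.
  have -> : w0 (Ordinal lt0) = i0 by apply: val_inj.
  have -> : y i0 = x i0 + (- k) *: comb f v.
    by rewrite xyE eqxx mulr1 scaleNr addrK.
  rewrite altDr B_alternating add0r altZr ffunE comb_zfam altDl (frame_ef ef) (frame_ff ef).
  by rewrite addr0 Qv eqxx mulr1.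
have rowE' (z' : 'I_n -> V) (u zz : {ffun 'I_n -> V}) : (forall i, u i = comb z' (row i Q)) ->
   zz =1 z' -> forall i, u i = comb zz (row i Q).
  by move=> uE zE i; rewrite uE; apply/esym/eq_comb.
have izS : indep zS by move=> a; rewrite (eq_comb _ zSE); apply: frame_indep_e zfS _.
have izT : indep zT by move=> a; rewrite (eq_comb _ zTE); apply: frame_indep_e zfT _.
have zSin i : zS i \in val (Zl S) by rewrite zSE.
have zTin i : zT i \in val (Zl T) by rewrite zTE.
have xE i : x i = comb zS (row i Q) by rewrite ffunE; apply/esym/eq_comb.
have yE i : y i = comb zT (row i Q) by rewrite ffunE; apply/esym/eq_comb.
rewrite /csgn !zhatE /= (sY S zS) // (sY T zT) // (sigmaE delta ad) gd.
rewrite (detfun_comb (delta (Zl S)) (lagr_dim _) izS zSin xE).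
rewrite (detfun_comb (delta (Zl T)) (lagr_dim _) izT zTin yE).
have dS := delta_neq0 delta izS zSin; have dT := delta_neq0 delta izT zTin.
set a1 := delta (Zl S) zS in dS *; set a2 := delta (Zl T) zT in dT *.
have Q0 : \det Q != 0 by rewrite -unitfE -unitmxE.
have -> : \det Q * a1 * (\det Q * a2) * - k = (a1 * a2 * k * (-1) ^+ 1) * \det Q ^+ 2 by ring.
rewrite chi_sqrM // chi_sign // !chiM ?mulf_neq0 //.
by do 4!case: (chi _).
Qed.

End Affine.
End Rigidity.

(** * The full automorphism group *)

Section FullAutomorphismGroup.
Variables (F : finFieldType) (n : nat) (V : vectType F) (B : {biscalar V}).
Hypothesis n_gt0 : (0 < n)%N.
Hypothesis q_mod4 : #|F| = 1 %[mod 4].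
Hypothesis dimV : \dim {:V} = (2 * n)%N.
Hypothesis B_alternating : forall x : V, B x x = 0.
Hypothesis B_nondegenerate : forall x : V, (forall y : V, B x y = 0) -> x = 0.
Variable delta : forall X : lagr B n, detfun n (val X).
Implicit Types (X Y U : lagr B n) (x y z : Defs.cover B n) (S T : 'M[F]_n).
Implicit Types (s : {perm (Defs.cover B n)}) (r : Defs.cover B n -> Defs.cover B n).
Local Notation fV := (finvect_type V).
Local Notation sigma := (sigma delta).
Local Notation R := (cover_rel delta).
Local Notation to := (full_action delta).

Definition preserving r := forall x y,
  dist (r x).1 (r y).1 = dist x.1 y.1 /\ csgn delta (r x) (r y) = csgn delta x y.

Lemma scheme_autP s : (s \in scheme_aut R) <-> preserving s.
Proof.
rewrite inE; split=> [/forallP H x y | H].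
  have [i Ri] := cover_rel_total delta x y.
  have /forallP/(_ x)/forallP/(_ y)/eqP := H i; rewrite Ri => Ri'.
  by move: Ri Ri'; rewrite !cover_relE => /andP[/eqP-> /eqP->] /andP[/eqP-> /eqP->].
apply/forallP => i; apply/forallP => x; apply/forallP => y.
by rewrite !cover_relE; have [-> ->] := H x y.
Qed.

Lemma act_preserving a : a \in two_PSigmaSp B n -> preserving (to^~ a).
Proof. by move=> Ga x y; apply: full_act_dist_sgn. Qed.

Lemma preserving_actV r a : a \in two_PSigmaSp B n -> preserving r ->
  preserving (fun x => to (r x) a^-1%g).
Proof.
move=> Ga rP x y; have [<- <-] := rP x y.
by apply: act_preserving; rewrite groupV.
Qed.

Section Affine.
Variables (e f : 'I_n -> V).
Hypothesis ef : frame B e f.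
Variable Y0 : lagr B n.
Hypothesis Y0E : val Y0 = <<codom f>>%VS.
Local Notation Zl := (Zl e f Y0).
Local Notation zhat := (zhat delta e f Y0).
Local Notation yhat := (yhat Y0).

Let opp S (symS : symmx S) := Zl_opposite dimV B_alternating ef Y0E symS.
Let opp_inv U (d : dist U Y0 = n) := opposite_Zl dimV B_alternating B_nondegenerate ef Y0E d.

(* A Lagrangian is determined by its distances to the ones opposite to Y0.     *)
Lemma preserving_fix r : preserving r -> r yhat = yhat ->
  (forall S, symmx S -> r (zhat S) = zhat S) -> r =1 id.
Proof.
move=> rP ry rz x; have EU : (r x).1 = x.1.
  apply/eqP/negPn/negP => ne; set U' := (r x).1 in ne *.
  have dY : dist U' Y0 = dist x.1 Y0 by have [] := rP x yhat; rewrite ry.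
  have dZ S : symmx S -> dist U' (Zl S) = dist x.1 (Zl S).
    by move=> symS; have [dd _] := rP x (zhat S); rewrite rz // zhat1 in dd.
  have [E0 | ne0] := eqVneq U' Y0.
    case/negP: ne; move/eqP: dY; rewrite E0 (_ : dist Y0 Y0 = 0%N); last first.
      by apply/eqP; rewrite dist_eq0.
    by rewrite eq_sym dist_eq0 eq_sym.
  have nsub U W : U != W -> ~~ (val U <= val W)%VS.
    by apply: contra => sub; apply/eqP/val_inj/eqP; rewrite eqEdim sub !lagr_dim leqnn.
  (* A Lagrangian through u opposite to both x.1 and [Y0] is not opposite to U', against the
     equality of distances. *)
  have [u [U'u nu nY]] := avoid_two (nsub _ _ ne) (nsub _ _ ne0).
  have dl X : u \notin val X -> disj <[u]>%VS (val X).
    move=> nX v /vlineP[k ->] Xku; have [-> | k0] := eqVneq k 0; first by rewrite scale0r.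
    by case/negP: nX; rewrite -[u](scalerK k0) memvZ.
  have [Z [Zu ZU ZY]] := iso_in_opposite dimV B_alternating B_nondegenerate
    (@iso_line _ _ _ B_alternating u) (dl _ nu) (dl _ nY).
  have [S symS EZ] := opp_inv (dist_disj ZY).
  have := dZ S symS; rewrite -EZ [RHS]distC (dist_disj ZU) => /(disj_dist)/(_ u U'u).
  have Zu' : u \in val Z by apply: (subvP Zu); apply: memv_line.
  by move=> /(_ Zu') u0; case/negP: nu; rewrite u0 mem0v.
have [_] := rP x (zhat 0); rewrite rz; last exact: sym0.
rewrite /csgn EU => /addIb/addIb E.
by rewrite [LHS]surjective_pairing [RHS]surjective_pairing EU E.
Qed.

(** In coordinates (a, a S) goes to (b, b P t(S) P^T) with b = t(a) P^-1. *)
Lemma semi_lagr_im g S T (t : {perm F}) (P : 'M[F]_n) : g \in SigmaSp B -> P \in unitmx ->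
    (forall a b, g (comb e a + comb f b) =
      comb e (map_mx t a *m invmx P) + comb f (map_mx t b *m P^T)) ->
    field_aut t -> symmx S -> symmx T -> T = P *m map_mx t S *m P^T ->
  lagr_im g (Zl S) = Zl T.
Proof.
move=> Gg Pu gE tP symS symT TE; apply/val_inj/eqP.
rewrite eqEdim !lagr_dim leqnn andbT; apply/subvP => v.
rewrite val_lagr_im // => /(mem_im_spaceP (autFP Gg))[w].
rewrite (mem_Zl dimV B_alternating ef) // => /eqP Ew ->.
rewrite (mem_Zl dimV B_alternating ef) //.
rewrite {1 2}(frame_decomp dimV ef w) Ew gE (fcoord_eK ef) (fcoord_fK ef).
apply/eqP; rewrite TE !mulmxA mulmxKV //; congr (_ *m _).
apply/rowP => j; rewrite !mxE (big_morph t (field_autD tP) (field_aut0 tP)).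
by apply: eq_bigr => i _; rewrite !mxE field_autM.
Qed.

(** The map phi induced on symmetric matrices is realized by a semi-isometry; after correction of
    one sign it agrees with r at [yhat] and at all [zhat S], and [preserving_fix] applies. *)
Lemma preserving_affine r : preserving r -> r yhat = yhat -> r (zhat 0) = zhat 0 ->
  exists2 a, a \in two_PSigmaSp B n & r =1 to^~ a.
Proof.
move=> rP ry r0.
(* The value 0 at nonsymmetric S is a default that makes phi total. *)
have phi_ex S : exists T, symmx S -> symmx T /\ r (zhat S) = zhat T.
  have [symS | nsym] := eqVneq S^T S; last by exists 0 => symS; case/eqP: nsym.
  have [dr sr] := rP (zhat S) yhat; rewrite ry in dr sr.
  rewrite csgn_zhat_yhat in sr; have dr' : dist (r (zhat S)).1 Y0 = n by rewrite dr zhat1 opp.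
  have [T symT ET] := opposite_zhat dimV B_alternating B_nondegenerate ef Y0E dr' sr.
  by exists T.
have [phi phiP] := fin_all_exists phi_ex.
have phi_sym S (symS : symmx S) := proj1 (phiP S symS).
have phi_z S (symS : symmx S) := proj2 (phiP S symS).
have phi0 : phi 0 = 0.
  have s0 := sym0 F n; apply: (zhat_inj dimV B_alternating ef (delta := delta) (Y0 := Y0)).
  - exact: phi_sym.
  - exact: s0.
  by rewrite -phi_z.
have distE S T (symS : symmx S) (symT : symmx T) :=
  dist_Zl dimV B_alternating ef Y0 symS symT.
have phi_rank S T : symmx S -> symmx T -> \rank (phi S - phi T)%R = \rank (S - T)%R.
  move=> symS symT; have [dd _] := rP (zhat S) (zhat T).
  rewrite (phi_z _ symS) (phi_z _ symT) !zhat1 in dd.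
  by rewrite -(distE _ _ (phi_sym _ symS) (phi_sym _ symT)) -(distE _ _ symS symT).
have symB S T : symmx S -> symmx T -> symmx (S - T).
  by move=> symS symT; rewrite -scaleN1r; apply/symD/symZ.
have phi_line S T k (v : 'rV[F]_n) : symmx S -> symmx T -> k != 0 -> v != 0 ->
    S - T = k *: sq v ->
    exists b w, [/\ b != 0, w != 0, chi b = chi k & phi S - phi T = b *: sq w].
  move=> symS symT k0 v0 E.
  have rk1 : \rank (phi S - phi T)%R = 1%N.
    apply/eqP; rewrite phi_rank // eqn_leq E rank_sq lt0n mxrank_eq0.
    have [i vi] := rV0Pn _ v0; apply: contraNneq vi => /matrixP/(_ i i).
    by rewrite !mxE => /eqP; rewrite !mulf_eq0 (negbTE k0) /= orbb.
  have [b [w [b0 w0 Ebw]]] := sym_rank1 (symB _ _ (phi_sym _ symS) (phi_sym _ symT)) rk1.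
  exists b, w; split=> //.
  rewrite -(csgn_zhat n_gt0 q_mod4 dimV B_alternating delta ef Y0E
    (phi_sym _ symS) (phi_sym _ symT) b0 w0 Ebw).
  rewrite -(csgn_zhat n_gt0 q_mod4 dimV B_alternating delta ef Y0E
    symS symT k0 v0 E).
  have [_ <-] := rP (zhat S) (zhat T).
  by rewrite (phi_z _ symS) (phi_z _ symT).
have [s0 [s00 s01 s0N1]] := third_unit q_mod4.
have [P [t [Pu tP phiE]]] := symmetric_forms_automorphism (two_neq0_mod4 q_mod4)
  s00 s01 s0N1 n_gt0 phi0 phi_sym phi_rank phi_line.
(* The frame that turns P t(S) P^T into the graph action: P^T acts on the f part, and its dual P^-1
   on the e part. *)
have ef' : frame B (fun i => comb e (row i (invmx P))) (fun i => comb f (row i P^T)).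
  split=> i j; rewrite ?(frame_ee ef) ?(frame_ff ef) // (frame_ef ef).
  transitivity ((invmx P *m P) i j); last by rewrite mulVmx // mxE.
  by rewrite mxE; apply: eq_bigr => k _; rewrite !mxE.
have [g gP gE'] := frame_semi_isometry dimV B_alternating B_nondegenerate ef ef' tP.
have Gg : g \in SigmaSp B by rewrite inE; apply/existsP; exists t.
have gE a b : g (comb e a + comb f b) =
      comb e (map_mx t a *m invmx P) + comb f (map_mx t b *m P^T).
  by rewrite gE' !comb_mulmx.
have gZ S : symmx S -> lagr_im g (Zl S) = Zl (phi S).
  by move=> symS; apply: (semi_lagr_im Gg Pu gE tP symS (phi_sym _ symS) (phiE _ symS)).
have gY : lagr_im g Y0 = Y0.
  apply/val_inj/eqP; rewrite eqEdim !lagr_dim leqnn andbT; apply/subvP => v.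
  rewrite val_lagr_im // => /(mem_im_spaceP (autFP Gg))[w].
  rewrite !(mem_Y0 dimV ef Y0E) => /eqP Ew ->.
  rewrite (frame_decomp dimV ef w) Ew gE (fcoord_eK ef).
  rewrite (_ : map_mx t 0 = 0) ?mul0mx //.
  by apply/rowP => i; rewrite !mxE field_aut0.
(* The power of [zeta] is chosen so that a fixes [yhat]. *)
have [a [Ga _ aE]] := full_act_ex q_mod4 dimV B_alternating B_nondegenerate delta
  (chi (lambda delta g Y0)) Gg.
exists a => //; have hE x : to x a = cover_act delta (x.1, chi (lambda delta g Y0) (+) x.2) g.
  exact: aE.
have hP := act_preserving Ga.
have hy : to yhat a = yhat by rewrite hE /cover_act Gg /= gY addbF addbb.
have hz S : symmx S -> to (zhat S) a = zhat (phi S).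
  move=> symS; have [_ sh] := hP (zhat S) yhat; rewrite hy csgn_zhat_yhat in sh.
  have h1 : (to (zhat S) a).1 = Zl (phi S) by rewrite hE /cover_act Gg /= zhat1 gZ.
  have := csgn_zhat_yhat delta e f Y0 (phi S); rewrite -sh /csgn h1 zhat1 => /addIb/addIb E.
  by rewrite [RHS]surjective_pairing zhat1 -h1 E -surjective_pairing.
have rh : (fun x => to (r x) a^-1%g) =1 id.
  apply: preserving_fix => [||S symS].
  - exact: preserving_actV.
  - by rewrite ry -[in LHS]hy actKin.
  by rewrite phi_z // -hz // actKin.
by move=> x; have := congr1 (to^~ a) (rh x); rewrite /= actKVin.
Qed.

End Affine.

Lemma scheme_aut_actperm : (actperm to @* two_PSigmaSp B n)%g = scheme_aut R.
Proof.
apply/setP => s; apply/idP/idP => [/morphimP[a Ga _ ->] | /scheme_autP sP].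
  by apply/scheme_autP => x y; rewrite !actpermE; apply: act_preserving.
have [e [f ef]] := exists_frame dimV B_alternating B_nondegenerate.
have [_ ff _] := ef; have [Y0 Y0E] := frame_lagr (frame_indep_f ef) ff.
(* Transitivity gives [a0] with the effect of s on this pair; s followed by the inverse of [a0]
   fixes both points. *)
pose z0 := zhat delta e f Y0 0; pose y0 := yhat Y0.
have [dz sz] := sP z0 y0.
have [a0 Ga0 [Ez Ey]] := full_act_transitive q_mod4 dimV B_alternating B_nondegenerate
  (esym dz) (esym sz).
have Ga : a0 \in two_PSigmaSp B n := subsetP (two_PSp_sub n B) _ Ga0.
have rP := preserving_actV Ga sP.
have [||a1 Ga1 Er] := preserving_affine ef Y0E rP.
- by rewrite -/y0 -Ey; apply: (actKin to Ga).
- by rewrite -/z0 -Ez; apply: (actKin to Ga).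
have -> : s = actperm to (a1 * a0)%g.
  apply/permP => x; rewrite actpermE ?groupM // actMin // -(Er x).
  by rewrite actKVin.
by rewrite mem_morphim // groupM.
Qed.

End FullAutomorphismGroup.

Unset Implicit Arguments.

Theorem theorem6p3 (F : finFieldType) (n : nat) (V : vectType F)
    (B : {biscalar V}) (delta : forall X : lagr B n, detfun n (val X))
    (n_gt0 : (1 <= n)%N) (q_mod4 : #|F| = 1 %[mod 4])
    (dimV : \dim {:V} = (2 * n)%N)
    (B_alternating : forall x : V, B x x = 0)
    (B_nondegenerate : forall x : V, (forall y : V, B x y = 0) -> x = 0) :
  let R := cover_rel delta in
  let to := full_action delta in
  [/\ orbitals to (two_PSp B n) = relations R,
      orbitals to (two_PSigmaSp B n) = relations R,
      symmetric_scheme R,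
      schurian R &
      isom (two_PSigmaSp B n) (scheme_aut R) (actperm to)].
Proof.
move=> R to; split.
- exact: orbitals_two_PSp.
- exact: orbitals_two_PSigmaSp.
- exact: cover_symmetric_scheme.
- exact: cover_schurian.
rewrite -scheme_aut_actperm //; apply/isomP; split=> //.
exact: cover_isom_inj.
Qed.
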